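(* Let $u,w$ be two uncorrelated wide-sense stationary (second order, zero mean) generalized stochastic processes on $\mathbf R^d$ with spectral non-negative tempered Radon measures $\mu_u,\mu_w$ respectively, and let $v=u+w$. Then there is a unique convolution filter $f\in\mathscr F L^\infty(\mu_u+\mu_w)$ which, applied to $v$ as $$(u_o,\varphi)=(2\pi)^{-d/2}(v,f^**\varphi),\qquad \varphi\in\mathscr F L^2(\mu_u+\mu_w),$$ is mean square error optimal to recover $u$. It is $f=\mathscr F^{-1}\widehat f\in\mathscr S'(\mathbf R^d)$ where $\widehat f$ is the Radon--Nikodym derivative determined by $$\mu_u=\widehat f\,(\mu_u+\mu_w).$$ Moreover $0\le\widehat f(\xi)\le 1$ for $(\mu_u+\mu_w)$-a.e. $\xi\in\mathbf R^d$, $$\operatorname{ess\,supp}\widehat f=\operatorname{supp}\mu_u,$$ and the minimal error for $\varphi\in\mathscr F L^2(\mu_u+\mu_w)$ is $$J(\varphi)=\mathbf E\,|(u-u_o,\varphi)|^2=\int_{\mathbf R^d}\widehat f(\xi)\,|\widehat\varphi(\xi)|^2\,\mathrm d\mu_w(\xi)=\int_{\mathbf R^d}\bigl(1-\widehat f(\xi)\bigr)|\widehat\varphi(\xi)|^2\,\mathrm d\mu_u(\xi).$$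
   Context: Let $(\Omega,\mathscr B,\mathbf P)$ be a probability space and $L_0^2(\Omega)$ the Hilbert space of complex zero mean random variables with finite variance, with inner product $\mathbf E(X\overline Y)$. A (second order zero mean) generalized stochastic process (GSP) on $\mathbf R^d$ is a continuous conjugate linear map $u:C_c^\infty(\mathbf R^d)\to L_0^2(\Omega)$, $\varphi\mapsto(u,\varphi)$. Two GSPs $u,w$ are uncorrelated if $\mathbf E((u,\varphi)\overline{(w,\psi)})=0$ for all $\varphi,\psi\in C_c^\infty(\mathbf R^d)$. A GSP $u$ is wide-sense stationary (WSS) if $\mathbf E((u,T_x\varphi)\overline{(u,T_x\psi)})=\mathbf E((u,\varphi)\overline{(u,\psi)})$ for all $x\in\mathbf R^d$ and all $\varphi,\psi\in C_c^\infty(\mathbf R^d)$, where $T_x\varphi(y)=\varphi(y-x)$. Fourier transform: $\widehat f(\xi)=\mathscr F f(\xi)=(2\pi)^{-d/2}\int_{\mathbf R^d} f(x)e^{-i\langle x,\xi\rangle}\mathrm dx$. A non-negative Radon measure $\mu$ on $\mathbf R^d$ is tempered if $\int(1+|x|^2)^{-s/2}\mathrm d\mu(x)<\infty$ for some $s\ge0$. By the Bochner--Schwartz theorem every WSS GSP $u$ has a spectral measure: the unique non-negative tempered Radon measure $\mu_u$ such that $\mathbf E((u,\varphi)\overline{(u,\psi)})=\int_{\mathbf R^d}\widehat\psi(\xi)\overline{\widehat\varphi(\xi)}\,\mathrm d\mu_u(\xi)$ for all $\varphi,\psi\in C_c^\infty(\mathbf R^d)$. For a non-negative tempered Radon measure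 $\mu$, $\mathscr F L^2(\mu)$ is the Hilbert space of elements $\varphi$ represented by $\widehat\varphi\in L^2(\mu)$, with norm $\|\varphi\|_{\mathscr F L^2(\mu)}=(\int|\widehat\varphi|^2\mathrm d\mu)^{1/2}$; the Schwartz space $\mathscr S(\mathbf R^d)$ is mapped continuously and densely (not necessarily injectively) into it by sending $\varphi$ to the class of $\widehat\varphi$. $\mathscr F L^\infty(\mu)$ is the space of $f\in\mathscr S'(\mathbf R^d)$ with $\widehat f\in L^\infty(\mu)$, where $g\in L^\infty(\mu)$ is identified with the tempered distribution $\varphi\mapsto\int g\,\overline\varphi\,\mathrm d\mu$. With $\mu=\mu_u+\mu_w$ (the spectral measure of $v=u+w$), the maps $u$, $w$, $v$ extend continuously from $C_c^\infty(\mathbf R^d)$ to $\mathscr F L^2(\mu)$. For $f\in\mathscr F L^\infty(\mu)$ and $\varphi\in\mathscr F L^2(\mu)$, $(2\pi)^{-d/2}f^**\varphi$ denotes the element of $\mathscr F L^2(\mu)$ whose Fourier transform is $\overline{\widehat f}\,\widehat\varphi$ (corresponding to $f^*(x)=\overline{f(-x)}$). Mean square error optimal means: for every $\varphi\in\mathscr F L^2(\mu)$ the error $\mathbf E|(u,\varphi)-(u_o,\varphi)|^2$ is minimal among all convolution filters $f\in\mathscr F L^\infty(\mu)$. The identity $\mu_u=\widehat f(\mu_u+\mu_w)$ means $\mu_u(A)=\int_A\widehat f\,\mathrm d(\mu_u+\mu_w)$ for all Borel sets $A\subseteq\mathbf R^d$. The essential support $\operatorname{ess\,supp}\widehat f$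 is the complement of the largest open set on which $\widehat f=0$ $(\mu_u+\mu_w)$-a.e. *)

(* Defs.v *)
From HB Require Import structures.
From mathcomp Require Import all_boot all_order all_algebra.
From mathcomp Require Import all_classical all_reals all_analysis.
From mathcomp Require Import measurable_realfun complex.

Import Order.TTheory GRing.Theory Num.Theory numFieldNormedType.Exports.
Set Implicit Arguments.
Unset Strict Implicit.
Unset Printing Implicit Defensive.

Local Open Scope classical_set_scope.
Local Open Scope ring_scope.
Local Open Scope complex_scope.

(* R^d is 'rV[R]_d, with the sigma-algebra generated by the open sets of its
   library topology (the usual one), i.e. the Borel sets. *)
Definition rV_display : measure_display. Proof. exact: default_measure_display. Qed.

Section borel_rV.
Variables (R : realType) (d : nat).

HB.instance Definition _ := @isMeasurable.Build rV_display 'rV[R]_d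
  <<s @open 'rV[R]_d >> (@sigma_algebra0 _ setT _)
  (@sigma_algebraC _ _) (@sigma_algebra_bigcup _ setT _).

Lemma open_measurable_rV (U : set 'rV[R]_d) : open U -> measurable U.
Proof. exact: sub_sigma_algebra. Qed.

Lemma measurable_coord_rV (i : 'I_d) :
  measurable_fun [set: 'rV[R]_d] (fun x : 'rV[R]_d => x ord0 i).
Proof.
apply: (measurability _ (RGenInftyO.measurableE R)) => _ [_ [a ->] <-].
rewrite setTI; apply: open_measurable_rV; apply: open_comp; last exact: interval_open.
by move=> x _; exact: coord_continuous.
Qed.

Let box (q : 'rV[rat]_d) (k : nat) : set 'rV[R]_d :=
  [set x | forall j, `|x ord0 j - ratr (q ord0 j)| < k.+1%:R^-1].

Lemma open_rV_boxes (U : set 'rV[R]_d) : open U ->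
  U = \bigcup_(qk in [set qk | box qk.1 qk.2 `<=` U]) box qk.1 qk.2.
Proof.
move=> oU; apply/seteqP; split=> [x Ux|x [qk /= qkU]]; last exact: qkU.
have /nbhs_ballP[e e0 xeU] : nbhs x U by exact: open_nbhs_nbhs.
have [k ke] : exists k : nat, k.+1%:R^-1 < e / 2 :> R.
  have e20 : 0 < e / 2 by rewrite divr_gt0.
  have [k _ /(_ k (leqnn k))] := near_infty_natSinv_lt (PosNum e20).
  by exists k.
have /choice[q qx] : forall j : 'I_d, exists q : rat, `|x ord0 j - ratr q| < k.+1%:R^-1.
  move=> j; have : x ord0 j - k.+1%:R^-1 < x ord0 j by rewrite ltrBlDr ltrDl.
  move=> /rat_in_itvoo[q]; rewrite in_itv/= => /andP[q1 q2]; exists q.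
  by rewrite gtr0_norm ?subr_gt0// ltrBlDr -ltrBlDl.
exists (\row_j q j, k) => /=; last by move=> j; rewrite mxE.
move=> y ydist; apply: xeU; split=> // i j; rewrite (ord1 i) /ball/=.
have := ydist j; rewrite mxE => yj.
rewrite -[ltLHS]/(`| _ |) (splitr e).
rewrite -(subrKA (ratr (q j))) (le_lt_trans (ler_normD _ _))//.
rewrite ltrD//; [exact: lt_trans ke|rewrite distrC; exact: lt_trans ke].
Qed.

Lemma measurable_fun_rV dT (T : measurableType dT) (f : T -> 'rV[R]_d) :
  (forall j, measurable_fun setT (fun t => f t ord0 j)) ->
  measurable_fun setT f.
Proof.
move=> mf; apply: (@measurability _ _ _ _ _ _ (@open 'rV[R]_d)) => //.
move=> _ [U oU <-]; rewrite setTI (open_rV_boxes oU) preimage_bigcup bigcup_mkcond.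
apply: countable_bigcupT_measurable => //= qk.
case: ifPn => // _.
rewrite (_ : _ @^-1` _ = \bigcap_(j in [set: 'I_d])
   ((fun t => `|f t ord0 j - ratr (qk.1 ord0 j)|) @^-1` `]-oo, qk.2.+1%:R^-1[)).
  apply: fin_bigcap_measurable => [|j _]; first exact: finite_finset.
  rewrite -[X in measurable X]setTI.
  suff : measurable_fun setT (fun t => `|f t ord0 j - ratr (qk.1 ord0 j)|) by apply.
  apply: measurableT_comp => //; exact: measurable_funB.
apply/seteqP; split=> t /= h j; first by move=> _; rewrite /= in_itv/=.
by have := h j I; rewrite /= in_itv.
Qed.

End borel_rV.

Section lebesgue_rV.
Variable R : realType.

Definition cons_rV d (p : R * 'rV[R]_d) : 'rV[R]_d.+1 := row_mx p.1%:M p.2.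

Lemma cons_rV0 d (p : R * 'rV[R]_d) : cons_rV p ord0 ord0 = p.1.
Proof.
by rewrite mxE; case: splitP => k //= _; rewrite (ord1 k) mxE eqxx mulr1n.
Qed.

Lemma cons_rVS d (p : R * 'rV[R]_d) i : cons_rV p ord0 (lift ord0 i) = p.2 ord0 i.
Proof.
rewrite mxE; case: splitP => k /= ek; first by rewrite (ord1 k) in ek.
by congr (_ _ _); apply: val_inj; case: ek.
Qed.

Lemma measurable_cons_rV d : measurable_fun setT (@cons_rV d).
Proof.
apply: measurable_fun_rV => j; case: (unliftP ord0 j) => [i|] ->.
  apply: (@eq_measurable_fun _ _ _ _ _ (fun p : R * 'rV[R]_d => p.2 ord0 i)).
    by move=> p _; rewrite cons_rVS.
  apply: (measurableT_comp (f := fun x : 'rV[R]_d => x ord0 i)) => //.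
  exact: measurable_coord_rV.
apply: (@eq_measurable_fun _ _ _ _ _ (fun p : R * 'rV[R]_d => p.1)).
  by move=> p _; rewrite cons_rV0.
exact: measurable_fst.
Qed.

Definition uncons_rV d (x : 'rV[R]_d.+1) : R * 'rV[R]_d :=
  (x ord0 ord0, \row_j x ord0 (lift ord0 j)).

Lemma measurable_uncons_rV d : measurable_fun setT (@uncons_rV d).
Proof.
apply/measurable_fun_pairP => /=; split; first exact: measurable_coord_rV.
apply: measurable_fun_rV => j.
apply: (@eq_measurable_fun _ _ _ _ _ (fun x : 'rV[R]_d.+1 => x ord0 (lift ord0 j))).
  by move=> x _; rewrite /= mxE.
exact: measurable_coord_rV.
Qed.

Lemma cons_rVK d : cancel (@cons_rV d) (@uncons_rV d).
Proof.
move=> [a x]; rewrite /uncons_rV cons_rV0; congr pair.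
by apply/rowP => j; rewrite mxE cons_rVS.
Qed.

Section lebesgue_cons.
Variables (d : nat) (m : {sigma_finite_measure set 'rV[R]_d -> \bar R}).

Let lebesgue1 : {sigma_finite_measure set (measurableTypeR R) -> \bar R} :=
  @lebesgue_measure R.

Definition lebesgue_cons : set 'rV[R]_d.+1 -> \bar R :=
  pushforward (lebesgue1 \x m)%E (@cons_rV d).

HB.instance Definition _ := Measure.copy lebesgue_cons
  (measure_function_pushforward__canonical__measure_function_Measure
    (lebesgue1 \x m)%E (@measurable_cons_rV d)).

Let sigma_finite_lebesgue_cons : sigma_finite setT lebesgue_cons.
Proof.
have /sigma_finiteP[F [TF ndF Foo]] := sigma_finiteT lebesgue1.
have /sigma_finiteP[G [TG ndG Goo]] := sigma_finiteT m.
exists (fun k => @uncons_rV d @^-1` (F k `*` G k)).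
  rewrite -preimage_bigcup -[LHS](preimage_setT (@uncons_rV d)).
  congr (_ @^-1` _); apply/seteqP; split => -[x y] // _.
  have [[k _ Fx] [l _ Gy]] : (\bigcup_k F k) x /\ (\bigcup_k G k) y.
    by rewrite -TF -TG.
  exists (maxn k l) => //; split=> /=.
    by move: x Fx; exact/subsetPset/ndF/leq_maxl.
  by move: y Gy; exact/subsetPset/ndG/leq_maxr.
move=> k; have [mF Fk] := Foo k; have [mG Gk] := Goo k.
have mFG := measurableX mF mG; split.
  by rewrite -[X in measurable X]setTI; exact: measurable_uncons_rV.
rewrite /lebesgue_cons /pushforward -comp_preimage.
rewrite (_ : _ \o _ = id) ?preimage_id; last first.
  by apply/funext => p /=; rewrite cons_rVK.
by rewrite product_measure1E// lte_mul_pinfty// ge0_fin_numE.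
Qed.

HB.instance Definition _ := Measure_isSigmaFinite.Build _ _ _ lebesgue_cons
  sigma_finite_lebesgue_cons.

End lebesgue_cons.

(* Lebesgue measure on R^d: the d-fold product of the one of R, transported
   along (a, x) |-> (a, x_0, ..., x_{d-1}); see lebesgue_rV_box below. *)
Fixpoint lebesgue_rV (d : nat) : {sigma_finite_measure set 'rV[R]_d -> \bar R} :=
  if d is d'.+1 then lebesgue_cons (lebesgue_rV d') else dirac (0 : 'rV[R]_0).

End lebesgue_rV.

Lemma measurable_box_rV (R : realType) d (A : 'I_d -> set R) :
  (forall i, measurable (A i)) ->
  measurable [set x : 'rV[R]_d | forall i, A i (x ord0 i)].
Proof.
move=> mA; rewrite (_ : mkset _ = \bigcap_(i in [set: 'I_d])
    ((fun x : 'rV[R]_d => x ord0 i) @^-1` A i)); last first.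
  by apply/seteqP; split=> x /= h i *; exact: h.
apply: fin_bigcap_measurable => [|i _]; first exact: finite_finset.
by rewrite -[X in measurable X]setTI; exact: measurable_coord_rV.
Qed.

Lemma lebesgue_rV_box (R : realType) d (A : 'I_d -> set R) :
  (forall i, measurable (A i)) ->
  lebesgue_rV R d [set x | forall i, A i (x ord0 i)] =
  (\prod_(i < d) lebesgue_measure (A i))%E.
Proof.
elim: d A => [A _|d IH A mA].
  by rewrite big_ord0 /= diracE mem_set//= => -[].
have mA' := measurable_box_rV (fun i => mA (lift ord0 i)).
rewrite big_ord_recl -IH//; apply: etrans (product_measure1E
  (@lebesgue_measure R) (lebesgue_rV R d) (mA ord0) mA').
rewrite /= /lebesgue_cons /pushforward; congr (_ _).
apply/seteqP; split=> [[a x] /= h|[a x] /= [h0 h] i].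
  split; first by have := h ord0; rewrite cons_rV0.
  by move=> i /=; have := h (lift ord0 i); rewrite cons_rVS.
by case: (unliftP ord0 i) => [j|] ->; rewrite ?cons_rV0 ?cons_rVS.
Qed.

Section complex_functions.
Context (R : realType) (d : measure_display) (T : measurableType d).
Implicit Types (mu : {measure set T -> \bar R}) (f g : T -> R[i]).

Definition sqnorm (z : R[i]) : R := Normc.normc z ^+ 2.

Definition cmeasurable f :=
  measurable_fun [set: T] (fun x => complex.Re (f x)) /\
  measurable_fun [set: T] (fun x => complex.Im (f x)).

Definition cintegral mu f : R[i] :=
  (\int[mu]_x complex.Re (f x)) +i* (\int[mu]_x complex.Im (f x)).

(* Elements of L^2 are represented by functions, up to a.e. equality. *)
Definition inL2 mu f :=
  cmeasurable f /\ (\int[mu]_x (sqnorm (f x))%:E < +oo)%E.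

Definition L2sqdist mu f g : \bar R := (\int[mu]_x (sqnorm (f x - g x))%:E)%E.

Definition inLinf mu f :=
  cmeasurable f /\ exists M : R, {ae mu, forall x, Normc.normc (f x) <= M}.

(* L^2_0: complex zero mean random variables with finite variance *)
Definition inL20 mu f := inL2 mu f /\ cintegral mu f = 0.

End complex_functions.

Section test_functions.
Context (R : realType) (d : nat).
Implicit Types (phi psi : 'rV[R]_d -> R[i]) (V : set ('rV[R]_d -> R[i])).

Definition dotp (x y : 'rV[R]_d) : R := \sum_(i < d) x ord0 i * y ord0 i.

(* 1 + |x|^2 for the Euclidean norm (the library norm on 'rV is the sup norm) *)
Definition bracket (x : 'rV[R]_d) : R := 1 + dotp x x.

Definition pderiv (j : 'I_d) phi : 'rV[R]_d -> R[i] := fun x =>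
  ('D_(delta_mx ord0 j) (fun y => complex.Re (phi y)) x) +i*
  ('D_(delta_mx ord0 j) (fun y => complex.Im (phi y)) x).

(* Iterated partial derivatives are indexed by lists of directions rather than
   by multi-indices; |alpha| is the length of the list. *)
Definition pderivs (s : seq 'I_d) phi := foldr pderiv phi s.

Definition smooth phi := forall s : seq 'I_d,
  [/\ continuous (fun y => complex.Re (pderivs s phi y)),
      continuous (fun y => complex.Im (pderivs s phi y)) &
      forall (j : 'I_d) (x : 'rV[R]_d),
        derivable (fun y => complex.Re (pderivs s phi y)) x (delta_mx ord0 j) /\
        derivable (fun y => complex.Im (pderivs s phi y)) x (delta_mx ord0 j)].

Definition supported_in (K : set 'rV[R]_d) phi := forall x, ~ K x -> phi x = 0.

(* C_c^oo(R^d) *)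
Definition test_function phi :=
  smooth phi /\ exists2 K, compact K & supported_in K phi.

(* Basic neighborhoods of 0 in the inductive limit topology of C_c^oo(R^d):
   absolutely convex sets whose trace on each space of test functions supported
   in a compact K is a neighborhood of 0 for uniform convergence of all
   derivatives. *)
Definition test_nbhs0 V :=
  (forall phi psi (a b : R[i]), test_function phi -> test_function psi ->
     V phi -> V psi -> Normc.normc a + Normc.normc b <= 1 ->
     V (fun x => a * phi x + b * psi x)) /\
  (forall K : set 'rV[R]_d, compact K ->
     exists (k : nat) (delta : R), 0 < delta /\
       forall phi, test_function phi -> supported_in K phi ->
         (forall s, (size s <= k)%N ->
            forall x, Normc.normc (pderivs s phi x) <= delta) ->
         V phi).

(* S(R^d) *)
Definition schwartz phi := smooth phi /\
  forall (N : nat) (s : seq 'I_d), exists C : R,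
    forall x, bracket x ^+ N * Normc.normc (pderivs s phi x) <= C.

Definition schwartz_ball (N k : nat) (delta : R) phi :=
  forall s : seq 'I_d, (size s <= k)%N ->
    forall x, bracket x ^+ N * Normc.normc (pderivs s phi x) <= delta.

Definition translate (x : 'rV[R]_d) phi : 'rV[R]_d -> R[i] :=
  fun y => phi (y - x).

(* (2 pi)^{-d/2} int phi(x) e^{-i <x, xi>} dx *)
Definition fourier phi : 'rV[R]_d -> R[i] := fun xi =>
  ((2 * pi) `^ (- (d%:R / 2)))%:C *
  cintegral (lebesgue_rV R d)
    (fun x => phi x * (cos (dotp x xi) -i* sin (dotp x xi))).

(* Tempered distributions act conjugate linearly. Such an f is only meaningful
   on Schwartz functions, and equality in S' is equality there. *)
Definition tempered_distribution (f : ('rV[R]_d -> R[i]) -> R[i]) :=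
  (forall (a : R[i]) phi psi, schwartz phi -> schwartz psi ->
     f (fun x => a * phi x + psi x) = a^* * f phi + f psi) /\
  (forall phi, schwartz phi -> forall eps : R, 0 < eps ->
     exists (N k : nat) (delta : R), 0 < delta /\
       forall psi, schwartz psi -> schwartz_ball N k delta (fun x => psi x - phi x) ->
         Normc.normc (f psi - f phi) <= eps).

End test_functions.

Section tempered_measures.
Context (R : realType) (d : nat).
Implicit Types (mu nu : {measure set 'rV[R]_d -> \bar R}).

(* On R^d, Borel measures that are finite on compact sets are regular. *)
Definition radon mu := forall K : set 'rV[R]_d, compact K -> (mu K < +oo)%E.

Definition tempered mu := exists2 s : R, 0 <= s &
  (\int[mu]_x (bracket x `^ (- (s / 2)))%:E < +oo)%E.

(* complement of the largest open null set *)
Definition supp mu : set 'rV[R]_d :=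
  ~` \bigcup_(U in [set U | open U /\ mu U = 0%E]) U.

(* complement of the largest open set on which h = 0 a.e. *)
Definition ess_supp mu (h : 'rV[R]_d -> R) : set 'rV[R]_d :=
  ~` \bigcup_(U in [set U | open U /\ {ae mu, forall x, U x -> h x = 0}]) U.

(* nu = h mu *)
Definition density mu nu (h : 'rV[R]_d -> R) :=
  measurable_fun [set: 'rV[R]_d] h /\
  forall A, measurable A -> nu A = (\int[mu]_(x in A) (h x)%:E)%E.

(* The tempered distribution f has Fourier transform h in L^oo(mu), where h is
   identified with phi |-> int h phi^* dmu, and the Fourier transform on S' is
   given by (F f, F phi) = (f, phi) for phi in S. *)
Definition has_fourier_Linf mu (f : ('rV[R]_d -> R[i]) -> R[i])
    (h : 'rV[R]_d -> R[i]) :=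
  [/\ tempered_distribution f, inLinf mu h &
      forall phi, schwartz phi ->
        cintegral mu (fun xi => h xi * (fourier phi xi)^*) = f phi].

Definition FLinf mu f := exists h, has_fourier_Linf mu f h.

Definition fourier_Linf mu f : 'rV[R]_d -> R[i] :=
  xget (fun=> 0) [set h | has_fourier_Linf mu f h].

(* An element phi of F L^2(mu) is represented by its Fourier transform g, with
   inL2 mu g. The Fourier transform of f^* * phi is
   (2 pi)^{d/2} (F f)^* g, where f^*(x) = f(-x)^*. *)
Definition star_conv mu f (g : 'rV[R]_d -> R[i]) : 'rV[R]_d -> R[i] :=
  fun xi => ((2 * pi) `^ (d%:R / 2))%:C * ((fourier_Linf mu f xi)^* * g xi).

End tempered_measures.

Section generalized_stochastic_processes.
Context (R : realType) (d : nat).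
Context (d' : measure_display) (T : measurableType d') (P : probability T R).
Implicit Types (u v w : ('rV[R]_d -> R[i]) -> T -> R[i]).
Implicit Types (mu : {measure set 'rV[R]_d -> \bar R}).

(* u phi is the random variable (u, phi), relevant for phi in C_c^oo only. *)
Definition gsp u :=
  [/\ forall phi, test_function phi -> inL20 P (u phi),
      forall (a : R[i]) phi psi, test_function phi -> test_function psi ->
        {ae P, forall t,
          u (fun x => a * phi x + psi x) t = a^* * u phi t + u psi t} &
      forall phi, test_function phi -> forall eps : R, 0 < eps ->
        exists2 V, test_nbhs0 V &
          forall psi, test_function psi -> V (fun x => psi x - phi x) ->
            (L2sqdist P (u psi) (u phi) < eps%:E)%E].

Definition gsp_add u w := fun phi t => u phi t + w phi t.

Definition covariance_gsp u w phi psi : R[i] :=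
  cintegral P (fun t => u phi t * (w psi t)^*).

Definition uncorrelated_gsp u w := forall phi psi,
  test_function phi -> test_function psi -> covariance_gsp u w phi psi = 0.

Definition wss u := forall (x : 'rV[R]_d) phi psi,
  test_function phi -> test_function psi ->
  covariance_gsp u u (translate x phi) (translate x psi) =
  covariance_gsp u u phi psi.

Definition spectral_measure u mu :=
  [/\ radon mu, tempered mu &
      forall phi psi, test_function phi -> test_function psi ->
        covariance_gsp u u phi psi =
        cintegral mu (fun xi => fourier psi xi * (fourier phi xi)^*)].

(* U is a continuous map from F L^2(mu) to L^2_0 that extends u. *)
Definition continuous_extension mu u U :=
  [/\ forall g, inL2 mu g -> inL20 P (U g),
      forall g, inL2 mu g -> forall eps : R, 0 < eps ->
        exists2 delta : R, 0 < delta &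
          forall h, inL2 mu h -> (L2sqdist mu h g < delta%:E)%E ->
            (L2sqdist P (U h) (U g) < eps%:E)%E &
      forall phi, test_function phi ->
        {ae P, forall t, U (fourier phi) t = u phi t}].

(* (u, phi) for phi in F L^2(mu) is gsp_ext mu u g, where g is the Fourier
   transform of phi. *)
Definition gsp_ext mu u : ('rV[R]_d -> R[i]) -> T -> R[i] :=
  xget (fun _ _ => 0) [set U | continuous_extension mu u U].

(* (u_o, phi) = (2 pi)^{-d/2} (v, f^* * phi) *)
Definition filter_output mu v f (g : 'rV[R]_d -> R[i]) : T -> R[i] := fun t =>
  ((2 * pi) `^ (- (d%:R / 2)))%:C * gsp_ext mu v (star_conv mu f g) t.

(* E |(u, phi) - (u_o, phi)|^2 *)
Definition mse mu u v f (g : 'rV[R]_d -> R[i]) : \bar R :=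
  L2sqdist P (gsp_ext mu u g) (filter_output mu v f g).

Definition mse_optimal mu u v f :=
  FLinf mu f /\
  forall f', FLinf mu f' ->
    forall g, inL2 mu g -> (mse mu u v f g <= mse mu u v f' g)%E.

End generalized_stochastic_processes.

(* Main.v *)
(* For test functions, uncorrelatedness gives
     E|(u, phi) - c (v, psi)|^2 = int |F phi - c F psi|^2 dmu_u + int |c F psi|^2 dmu_w,
   and this persists for the extensions of u and v to L^2(mu), since the
   transforms of test functions are dense there.  If h is the transform of a
   filter and fhat = dmu_u/dmu, then completing the square turns its error into
     int |g|^2 |h - fhat|^2 dmu + int fhat (1 - fhat) |g|^2 dmu,
   which is minimal for all g exactly when h = fhat a.e.
   For the density, the closure W of the transforms of test functions in
   L^2(mu) is stable under multiplication by cos <a, .> and sin <a, .>, because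
   test functions can be translated.  The bounded real multipliers of W form an
   algebra stable under bounded pointwise limits; iterating (3 t - t^3) / 2, it
   is stable under the sign function, so it contains
   sgn (x_j - c) = lim_n sgn (sin ((x_j - c) / n)), hence the indicators of Borel
   sets, hence all bounded measurable functions.  Since W contains transforms of
   bump functions with a positive real part on an arbitrarily large ball, it is
   all of L^2(mu). *)

Require Import Defs.
From HB Require Import structures.
From mathcomp Require Import all_boot all_order all_algebra.
From mathcomp Require Import all_classical all_reals all_analysis.
From mathcomp Require Import measurable_realfun complex ring lra.

Import Order.TTheory GRing.Theory Num.Theory numFieldNormedType.Exports.
Set Implicit Arguments.
Unset Strict Implicit.
Unset Printing Implicit Defensive.

Local Open Scope classical_set_scope.
Local Open Scope ring_scope.
Local Open Scope complex_scope.

(** The spectral measures are only tempered, so [mu] may be infinite and constants need not lie in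
    L^2(mu). Powers of [bracket] repair this wherever finiteness is wanted: they make a measure
    finite before the Radon-Nikodym theorem is applied, they turn the pairing of an L^oo function
    with a transform into a product of two L^2 functions, and they supply a nowhere vanishing
    element of L^2(mu) on which two filters can be compared. [gsp_ext] and [fourier_Linf] are
    arbitrary choices among the objects with a given property. Existence must be proved before
    anything is known about them (by completeness of L^2(P) for the first one), and afterwards only
    the defining property may be used: the extensions are reached through test functions, and the
    transform of a filter is known only up to a [mu]-null set. Norms enter squared, with values in
    the extended reals, so the triangle inequality takes the form |x + y|^2 <= (1 + e) |x|^2 + (1 +
    1/e) |y|^2, with e = 1 for rough estimates and e -> 0 to pass to the limit in exact
    identities. *)

Local Notation normc := Normc.normc.

(** * Square integrable complex functions *)

Section complex_numbers.
Variable R : realType.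
Implicit Types (x y z : R[i]) (r : R).

Lemma RecD x y : complex.Re (x + y) = complex.Re x + complex.Re y.
Proof. by case: x; case: y. Qed.

Lemma ImcD x y : complex.Im (x + y) = complex.Im x + complex.Im y.
Proof. by case: x; case: y. Qed.

Lemma RecN x : complex.Re (- x) = - complex.Re x.
Proof. by case: x. Qed.

Lemma ImcN x : complex.Im (- x) = - complex.Im x.
Proof. by case: x. Qed.

Lemma RecM x y :
  complex.Re (x * y) = complex.Re x * complex.Re y - complex.Im x * complex.Im y.
Proof. by case: x; case: y. Qed.

Lemma ImcM x y :
  complex.Im (x * y) = complex.Re x * complex.Im y + complex.Im x * complex.Re y.
Proof. by case: x; case: y. Qed.

Lemma RecJ x : complex.Re x^* = complex.Re x.
Proof. by case: x. Qed.

Lemma ImcJ x : complex.Im x^* = - complex.Im x.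
Proof. by case: x. Qed.

Definition ReImE := (RecD, ImcD, RecN, ImcN, RecM, ImcM, RecJ, ImcJ).

Lemma eq_ReIm x y :
  complex.Re x = complex.Re y -> complex.Im x = complex.Im y -> x = y.
Proof. by case: x => a b; case: y => c e /= -> ->. Qed.

Lemma sqnormE z : sqnorm z = complex.Re z ^+ 2 + complex.Im z ^+ 2.
Proof.
by case: z => a b; rewrite /sqnorm /= sqr_sqrtr// addr_ge0// sqr_ge0.
Qed.

Lemma sqnorm_ge0 z : 0 <= sqnorm z. Proof. exact: sqr_ge0. Qed.

Lemma sqnormM x y : sqnorm (x * y) = sqnorm x * sqnorm y.
Proof. by rewrite !sqnormE !ReImE; ring. Qed.

Lemma sqnormN x : sqnorm (- x) = sqnorm x.
Proof. by rewrite !sqnormE !ReImE; ring. Qed.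

Lemma sqnormC r : sqnorm r%:C = r ^+ 2.
Proof. by rewrite sqnormE /= expr0n addr0. Qed.

Lemma sqnorm0 : sqnorm (0 : R[i]) = 0.
Proof. by rewrite sqnormE /= expr0n addr0. Qed.

Lemma sqnorm_eq0 z : sqnorm z = 0 -> z = 0.
Proof.
rewrite sqnormE => /eqP; rewrite paddr_eq0 ?sqr_ge0// !sqrf_eq0 => /andP[/eqP a /eqP b].
exact: eq_ReIm.
Qed.

(** Weighted Young inequality: the gap between the two sides is a square divided by [e]. Small [e]
    brings the factor of [sqnorm x] close to 1, so that equalities of squared norms survive an L^2
    approximation. *)
Lemma sqnormD_eps e x y : 0 < e ->
  sqnorm (x + y) <= (1 + e) * sqnorm x + (1 + e^-1) * sqnorm y.
Proof.
move=> e0; rewrite !sqnormE !ReImE.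
have h (a b : R) : (a + b) ^+ 2 <= (1 + e) * a ^+ 2 + (1 + e^-1) * b ^+ 2.
  have -> : (1 + e) * a ^+ 2 + (1 + e^-1) * b ^+ 2 =
     (a + b) ^+ 2 + e^-1 * (e * a - b) ^+ 2 by field; rewrite gt_eqF.
  by rewrite lerDl mulr_ge0 ?sqr_ge0// invr_ge0 ltW.
by have := h (complex.Re x) (complex.Re y); have := h (complex.Im x) (complex.Im y); lra.
Qed.

Lemma sqnormD_le x y : sqnorm (x + y) <= 2 * sqnorm x + 2 * sqnorm y.
Proof. by have := sqnormD_eps x y ltr01; rewrite invr1; lra. Qed.

Lemma sqr_Re_le z : complex.Re z ^+ 2 <= sqnorm z.
Proof. by rewrite sqnormE lerDl sqr_ge0. Qed.

Lemma sqr_Im_le z : complex.Im z ^+ 2 <= sqnorm z.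
Proof. by rewrite sqnormE lerDr sqr_ge0. Qed.

Lemma normc_ge0 z : 0 <= normc z.
Proof. by case: z => a b; rewrite /= sqrtr_ge0. Qed.

Lemma normcC r : normc r%:C = `|r|.
Proof. by rewrite /= expr0n/= addr0 sqrtr_sqr. Qed.

Lemma Re_le_normc z : `|complex.Re z| <= normc z.
Proof. by rewrite -(@ler_pXn2r _ 2) ?nnegrE ?normc_ge0// real_normK ?num_real// sqr_Re_le. Qed.

Lemma Im_le_normc z : `|complex.Im z| <= normc z.
Proof. by rewrite -(@ler_pXn2r _ 2) ?nnegrE ?normc_ge0// real_normK ?num_real// sqr_Im_le. Qed.

Lemma normc_le_ReIm z : normc z <= `|complex.Re z| + `|complex.Im z|.
Proof.
rewrite -(@ler_pXn2r _ 2) ?nnegrE ?normc_ge0 ?addr_ge0// -/(sqnorm z) sqnormE.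
rewrite -(real_normK (num_real (complex.Re z))) -(real_normK (num_real (complex.Im z))).
by rewrite sqrrD lerD2r lerDl mulrn_wge0// mulr_ge0.
Qed.

Lemma sqnorm_le_bound z r : normc z <= r -> sqnorm z <= r ^+ 2.
Proof.
by move=> zr; rewrite /sqnorm ler_pXn2r// nnegrE ?normc_ge0// (le_trans (normc_ge0 z)).
Qed.

End complex_numbers.

Section square_integrable.
Context (R : realType) (d : measure_display) (T : measurableType d).
Variable mu : {measure set T -> \bar R}.
Implicit Types (f g h : T -> R[i]) (r s : T -> R).

Lemma le_nnint r s : measurable_fun setT r -> measurable_fun setT s ->
  (forall x, 0 <= r x) -> (forall x, r x <= s x) ->
  (\int[mu]_x (r x)%:E <= \int[mu]_x (s x)%:E)%E.
Proof.
move=> mr ms r0 rs; apply: ge0_le_integral => //.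
- by move=> x _; rewrite lee_fin.
- exact/measurable_EFinP.
- exact/measurable_EFinP.
- by move=> x _; rewrite lee_fin.
Qed.

Lemma nnintD r s : measurable_fun setT r -> measurable_fun setT s ->
  (forall x, 0 <= r x) -> (forall x, 0 <= s x) ->
  (\int[mu]_x (r x + s x)%:E = \int[mu]_x (r x)%:E + \int[mu]_x (s x)%:E)%E.
Proof.
move=> mr ms r0 s0; under eq_integral do rewrite EFinD.
rewrite ge0_integralD//.
- by move=> x _; rewrite lee_fin.
- exact/measurable_EFinP.
- by move=> x _; rewrite lee_fin.
- exact/measurable_EFinP.
Qed.

Lemma nnintZ (k : R) r : measurable_fun setT r -> (forall x, 0 <= r x) -> 0 <= k ->
  (\int[mu]_x (k * r x)%:E = k%:E * \int[mu]_x (r x)%:E)%E.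
Proof.
move=> mr r0 k0; under eq_integral do rewrite EFinM.
rewrite ge0_integralZl_EFin//.
- by move=> x _; rewrite lee_fin.
- exact/measurable_EFinP.
Qed.

Lemma nnint_ge0 r : (forall x, 0 <= r x) -> (0 <= \int[mu]_x (r x)%:E)%E.
Proof. by move=> r0; apply: integral_ge0 => x _; rewrite lee_fin. Qed.

Lemma integrable_nnint r : measurable_fun setT r -> (forall x, 0 <= r x) ->
  (\int[mu]_x (r x)%:E < +oo)%E -> mu.-integrable setT (EFin \o r).
Proof.
move=> mr r0 roo; apply/integrableP; split; first exact/measurable_EFinP.
by under eq_integral do rewrite /= ger0_norm//.
Qed.

Lemma le_integrable_real r s : measurable_fun setT r -> (forall x, `|r x| <= s x) ->
  mu.-integrable setT (EFin \o s) -> mu.-integrable setT (EFin \o r).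
Proof.
move=> mr rs; apply: le_integrable => //; first exact/measurable_EFinP.
by move=> x _ /=; rewrite lee_fin (le_trans (rs x))// ler_norm.
Qed.

Lemma cmeasurableD f g : cmeasurable f -> cmeasurable g ->
  cmeasurable (fun x => f x + g x).
Proof.
move=> [f1 f2] [g1 g2]; split.
- by under eq_fun do rewrite RecD; exact: measurable_funD.
- by under eq_fun do rewrite ImcD; exact: measurable_funD.
Qed.

Lemma cmeasurableM f g : cmeasurable f -> cmeasurable g ->
  cmeasurable (fun x => f x * g x).
Proof.
move=> [f1 f2] [g1 g2]; split.
- under eq_fun do rewrite RecM.
  by apply: measurable_funB; exact: measurable_funM.
- under eq_fun do rewrite ImcM.
  by apply: measurable_funD; exact: measurable_funM.
Qed.

Lemma cmeasurableN f : cmeasurable f -> cmeasurable (fun x => - f x).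
Proof.
move=> [f1 f2]; split.
- by under eq_fun do rewrite RecN; exact: measurableT_comp.
- by under eq_fun do rewrite ImcN; exact: measurableT_comp.
Qed.

Lemma cmeasurableB f g : cmeasurable f -> cmeasurable g ->
  cmeasurable (fun x => f x - g x).
Proof. by move=> mf mg; apply: cmeasurableD => //; exact: cmeasurableN. Qed.

Lemma cmeasurableJ f : cmeasurable f -> cmeasurable (fun x => (f x)^*).
Proof.
move=> [f1 f2]; split.
- by under eq_fun do rewrite RecJ.
- by under eq_fun do rewrite ImcJ; exact: measurableT_comp.
Qed.

Lemma cmeasurable_cst (c : R[i]) : cmeasurable (fun _ : T => c).
Proof. by split; exact: measurable_cst. Qed.

Lemma cmeasurableC r : measurable_fun setT r -> cmeasurable (fun x => (r x)%:C).
Proof. by move=> mr; split => //=; exact: measurable_cst. Qed.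

Lemma measurable_sqnorm f : cmeasurable f -> measurable_fun setT (fun x => sqnorm (f x)).
Proof.
move=> [f1 f2]; under eq_fun do rewrite sqnormE.
by apply: measurable_funD; exact: measurable_funX.
Qed.

Hint Resolve sqnorm_ge0 : core.

Lemma inL2_le f r : cmeasurable f -> measurable_fun setT r ->
  (forall x, sqnorm (f x) <= r x) -> (\int[mu]_x (r x)%:E < +oo)%E -> inL2 mu f.
Proof.
move=> mf mr fr roo; split=> //; apply: le_lt_trans roo.
apply: le_nnint => //; exact: measurable_sqnorm.
Qed.

Lemma inL2D f g : inL2 mu f -> inL2 mu g -> inL2 mu (fun x => f x + g x).
Proof.
move=> [mf foo] [mg goo]; have sf := measurable_sqnorm mf; have sg := measurable_sqnorm mg.
apply: (@inL2_le _ (fun x => 2 * sqnorm (f x) + 2 * sqnorm (g x))).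
- exact: cmeasurableD.
- by apply: measurable_funD; exact: measurable_funM.
- by move=> x; exact: sqnormD_le.
rewrite nnintD//; last by move=> x; rewrite mulr_ge0 ?sqnorm_ge0.
  by rewrite !nnintZ// lte_add_pinfty// lte_mul_pinfty.
- exact: measurable_funM.
- exact: measurable_funM.
- by move=> x; rewrite mulr_ge0 ?sqnorm_ge0.
Qed.

Lemma inL2_bddM f (m : T -> R[i]) (M : R) : cmeasurable m ->
  (forall x, normc (m x) <= M) -> inL2 mu f -> inL2 mu (fun x => m x * f x).
Proof.
move=> mm mM [mf foo]; have sf := measurable_sqnorm mf.
apply: (@inL2_le _ (fun x => M ^+ 2 * sqnorm (f x))).
- exact: cmeasurableM.
- exact: measurable_funM.
- by move=> x; rewrite sqnormM; apply: ler_wpM2r; [exact: sqnorm_ge0|exact: sqnorm_le_bound].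
by rewrite nnintZ ?sqr_ge0// lte_mul_pinfty// lee_fin sqr_ge0.
Qed.

Lemma inL2Z (c : R[i]) f : inL2 mu f -> inL2 mu (fun x => c * f x).
Proof.
move=> fi; apply: (@inL2_bddM f (fun=> c) (normc c)) => //.
Qed.

Lemma inL2N f : inL2 mu f -> inL2 mu (fun x => - f x).
Proof. by move=> /(inL2Z (-1)); under eq_fun do rewrite mulN1r. Qed.

Lemma inL2B f g : inL2 mu f -> inL2 mu g -> inL2 mu (fun x => f x - g x).
Proof. by move=> fi gi; apply: inL2D => //; exact: inL2N. Qed.

Lemma L2sqdist_ge0 f g : (0 <= L2sqdist mu f g)%E.
Proof. exact: nnint_ge0. Qed.

Lemma L2sqdistxx f : L2sqdist mu f f = 0%E.
Proof. by rewrite /L2sqdist; under eq_integral do rewrite subrr sqnorm0; rewrite integral0. Qed.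

Lemma L2sqdistC f g : L2sqdist mu f g = L2sqdist mu g f.
Proof. by apply: eq_integral => x _; rewrite -sqnormN opprB. Qed.

Lemma L2sqdist_lty f g : inL2 mu f -> inL2 mu g -> (L2sqdist mu f g < +oo)%E.
Proof. by move=> fi gi; have [] := inL2B fi gi. Qed.

Lemma L2sqdist_ae f g f' g' : cmeasurable f -> cmeasurable g ->
  cmeasurable f' -> cmeasurable g' ->
  {ae mu, forall x, f x = f' x} -> {ae mu, forall x, g x = g' x} ->
  L2sqdist mu f g = L2sqdist mu f' g'.
Proof.
move=> mf mg mf' mg' ff' gg'; apply: ge0_ae_eq_integral => //.
- by apply/measurable_EFinP; apply: measurable_sqnorm; exact: cmeasurableB.
- by apply/measurable_EFinP; apply: measurable_sqnorm; exact: cmeasurableB.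
- by move=> x _; rewrite lee_fin sqnorm_ge0.
- by move=> x _; rewrite lee_fin sqnorm_ge0.
- by apply: filterS2 ff' gg' => x -> ->.
Qed.

(** The factor 2 is the price of squared distances; later constants such as 16 and 40 absorb its
    repeated use. *)
Lemma L2sqdist_triangle g f h : cmeasurable f -> cmeasurable g -> cmeasurable h ->
  (L2sqdist mu f h <= 2%:E * L2sqdist mu f g + 2%:E * L2sqdist mu g h)%E.
Proof.
move=> mf mg mh.
have s1 := measurable_sqnorm (cmeasurableB mf mg).
have s2 := measurable_sqnorm (cmeasurableB mg mh).
rewrite -!nnintZ// -nnintD//; [|exact: measurable_funM|exact: measurable_funM|
  by move=> x; rewrite mulr_ge0 ?sqnorm_ge0|by move=> x; rewrite mulr_ge0 ?sqnorm_ge0].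
apply: le_nnint => //.
- by apply: measurable_sqnorm; exact: cmeasurableB.
- by apply: measurable_funD; exact: measurable_funM.
- move=> x; rewrite -(subrKA (g x)); exact: sqnormD_le.
Qed.

Lemma sqnorm_integral_eps (e : R) f g : 0 < e -> cmeasurable f -> cmeasurable g ->
  (\int[mu]_x (sqnorm (f x))%:E <= (1 + e)%:E * \int[mu]_x (sqnorm (g x))%:E +
    (1 + e^-1)%:E * L2sqdist mu f g)%E.
Proof.
move=> e0 mf mg; have e1 : 0 <= 1 + e by rewrite addr_ge0// ltW.
have e2 : 0 <= 1 + e^-1 by rewrite addr_ge0// invr_ge0 ltW.
have s2 := measurable_sqnorm (cmeasurableB mf mg); have s1 := measurable_sqnorm mg.
rewrite -!nnintZ// -nnintD//; [|exact: measurable_funM|exact: measurable_funM|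
  by move=> x; rewrite mulr_ge0 ?sqnorm_ge0|by move=> x; rewrite mulr_ge0 ?sqnorm_ge0].
apply: le_nnint => //.
- exact: measurable_sqnorm.
- by apply: measurable_funD; exact: measurable_funM.
- move=> x; rewrite -{1}(subrK (g x) (f x)) addrC; exact: sqnormD_eps.
Qed.

Lemma L2sqdist_lin (c : R[i]) f g f' g' : cmeasurable f -> cmeasurable g ->
  cmeasurable f' -> cmeasurable g' ->
  (L2sqdist mu (fun x => c * f x + g x)%R (fun x => c * f' x + g' x)%R <=
    (2 * sqnorm c)%:E * L2sqdist mu f f' + 2%:E * L2sqdist mu g g')%E.
Proof.
move=> mf mg mf' mg'.
have s1 := measurable_sqnorm (cmeasurableB mf mf').
have s2 := measurable_sqnorm (cmeasurableB mg mg').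
have c0 : 0 <= 2 * sqnorm c by rewrite mulr_ge0 ?sqnorm_ge0.
rewrite -!nnintZ//.
rewrite -nnintD; [|exact: measurable_funM|exact: measurable_funM|
  by move=> x; rewrite mulr_ge0 ?sqnorm_ge0|by move=> x; rewrite mulr_ge0 ?sqnorm_ge0].
apply: le_nnint.
- apply: measurable_sqnorm; apply: cmeasurableB.
    by apply: cmeasurableD => //; apply: cmeasurableM => //; exact: cmeasurable_cst.
  by apply: cmeasurableD => //; apply: cmeasurableM => //; exact: cmeasurable_cst.
- by apply: measurable_funD; exact: measurable_funM.
- by move=> x; exact: sqnorm_ge0.
- move=> x.
  have -> : c * f x + g x - (c * f' x + g' x) = c * (f x - f' x) + (g x - g' x) by ring.
  by apply: le_trans (sqnormD_le _ _) _; rewrite sqnormM mulrA.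
Qed.

End square_integrable.

Section complex_integral.
Context (R : realType) (d : measure_display) (T : measurableType d).
Variable mu : {measure set T -> \bar R}.
Implicit Types (f g h : T -> R[i]) (r s : T -> R).

Definition cintegrable f :=
  mu.-integrable setT (EFin \o (fun x => complex.Re (f x))) /\
  mu.-integrable setT (EFin \o (fun x => complex.Im (f x))).

Lemma cintegrable_le f s : cmeasurable f -> (forall x, normc (f x) <= s x) ->
  mu.-integrable setT (EFin \o s) -> cintegrable f.
Proof.
move=> [mf1 mf2] fs si; split; apply: le_integrable_real si => // x.
- exact: le_trans (Re_le_normc _) (fs x).
- exact: le_trans (Im_le_normc _) (fs x).
Qed.

Lemma cintegralD f g : cintegrable f -> cintegrable g ->
  cintegral mu (fun x => f x + g x) = cintegral mu f + cintegral mu g.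
Proof.
move=> [f1 f2] [g1 g2]; apply: eq_ReIm; rewrite /cintegral /=.
- by rewrite -RintegralD//; apply: eq_Rintegral => x _; rewrite RecD.
- by rewrite -RintegralD//; apply: eq_Rintegral => x _; rewrite ImcD.
Qed.

Lemma integrable_realZ (k : R) r : mu.-integrable setT (EFin \o r) ->
  mu.-integrable setT (EFin \o (fun x => k * r x)).
Proof.
by move=> /(integrableZl measurableT k); apply: eq_integrable => // x _; rewrite /= EFinM.
Qed.

Lemma integrable_realD r s : mu.-integrable setT (EFin \o r) ->
  mu.-integrable setT (EFin \o s) ->
  mu.-integrable setT (EFin \o (fun x => r x + s x)).
Proof.
by move=> ri si; have := integrableD measurableT ri si; apply: eq_integrable.
Qed.

Lemma integrable_realB r s : mu.-integrable setT (EFin \o r) ->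
  mu.-integrable setT (EFin \o s) ->
  mu.-integrable setT (EFin \o (fun x => r x - s x)).
Proof.
by move=> ri si; have := integrableB measurableT ri si; apply: eq_integrable.
Qed.

Lemma cintegrableZ (c : R[i]) f : cintegrable f -> cintegrable (fun x => c * f x).
Proof.
move=> [f1 f2]; split.
- have := integrable_realB (integrable_realZ (complex.Re c) f1) (integrable_realZ (complex.Im c) f2).
  by apply: eq_integrable => // x _; rewrite /= RecM.
- have := integrable_realD (integrable_realZ (complex.Re c) f2) (integrable_realZ (complex.Im c) f1).
  by apply: eq_integrable => // x _; rewrite /= ImcM.
Qed.

Lemma cintegralZ (c : R[i]) f : cintegrable f ->
  cintegral mu (fun x => c * f x) = c * cintegral mu f.
Proof.
move=> [f1 f2]; apply: eq_ReIm; rewrite /cintegral ?RecM ?ImcM /=.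
- rewrite -!RintegralZl// -RintegralB//; [|exact: integrable_realZ..].
  by apply: eq_Rintegral => x _; rewrite RecM.
- rewrite -!RintegralZl// -RintegralD//; [|exact: integrable_realZ..].
  by apply: eq_Rintegral => x _; rewrite ImcM.
Qed.

Lemma normc_cintegral_le f s : cintegrable f -> (forall x, normc (f x) <= s x) ->
  mu.-integrable setT (EFin \o s) ->
  normc (cintegral mu f) <= 2 * \int[mu]_x s x.
Proof.
move=> [f1 f2] fs si; apply: le_trans (normc_le_ReIm _) _.
rewrite mulr_natl mulr2n; apply: lerD => /=.
- apply: le_trans (le_normr_Rintegral _ f1) _ => //; apply: le_Rintegral => //.
    exact: (integrable_norm f1).
  by move=> x _; exact: le_trans (Re_le_normc _) (fs x).
- apply: le_trans (le_normr_Rintegral _ f2) _ => //; apply: le_Rintegral => //.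
    exact: (integrable_norm f2).
  by move=> x _; exact: le_trans (Im_le_normc _) (fs x).
Qed.

Lemma cintegrable_inL2M f g : inL2 mu f -> inL2 mu g ->
  cintegrable (fun x => f x * (g x)^*).
Proof.
move=> [mf foo] [mg goo].
apply: (@cintegrable_le _ (fun x => sqnorm (f x) + sqnorm (g x))).
- by apply: cmeasurableM => //; exact: cmeasurableJ.
- move=> x; have -> : normc (f x * (g x)^*) = normc (f x) * normc (g x).
    rewrite Normc.normcM; congr (_ * _).
    by case: (g x) => a b /=; rewrite sqrrN.
  rewrite /sqnorm -subr_ge0; set a := normc (f x); set b := normc (g x).
  have -> : a ^+ 2 + b ^+ 2 - a * b = ((a - b) ^+ 2 + (a ^+ 2 + b ^+ 2)) / 2 by field.
  by rewrite divr_ge0// !addr_ge0// sqr_ge0.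
- apply: integrable_realD; apply: integrable_nnint => //.
  + exact: measurable_sqnorm.
  + by move=> x; exact: sqnorm_ge0.
  + exact: measurable_sqnorm.
  + by move=> x; exact: sqnorm_ge0.
Qed.

(** Expanding the square leaves a cross term whose integral is the vanishing inner product. It
    serves for uncorrelated random variables and for functions orthogonal to all transforms. *)
Lemma L2_pythagoras f g : inL2 mu f -> inL2 mu g ->
  complex.Re (cintegral mu (fun x => f x * (g x)^*)) = 0 ->
  (L2sqdist mu f g = \int[mu]_x (sqnorm (f x))%:E + \int[mu]_x (sqnorm (g x))%:E)%E.
Proof.
move=> fi gi fg0; have [fg _] := cintegrable_inL2M fi gi.
have fg2 := integrable_realZ (-2) fg.
have [mf foo] := fi; have [mg goo] := gi.
have sf := measurable_sqnorm mf; have sg := measurable_sqnorm mg.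
have i1 := integrable_nnint sf (fun x => sqnorm_ge0 _) foo.
have i2 := integrable_nnint sg (fun x => sqnorm_ge0 _) goo.
have i3 := integrable_realD i1 i2.
rewrite -nnintD//; [|by move=> x; exact: sqnorm_ge0|by move=> x; exact: sqnorm_ge0].
transitivity (\int[mu]_x (sqnorm (f x) + sqnorm (g x) + (-2) * complex.Re (f x * (g x)^*))%:E)%E.
  by apply: eq_integral => x _; congr EFin; rewrite !sqnormE !ReImE; ring.
under eq_integral do rewrite EFinD.
rewrite integralD_EFin//= -[RHS]adde0; congr (_ + _)%E.
rewrite -[LHS]fineK; last exact: integrable_fin_num.
congr EFin; rewrite -[LHS]/(\int[mu]_x (-2 * complex.Re (f x * (g x)^*))) RintegralZl//.
by rewrite -[X in _ * X]/(complex.Re (cintegral mu (fun x => f x * (g x)^*))) fg0 mulr0.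
Qed.

Lemma cintegral_sqnorm f : complex.Re (cintegral mu (fun x => f x * (f x)^*)) =
  fine (\int[mu]_x (sqnorm (f x))%:E)%E.
Proof.
rewrite /cintegral /=; congr fine; apply: eq_integral => x _; congr EFin.
by rewrite sqnormE !ReImE; ring.
Qed.

Lemma L2sqdist0_ae f g : cmeasurable f -> cmeasurable g ->
  L2sqdist mu f g = 0%E -> {ae mu, forall x, f x = g x}.
Proof.
move=> mf mg fg0; have mfg := measurable_sqnorm (cmeasurableB mf mg).
have /(ae_eq_integral_abs mu measurableT)[+ _] :
  measurable_fun setT (EFin \o (fun x => sqnorm (f x - g x))) by exact/measurable_EFinP.
move=> /(_ _)-/(_ _)[].
  rewrite -[RHS]fg0; apply: eq_integral => x _.
  by rewrite /= ger0_norm// sqnorm_ge0.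
move=> N [mN N0 fgN]; exists N; split => //; apply: subset_trans fgN => x /= fgx h.
by apply: fgx; have [/sqnorm_eq0/subr0_eq] := h I.
Qed.

End complex_integral.

(** * Riesz-Fischer completeness for a finite measure *)

Section riesz_fischer.
Context (R : realType) (d : measure_display) (T : measurableType d).
Variable mu : {measure set T -> \bar R}.
Hypothesis mufin : (mu setT < +oo)%E.

Let q (n : nat) : R := 2^-1 ^+ n.

Let q_gt0 n : 0 < q n.
Proof. by rewrite exprn_gt0// invr_gt0. Qed.

Let sum_q N : \sum_(n < N) q n = 2 - 2 * q N.
Proof.
elim: N => [|N IH]; first by rewrite big_ord0 /q expr0; ring.
by rewrite big_ord_recr /= IH /q exprS; field.
Qed.

(** The inequality |a| <= 2^n a^2 + 2^-n turns the bound 8^-n on squared increments into a bound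
    2^-n (1 + mu(T)) on absolute ones. Their sum is integrable, hence finite a.e., and the sequence
    converges wherever it is finite. *)
Lemma ae_cvg_fast_real (r : nat -> T -> R) : (forall n, measurable_fun setT (r n)) ->
  (forall n, \int[mu]_x ((r n.+1 x - r n x) ^+ 2)%:E <= (8^-1 ^+ n)%:E)%E ->
  exists2 s : T -> R, measurable_fun setT s &
    {ae mu, forall x, r ^~ x @ \oo --> s x}.
Proof.
move=> mr rq.
have mdr n : measurable_fun setT (fun x => r n.+1 x - r n x) by exact: measurable_funB.
pose m := fine (mu setT).
have m0 : 0 <= m by rewrite fine_ge0.
have mE : mu setT = m%:E by rewrite fineK// ge0_fin_numE.
have int_t n : (\int[mu]_x (`|r n.+1 x - r n x|)%:E <= (q n * (1 + m))%:E)%E.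
  apply: (@le_trans _ _ (\int[mu]_x (2 ^+ n * (r n.+1 x - r n x) ^+ 2 + q n)%:E)%E).
    apply: le_nnint => //.
    - exact: measurableT_comp.
    - apply: measurable_funD => //; apply: measurable_funM => //.
      exact: measurable_funX.
    - move=> x; rewrite -(real_normK (num_real (_ - _))).
      set a := `| _ |; have a0 : 0 <= a by exact: normr_ge0.
      have -> : 2 ^+ n = (q n)^-1 :> R by rewrite /q exprVn invrK.
      have qn := q_gt0 n; rewrite -subr_ge0.
      have -> : (q n)^-1 * a ^+ 2 + q n - a = (q n)^-1 * ((a - q n) ^+ 2 + a * q n).
        by field; rewrite gt_eqF.
      apply: mulr_ge0; first by rewrite invr_ge0 ltW.
      by apply: addr_ge0; [exact: sqr_ge0|apply: mulr_ge0 => //; exact: ltW].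
  rewrite nnintD//; last 3 first.
  - by apply: measurable_funM => //; exact: measurable_funX.
  - by move=> x; rewrite mulr_ge0 ?sqr_ge0// exprn_ge0.
  - by move=> x; exact: ltW.
  rewrite nnintZ; [|exact: measurable_funX|by move=> x; rewrite sqr_ge0|exact: exprn_ge0].
  rewrite integral_cst//= [X in (_ + X)%E](_ : _ = (q n * m)%:E); last by rewrite EFinM -mE.
  rewrite mulrDr mulr1 EFinD leeD2r//.
  apply: le_trans (lee_wpmul2l _ (rq n)) _; first by rewrite lee_fin exprn_ge0.
  by rewrite -EFinM lee_fin /q -exprMn lerXn2r ?nnegrE//; lra.
have int_sum : (\int[mu]_x (\sum_(n <oo) (`|r n.+1 x - r n x|)%:E) < +oo)%E.
  rewrite integral_nneseries//; last first.
    by move=> n; apply/measurable_EFinP; exact: measurableT_comp.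
  apply: (@le_lt_trans _ _ (2 * (1 + m))%:E); last by rewrite ltry.
  apply: lime_le; first by apply: is_cvg_nneseries => n _ _; exact: nnint_ge0.
  apply: nearW => N.
  apply: (@le_trans _ _ (\sum_(0 <= n < N) (q n * (1 + m))%:E)%E).
    by apply: lee_sum => n _; exact: int_t.
  rewrite sumEFin lee_fin -mulr_suml big_mkord sum_q ler_wpM2r ?addr_ge0//.
  by have := q_gt0 N; lra.
have iS : mu.-integrable setT (fun x => \sum_(n <oo) (`|r n.+1 x - r n x|)%:E)%E.
  apply/integrableP; split.
    apply: ge0_emeasurable_sum => //.
    by move=> n _; apply/measurable_EFinP; exact: measurableT_comp.
  under eq_integral => x _ do rewrite gee0_abs ?nneseries_ge0//.
  exact: int_sum.
(* The upper limit is measurable on the whole space and equals the limit where there is one. *)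
exists (fun x => fine (limn_esup (fun n => (r n x)%:E))).
  apply: measurableT_comp => //; apply: measurable_fun_limn_esup => n.
  exact/measurable_EFinP.
have := integrable_ae measurableT iS; apply: filterS => x /(_ I) fx.
have cr : cvgn (r ^~ x).
  have : cvgn (series (telescope (r ^~ x))).
    apply: normed_cvg; apply: nondecreasing_is_cvgn.
      by apply: nondecreasing_series => n _ _; exact: normr_ge0.
    exists (fine (\sum_(n <oo) (`|r n.+1 x - r n x|)%:E)%E) => _ [N _ <-].
    rewrite -lee_fin fineK// /series/= -sumEFin.
    by apply: nneseries_lim_ge.
  rewrite telescopeK => h.
  rewrite (_ : r ^~ x = (fun n => (r n x - r 0%N x) + r 0%N x)).
    by apply: is_cvgD => //; exact: is_cvg_cst.
  by apply/funext => n; rewrite subrK.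
have crE : (fun n => (r n x)%:E) @ \oo --> (limn (r ^~ x))%:E.
  by apply/fine_cvgP; split; [exact: nearW|exact: cr].
by rewrite is_cvg_limn_esupE; [move/cvg_lim : crE => ->|apply/cvg_ex; exists (limn (r ^~ x))%:E].
Qed.

Lemma ae_sqnorm_cvg (f_ : nat -> T -> R[i]) (f : T -> R[i]) :
  {ae mu, forall x, (fun n => complex.Re (f_ n x)) @ \oo --> complex.Re (f x)} ->
  {ae mu, forall x, (fun n => complex.Im (f_ n x)) @ \oo --> complex.Im (f x)} ->
  forall g, {ae mu, forall x,
    (fun n => (sqnorm (f_ n x - g x))%:E) @ \oo --> (sqnorm (f x - g x))%:E}.
Proof.
move=> f1 f2 g; apply: filterS2 f1 f2 => x f1 f2; apply: cvg_EFin.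
  exact: nearW.
under eq_fun do rewrite /= sqnormE !RecD !RecN !ImcD !ImcN.
rewrite sqnormE !RecD !RecN !ImcD !ImcN.
apply: cvgD; under eq_fun do rewrite expr2; rewrite expr2.
  by apply: cvgM; (apply: cvgB; [exact: f1|exact: cvg_cst]).
by apply: cvgM; (apply: cvgB; [exact: f2|exact: cvg_cst]).
Qed.

(** The a.e. limits of the real and imaginary parts give [f]; Fatou's lemma carries to it the bounds
    on the distances between terms of the sequence. *)
Lemma L2_complete_fast (f_ : nat -> T -> R[i]) : (forall n, inL2 mu (f_ n)) ->
  (forall n, L2sqdist mu (f_ n) (f_ n.+1) <= (8^-1 ^+ n)%:E)%E ->
  exists2 f, inL2 mu f &
    forall n, (L2sqdist mu f (f_ n) <= (4 * 8^-1 ^+ n)%:E)%E.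
Proof.
move=> fL2 fq; have mf n : cmeasurable (f_ n) by have [] := fL2 n.
have [] := @ae_cvg_fast_real (fun n x => complex.Re (f_ n x)).
- by move=> n; have [] := mf n.
- move=> n; apply: le_trans (fq n); rewrite L2sqdistC; apply: le_nnint.
  + apply: measurable_funX; apply: measurable_funB; first by have [] := mf n.+1.
    by have [] := mf n.
  + by apply: measurable_sqnorm; exact: cmeasurableB.
  + by move=> x; exact: sqr_ge0.
  + by move=> x; rewrite -RecN -RecD sqr_Re_le.
move=> r mr f_r.
have [] := @ae_cvg_fast_real (fun n x => complex.Im (f_ n x)).
- by move=> n; have [] := mf n.
- move=> n; apply: le_trans (fq n); rewrite L2sqdistC; apply: le_nnint.
  + apply: measurable_funX; apply: measurable_funB; first by have [] := mf n.+1.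
    by have [] := mf n.
  + by apply: measurable_sqnorm; exact: cmeasurableB.
  + by move=> x; exact: sqr_ge0.
  + by move=> x; rewrite -ImcN -ImcD sqr_Im_le.
move=> s ms f_s.
pose f x := r x +i* s x; have mF : cmeasurable f by split.
(* The factor 4 closes the induction: 2 * 8^-n + 2 * 4 * 8^-(n+1) = 3 * 8^-n. *)
have dist_le n k : (L2sqdist mu (f_ n) (f_ (k + n)%N) <= (4 * 8^-1 ^+ n)%:E)%E.
  elim: k n => [|k IH] n.
    by rewrite add0n L2sqdistxx lee_fin mulr_ge0// exprn_ge0.
  apply: le_trans (L2sqdist_triangle _ (mf n) (mf n.+1) (mf _)) _.
  apply: (@le_trans _ _ (2%:E * (8^-1 ^+ n)%:E + 2%:E * (4 * 8^-1 ^+ n.+1)%:E)%E).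
    by rewrite leeD// lee_wpmul2l// addSnnS.
  rewrite -!EFinM -EFinD lee_fin exprS.
  have : 0 <= 8^-1 ^+ n :> R by rewrite exprn_ge0.
  lra.
have fdist n : (L2sqdist mu f (f_ n) <= (4 * 8^-1 ^+ n)%:E)%E.
  have msn k : measurable_fun setT (fun x => (sqnorm (f_ (k + n)%N x - f_ n x))%:E).
    by apply/measurable_EFinP/measurable_sqnorm; exact: cmeasurableB.
  (* A.e. the integrand is a limit, hence a lower limit, the form to which Fatou's lemma applies. *)
  have -> : L2sqdist mu f (f_ n) =
      (\int[mu]_x limn_einf (fun k => (sqnorm (f_ (k + n)%N x - f_ n x))%:E))%E.
    apply: ae_eq_integral => //.
    - by apply/measurable_EFinP/measurable_sqnorm; exact: cmeasurableB.
    - apply: measurableT_comp => //; apply: measurable_fun_limn_esup => k.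
      exact: measurableT_comp.
    - have := @ae_sqnorm_cvg f_ f f_r f_s (f_ n); apply: filterS => x fx _.
      have fx' : (fun k => (sqnorm (f_ (k + n)%N x - f_ n x))%:E) @ \oo -->
          (sqnorm (f x - f_ n x))%:E by rewrite (cvg_shiftn n (fun k => (sqnorm (f_ k x - f_ n x))%:E)).
      by have [->] := cvg_limn_einf_sup fx'.
  apply: le_trans (fatou mu measurableT msn _) _.
    by move=> k x _; rewrite lee_fin sqnorm_ge0.
  rewrite limn_einf_lim; apply: lime_le; first exact: is_cvg_einfs.
  apply: nearW => k; apply: le_trans (dist_le n k).
  rewrite L2sqdistC; apply: ereal_inf_lbound; exists k => //=.
exists f => //.
have -> : f = (fun x => (f x - f_ 0%N x) + f_ 0%N x) by apply/funext => x; rewrite subrK.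
apply: inL2D => //; split; first exact: cmeasurableB.
by apply: le_lt_trans (fdist 0%N) _; rewrite ltry.
Qed.

End riesz_fischer.

(** * Means of square integrable random variables *)

Section zero_mean.
Context (R : realType) (d : measure_display) (T : measurableType d).
Variable P : probability T R.
Implicit Types f g : T -> R[i].

(** On a probability space the constant 1 is square integrable, so [f] is a product of two L^2
    functions. *)
Lemma integrable_inL2 f : inL2 P f -> cintegrable P f.
Proof.
move=> fi; have := @cintegrable_inL2M _ _ _ P f (fun=> 1) fi.
have one : inL2 P (fun=> 1 : R[i]).
  split; first exact: cmeasurable_cst.
  rewrite integral_cst//= [X in (_ * X)%E]probability_setT mule1.
  by rewrite ltry.
move=> /(_ one); congr (cintegrable _ _); apply/funext => x.
by apply: eq_ReIm; rewrite !ReImE /=; ring.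
Qed.

(** Integrate |r| <= r^2 / D + D over a probability space: each term contributes at most [D]. *)
Let mean_le (r : T -> R) (D : R) : measurable_fun setT r -> 0 <= D ->
  P.-integrable setT (EFin \o r) ->
  (\int[P]_x (r x ^+ 2)%:E < (D ^+ 2)%:E)%E -> `|\int[P]_x r x| <= 2 * D.
Proof.
move=> mr; rewrite le_eqVlt => /predU1P[<-|D0] ir rD.
  by move: rD; rewrite expr0n/= ltNge nnint_ge0// => x; exact: sqr_ge0.
rewrite -lee_fin EFin_normr_Rintegral//; apply: le_trans.
  apply: (@le_abse_integral _ _ _ P setT (EFin \o r)) => //.
  exact/measurable_EFinP.
apply: (@le_trans _ _ (\int[P]_x (D^-1 * r x ^+ 2 + D)%:E)%E).
  apply: le_nnint => //.
  - exact: measurableT_comp.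
  - by apply: measurable_funD => //; apply: measurable_funM => //; exact: measurable_funX.
  - move=> x; rewrite -(real_normK (num_real (r x))).
    set a := `| _ |; have a0 : 0 <= a by exact: normr_ge0.
    rewrite -subr_ge0.
    have -> : D^-1 * a ^+ 2 + D - a = D^-1 * ((a - D) ^+ 2 + a * D).
      by field; rewrite gt_eqF.
    apply: mulr_ge0; first by rewrite invr_ge0 ltW.
    by apply: addr_ge0; [exact: sqr_ge0|apply: mulr_ge0 => //; exact: ltW].
rewrite nnintD//; last 3 first.
- by apply: measurable_funM => //; exact: measurable_funX.
- by move=> x; rewrite mulr_ge0 ?sqr_ge0// invr_ge0 ltW.
- by move=> x; exact: ltW.
rewrite nnintZ; [|exact: measurable_funX|by move=> x; rewrite sqr_ge0|by rewrite invr_ge0 ltW].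
rewrite [X in (_ + X <= _)%E](_ : _ = D%:E); last first.
  by rewrite integral_cst//= [X in (_ * X)%E]probability_setT mule1.
rewrite mulr_natl mulr2n EFinD leeD2r//.
apply: le_trans (lee_wpmul2l _ (ltW rD)) _; first by rewrite lee_fin invr_ge0 ltW.
by rewrite -EFinM lee_fin expr2 mulKf// gt_eqF.
Qed.

(** The mean is continuous for the L^2 distance, so having zero mean is a closed condition. *)
Lemma zero_mean_limit f : inL2 P f ->
  (forall e : R, 0 < e -> exists2 g, inL20 P g & (L2sqdist P f g < e%:E)%E) ->
  inL20 P f.
Proof.
move=> fi fg; split=> //; have [if1 if2] := integrable_inL2 fi; have [mf _] := fi.
have small (r : R) : (forall e, 0 < e -> `|r| <= 2 * e) -> r = 0.
  move=> re; apply/eqP; rewrite -normr_le0; apply/ler_addgt0Pr => e e0.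
  by rewrite add0r; apply: le_trans (re _ (divr_gt0 e0 (ltr0n R 2))) _; rewrite mulrC divfK.
apply: eq_ReIm; apply: small => e e0;
  have [g [gi g0] fge] := fg (e ^+ 2) (exprn_gt0 2 e0);
  have [ig1 ig2] := integrable_inL2 gi; have [mg _] := gi;
  have mfg := cmeasurableB mf mg.
- rewrite /cintegral/= -(subr0 (\int[P]_x _)).
  rewrite -[X in _ - X](_ : \int[P]_x complex.Re (g x) = 0); last first.
    exact: (congr1 (@complex.Re R) g0).
  rewrite -RintegralB//; apply: mean_le; [|exact: ltW|exact: integrable_realB|].
    by apply: measurable_funB; [case: mf|case: mg].
  apply: le_lt_trans fge; apply: le_nnint.
  + by apply: measurable_funX; apply: measurable_funB; [case: mf|case: mg].
  + exact: measurable_sqnorm.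
  + by move=> x; exact: sqr_ge0.
  + by move=> x; rewrite -RecN -RecD sqr_Re_le.
- rewrite /cintegral/= -(subr0 (\int[P]_x _)).
  rewrite -[X in _ - X](_ : \int[P]_x complex.Im (g x) = 0); last first.
    exact: (congr1 (@complex.Im R) g0).
  rewrite -RintegralB//; apply: mean_le; [|exact: ltW|exact: integrable_realB|].
    by apply: measurable_funB; [case: mf|case: mg].
  apply: le_lt_trans fge; apply: le_nnint.
  + by apply: measurable_funX; apply: measurable_funB; [case: mf|case: mg].
  + exact: measurable_sqnorm.
  + by move=> x; exact: sqr_ge0.
  + by move=> x; rewrite -ImcN -ImcD sqr_Im_le.
Qed.

End zero_mean.

Lemma L2sqdist_fin (R : realType) (d : measure_display) (T : measurableType d)
  (mu : {measure set T -> \bar R}) (f g : T -> R[i]) :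
  (L2sqdist mu f g < +oo)%E -> exists r, L2sqdist mu f g = r%:E.
Proof.
move=> fg; exists (fine (L2sqdist mu f g)).
by rewrite fineK// ge0_fin_numE// L2sqdist_ge0.
Qed.

(** * Extension of generalized processes *)

Section extension.
Context (R : realType) (d : nat) (d' : measure_display) (T : measurableType d').
Context (P : probability T R) (mu : {measure set 'rV[R]_d -> \bar R}).
Variable u : ('rV[R]_d -> R[i]) -> T -> R[i].
Hypothesis u_L20 : forall phi, test_function phi -> inL20 P (u phi).
(** An inequality rather than an isometry, because it has to cover [u], whose spectral measure is
    only dominated by that of the sum u + w. *)
Hypothesis u_contraction : forall phi psi, test_function phi -> test_function psi ->
  (L2sqdist P (u phi) (u psi) <= L2sqdist mu (fourier phi) (fourier psi))%E.
Hypothesis fourier_inL2 : forall phi, test_function phi -> inL2 mu (fourier phi).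
Hypothesis fourier_dense : forall g, inL2 mu g -> forall e : R, 0 < e ->
  exists2 phi, test_function phi & (L2sqdist mu (fourier phi) g < e%:E)%E.

Let q (n : nat) : R := 8^-1 ^+ n.

Let q_gt0 n : 0 < q n. Proof. by rewrite exprn_gt0// invr_gt0. Qed.

(** Test functions approximate [g] fast, and contraction makes the values of [u] on them converge.
    What is kept of the limit is a joint approximation: some test function is close to [g] while its
    value is close to [U]. *)
Let limit_exists g : inL2 mu g -> exists U : T -> R[i], inL20 P U /\
  forall e : R, 0 < e -> exists phi, [/\ test_function phi,
    (L2sqdist mu (fourier phi) g < e%:E)%E & (L2sqdist P U (u phi) < e%:E)%E].
Proof.
move=> gi; have [mg _] := gi.
(* The margin q n / 4 yields 2 q n / 4 + 2 q (n+1) / 4 <= q n between consecutive terms, the rate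
   asked by [L2_complete_fast]. *)
have /choice[phi phiP] : forall n, exists phi, test_function phi /\
    (L2sqdist mu (fourier phi) g < (q n / 4)%:E)%E.
  by move=> n; have [|phi tphi phig] := fourier_dense gi (e := q n / 4);
    [rewrite divr_gt0|exists phi].
have tphi n : test_function (phi n) by have [] := phiP n.
have phig n : (L2sqdist mu (fourier (phi n)) g < (q n / 4)%:E)%E by have [] := phiP n.
have mF n : cmeasurable (fourier (phi n)) by have [] := fourier_inL2 (tphi n).
have [|||U UL2 Uphi] := @L2_complete_fast _ _ _ P _ (fun n => u (phi n)).
- by rewrite [ltLHS]probability_setT ltry.
- by move=> n; have [] := u_L20 (tphi n).
- move=> n; apply: le_trans (u_contraction (tphi n) (tphi n.+1)) _.
  apply: le_trans (L2sqdist_triangle mu (mF n) mg (mF n.+1)) _.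
  rewrite (L2sqdistC _ g).
  apply: (@le_trans _ _ (2%:E * (q n / 4)%:E + 2%:E * (q n.+1 / 4)%:E)%E).
    by rewrite leeD// lee_wpmul2l// ltW.
  rewrite -!EFinM -EFinD lee_fin -/(q n) /q exprS.
  have : 0 <= 8^-1 ^+ n :> R by rewrite exprn_ge0.
  lra.
have close (e : R) : 0 < e -> exists n, 4 * q n < e.
  move=> e0.
  have : (fun n => 4 * q n) @ \oo --> (4 * 0 : R).
    apply: cvgM; first exact: cvg_cst.
    by apply: cvg_expr; rewrite ger0_norm; lra.
  rewrite mulr0 => /cvgr_lt/(_ _ e0)[N _ /(_ N (leqnn N))] h.
  by exists N.
have Uapprox e : 0 < e -> exists phi, [/\ test_function phi,
    (L2sqdist mu (fourier phi) g < e%:E)%E & (L2sqdist P U (u phi) < e%:E)%E].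
  move=> /close[n qn]; exists (phi n); split => //.
    apply: lt_trans (phig n) _; rewrite lte_fin.
    by have := q_gt0 n; lra.
  by apply: le_lt_trans (Uphi n) _; rewrite lte_fin.
exists U; split => //; apply: zero_mean_limit => // e /Uapprox[psi [tpsi _ h]].
by exists (u psi) => //; exact: u_L20.
Qed.


(** The values [U g] are chosen separately for each [g]. Continuity and agreement with [u] both
    follow from the joint approximation, since two values can be compared through test functions. *)
Lemma continuous_extension_exists : exists U, continuous_extension P mu u U.
Proof.
have /choice[U UP] : forall g, exists U : T -> R[i], inL2 mu g -> inL20 P U /\
  forall e : R, 0 < e -> exists phi, [/\ test_function phi,
    (L2sqdist mu (fourier phi) g < e%:E)%E & (L2sqdist P U (u phi) < e%:E)%E].
  move=> g; have [gi|ngi] := pselect (inL2 mu g); last by exists (fun=> 0).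
  by have [U UP] := limit_exists gi; exists U.
have mu_ phi : test_function phi -> cmeasurable (u phi).
  by move=> tphi; have [[]] := u_L20 tphi.
have mF (phi : 'rV[R]_d -> R[i]) : test_function phi -> cmeasurable (fourier phi).
  by move=> tphi; have [] := fourier_inL2 tphi.
have mU g : inL2 mu g -> cmeasurable (U g) by move=> /UP[[[]]].
exists U; split.
- by move=> g /UP[].
(* The path from [U h] to [U g] runs through [u phi] and [u psi], the one from [fourier phi] to
   [fourier psi] through [h] and [g]. Four nested triangle inequalities put 2^4 in front of the
   distance from [h] to [g]. *)
- have key g h : inL2 mu g -> inL2 mu h ->
    (L2sqdist P (U h) (U g) <= 16%:E * L2sqdist mu h g)%E.
    move=> gi hi; have [mg _] := gi; have [mh _] := hi.
    have [_ hU] := UP _ hi; have [_ gU] := UP _ gi.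
    (* The four approximation errors carry the weights 2, 4, 8 and 16, of sum 30 < 40. *)
    apply/lee_addgt0Pr => e e0; have e40 : 0 < e / 40 by rewrite divr_gt0.
    have [phi [tphi phih Uphi]] := hU _ e40; have [psi [tpsi psig Upsi]] := gU _ e40.
    apply: le_trans (L2sqdist_triangle P (mU _ hi) (mu_ _ tphi) (mU _ gi)) _.
    have h1 := L2sqdist_triangle P (mu_ _ tphi) (mu_ _ tpsi) (mU _ gi).
    have h2 := u_contraction tphi tpsi.
    have h3 := L2sqdist_triangle mu (mF _ tphi) mh (mF _ tpsi).
    have h4 := L2sqdist_triangle mu mh mg (mF _ tpsi).
    rewrite (L2sqdistC P _ (u psi)) in Upsi; rewrite (L2sqdistC mu _ g) in psig.
    have hgoo := L2sqdist_lty hi gi.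
    (* Finiteness propagates along the chain of inequalities; once every distance is a real number,
       the estimate is linear. *)
    have [a4 E4] := L2sqdist_fin hgoo.
    have [a5 E5] := L2sqdist_fin (lt_trans Uphi (ltry _)).
    have [a7 E7] := L2sqdist_fin (lt_trans Upsi (ltry _)).
    have [a8 E8] := L2sqdist_fin (lt_trans phih (ltry _)).
    have [a9 E9] := L2sqdist_fin (lt_trans psig (ltry _)).
    rewrite E4 E9 -!EFinM -EFinD in h4.
    have [a3 E3] := L2sqdist_fin (le_lt_trans h4 (ltry _)).
    rewrite E8 E3 -!EFinM -EFinD in h3.
    have [a2 E2] := L2sqdist_fin (le_lt_trans h3 (ltry _)).
    rewrite E2 in h2.
    have [a1 E1] := L2sqdist_fin (le_lt_trans h2 (ltry _)).
    rewrite E1 E7 -!EFinM -EFinD in h1.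
    have [a6 E6] := L2sqdist_fin (le_lt_trans h1 (ltry _)).
    move: h1 h2 h3 h4 Uphi Upsi phih psig.
    rewrite E1 E2 E3 E4 E5 E6 E7 E8 E9 -!EFinM -!EFinD !lee_fin !lte_fin.
    lra.
  move=> g gi e e0; exists (e / 16); first by rewrite divr_gt0.
  move=> h hi hg; apply: le_lt_trans (key _ _ gi hi) _.
  move: hg; have := L2sqdist_ge0 mu h g; case: (L2sqdist mu h g) => //= r _.
  by rewrite -EFinM !lte_fin ltr_pdivlMr// mulrC.
- move=> phi tphi; have Fi := fourier_inL2 tphi; have [_ FU] := UP _ Fi.
  apply: L2sqdist0_ae; [exact: mU|exact: mu_|].
  apply/eqP; rewrite eq_le L2sqdist_ge0 andbT; apply/lee_addgt0Pr => e e0.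
  have [psi [tpsi psiphi Upsi]] := FU _ (divr_gt0 e0 (ltr0n R 4)).
  apply: le_trans (L2sqdist_triangle P (mU _ Fi) (mu_ _ tpsi) (mu_ _ tphi)) _.
  have h1 := u_contraction tpsi tphi.
  have [a1 E1] := L2sqdist_fin (lt_trans Upsi (ltry _)).
  have [a2 E2] := L2sqdist_fin (lt_trans psiphi (ltry _)).
  rewrite E2 in h1.
  have [a3 E3] := L2sqdist_fin (le_lt_trans h1 (ltry _)).
  move: h1 Upsi psiphi; rewrite E1 E2 E3 add0e -!EFinM -!EFinD !lee_fin !lte_fin.
  lra.
Qed.

End extension.

(** * Lebesgue measure on R^d *)

Section lebesgue_translation.
Variable R : realType.

(** Lebesgue measure is determined by its values on half-open intervals, and its translate has the
    same ones. *)
Lemma lebesgue_translation (a : R) (A : set R) : measurable A ->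
  pushforward (@lebesgue_measure R) (fun x : measurableTypeR R => x + a : measurableTypeR R) A =
  lebesgue_measure A.
Proof.
move=> mA; have ma : measurable_fun setT (fun x : measurableTypeR R => x + a : measurableTypeR R).
  exact: measurable_funD.
pose m := measure_function_pushforward__canonical__measure_function_Measure
  (@lebesgue_measure R) ma.
apply/esym; apply: (@lebesgue_measure_unique R m) => // _ [[x y]] _ <-.
rewrite /m /= /pushforward.
rewrite (_ : _ @^-1` _ = `]x - a, y - a]%classic); last first.
  by apply/seteqP; split => z /=; rewrite !in_itv/= ltrBlDr lerBrDr.
rewrite !lebesgue_measure_itv/= !lte_fin ltrD2r -!EFinB.
by case: ifP => // _; congr EFin; ring.
Qed.

Lemma measurable_translation_rV d (a : 'rV[R]_d) :
  measurable_fun setT (fun x : 'rV[R]_d => x + a).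
Proof.
apply: measurable_fun_rV => j.
under eq_fun do rewrite mxE.
by apply: measurable_funD => //; exact: measurable_coord_rV.
Qed.

(** Induction on the dimension: after splitting off the first coordinate a translation is a product
    map, and a product measure is determined by its values on rectangles. *)
Lemma lebesgue_rV_translation d (a : 'rV[R]_d) (A : set 'rV[R]_d) : measurable A ->
  pushforward (lebesgue_rV R d) (fun x => x + a) A = lebesgue_rV R d A.
Proof.
elim: d a A => [|d IH] a A mA.
  rewrite /pushforward; congr (lebesgue_rV R 0 _).
  by apply/seteqP; split => x /=; rewrite (_ : x + a = x)//; apply/rowP => -[].
pose a0 := a ord0 ord0; pose a' : 'rV[R]_d := \row_j a ord0 (lift ord0 j).
pose tau (p : measurableTypeR R * 'rV[R]_d) : measurableTypeR R * 'rV[R]_d :=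
  (p.1 + a0, p.2 + a').
have mtau : measurable_fun setT tau.
  apply/measurable_fun_pairP; split => /=.
    by apply: measurable_funD => //; exact: measurable_fst.
  apply: (measurableT_comp (f := fun x : 'rV[R]_d => x + a')); last exact: measurable_snd.
  exact: measurable_translation_rV.
have consD p : cons_rV p + a = cons_rV (tau p).
  apply/rowP => j; rewrite mxE; case: (unliftP ord0 j) => [i|] ->.
    by rewrite !cons_rVS/= !mxE.
  by rewrite !cons_rV0.
rewrite /= /lebesgue_cons /pushforward.
set B := cons_rV (d := d) @^-1` A.
have mB : measurable B by rewrite -[B]setTI; exact: measurable_cons_rV.
rewrite (_ : cons_rV (d := d) @^-1` _ = tau @^-1` B); last first.
  by apply/seteqP; split => p /=; rewrite consD.
pose m := measure_function_pushforward__canonical__measure_function_Measure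
  (@lebesgue_measure R \x lebesgue_rV R d)%E mtau.
apply/esym; apply: (@product_measure_unique _ _ _ _ R (@lebesgue_measure R) (lebesgue_rV R d) m) => //.
move=> X Y mX mY; rewrite /m /= /pushforward.
rewrite (_ : tau @^-1` _ = ((fun x => x + a0) @^-1` X) `*` ((fun x => x + a') @^-1` Y)) //.
rewrite product_measure1E//.
- by rewrite -(lebesgue_translation a0 mX) -(IH a' Y mY).
- rewrite -[X in measurable X]setTI.
  have : measurable_fun setT (fun x : measurableTypeR R => x + a0 : measurableTypeR R).
    exact: measurable_funD.
  by apply.
- by rewrite -[X in measurable X]setTI; exact: measurable_translation_rV.
Qed.

Lemma ge0_integral_translation_rV d (a : 'rV[R]_d) (f : 'rV[R]_d -> R) :
  measurable_fun setT f -> (forall x, 0 <= f x) ->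
  (\int[lebesgue_rV R d]_x (f (x + a))%:E = \int[lebesgue_rV R d]_x (f x)%:E)%E.
Proof.
move=> mf f0.
pose m := measure_function_pushforward__canonical__measure_function_Measure
  (lebesgue_rV R d) (measurable_translation_rV a).
transitivity (\int[m]_x (f x)%:E)%E.
  rewrite /m ge0_integral_pushforward//.
  - exact: measurable_translation_rV.
  - exact/measurable_EFinP.
  - by move=> y _; rewrite lee_fin.
by apply: eq_measure_integral => A mA _; exact: lebesgue_rV_translation.
Qed.

Lemma Rintegral_translation_rV d (a : 'rV[R]_d) (f : 'rV[R]_d -> R) :
  (lebesgue_rV R d).-integrable setT (EFin \o f) ->
  (lebesgue_rV R d).-integrable setT (EFin \o (fun x => f (x + a))) /\
  \int[lebesgue_rV R d]_x (f (x + a)) = \int[lebesgue_rV R d]_x (f x).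
Proof.
move=> fi; have /integrableP[/measurable_EFinP mf foo] := fi.
have mfa : measurable_fun setT (fun x : 'rV[R]_d => f (x + a)).
  by apply: measurableT_comp => //; exact: measurable_translation_rV.
pose m := measure_function_pushforward__canonical__measure_function_Measure
  (lebesgue_rV R d) (measurable_translation_rV a).
have fai : (lebesgue_rV R d).-integrable setT (EFin \o (fun x : 'rV[R]_d => f (x + a))).
  apply/integrableP; split; first exact/measurable_EFinP.
  rewrite (_ : integral _ _ _ = integral (lebesgue_rV R d) setT (abse \o (EFin \o f)))//.
  apply: (ge0_integral_translation_rV a (f := fun x => `|f x|)) => //.
  exact: measurableT_comp.
split => //; congr fine.
transitivity (\int[m]_x (f x)%:E)%E; last first.
  by apply: eq_measure_integral => A mA _; exact: lebesgue_rV_translation.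
rewrite /m integral_pushforward//; [exact: measurable_translation_rV|exact/measurable_EFinP].
Qed.

End lebesgue_translation.

(** * The weight 1 + |x|^2 *)

Section bracket.
Context (R : realType) (d : nat).
Implicit Types x y : 'rV[R]_d.

Lemma dotp_ge0 x : 0 <= dotp x x.
Proof. by apply: sumr_ge0 => i _; rewrite -expr2 sqr_ge0. Qed.

Lemma bracket_ge1 x : 1 <= bracket x.
Proof. by rewrite lerDl dotp_ge0. Qed.

Lemma bracket_gt0 x : 0 < bracket x.
Proof. exact: lt_le_trans ltr01 (bracket_ge1 x). Qed.

Lemma bracketX_gt0 x n : 0 < bracket x ^+ n.
Proof. by rewrite exprn_gt0// bracket_gt0. Qed.

Lemma sqr_coord_le_bracket x i : 1 + x ord0 i ^+ 2 <= bracket x.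
Proof.
rewrite lerD2l /dotp (bigD1 i)//= -expr2 lerDl.
by apply: sumr_ge0 => j _; rewrite -expr2 sqr_ge0.
Qed.

Lemma coord_le_bracket x i : `|x ord0 i| <= bracket x.
Proof.
apply: le_trans (sqr_coord_le_bracket x i).
rewrite -(real_normK (num_real (x ord0 i))); set a := `|_|.
by have := sqr_ge0 (a - 1); nra.
Qed.

Lemma measurable_dotp y : measurable_fun setT (fun x => dotp x y).
Proof.
rewrite /dotp; apply: measurable_sum => i; apply: measurable_funM => //.
exact: measurable_coord_rV.
Qed.

Lemma measurable_bracket : measurable_fun setT (fun x => bracket x).
Proof.
rewrite /bracket /dotp; apply: measurable_funD => //; apply: measurable_sum => i.
by apply: measurable_funM; exact: measurable_coord_rV.
Qed.

Lemma measurable_bracketXV n : measurable_fun setT (fun x => (bracket x ^+ n)^-1).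
Proof.
rewrite (_ : (fun _ => _) = (fun x => bracket x `^ (- n%:R))); last first.
  by apply/funext => x; rewrite powRN powR_mulrn// ltW// bracket_gt0.
apply: (measurableT_comp (f := fun t : R => t `^ (- n%:R))); last exact: measurable_bracket.
exact: measurable_powR.
Qed.

End bracket.

Section bracket_integrable.
Variable R : realType.

Let pi1 (t : R) : R := (oneDsqr t)^-1.

Let pi1_ge0 t : 0 <= pi1 t. Proof. by rewrite invr_ge0 addr_ge0// sqr_ge0. Qed.

Let mpi1 : measurable_fun setT pi1.
Proof. by apply: continuous_measurable_fun; exact: continuous_oneDsqrV. Qed.

Let int_pi1 : (\int[lebesgue_measure]_t (pi1 t)%:E = (pi : R)%:E)%E.
Proof.
rewrite ge0_symfun_integralT//.
- rewrite (_ : [set x | _] = `[0, +oo[%classic).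
    by rewrite integral0y_oneDsqr -EFinM mulrC divfK.
  by apply/seteqP; split => x/=; rewrite in_itv/= andbT.
- exact: continuous_oneDsqrV.
- by move=> x; rewrite /pi1 /oneDsqr /= sqrrN.
Qed.

(** Tonelli, one coordinate at a time; each factor 1/(1 + t^2) has integral pi. *)
Lemma integral_prod_oneDsqrV d :
  (\int[lebesgue_rV R d]_x (\prod_(i < d) (oneDsqr (x ord0 i))^-1)%:E = ((pi : R) ^+ d)%:E)%E.
Proof.
have mprod k : measurable_fun setT (fun x : 'rV[R]_k => \prod_(i < k) pi1 (x ord0 i)).
  by apply: measurable_prod => i _; apply: measurableT_comp => //; exact: measurable_coord_rV.
have prod_ge0 k (x : 'rV[R]_k) : 0 <= \prod_(i < k) pi1 (x ord0 i) by exact: prodr_ge0.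
rewrite -[LHS]/(\int[lebesgue_rV R d]_x (\prod_(i < d) pi1 (x ord0 i))%:E)%E.
elim: d => [|d IH].
  rewrite expr0; under eq_integral do rewrite big_ord0.
  by rewrite integral_cst//= diracT mule1.
rewrite /= /lebesgue_cons ge0_integral_pushforward//=; last 3 first.
- exact: measurable_cons_rV.
- by apply/measurable_EFinP; exact: mprod.
- by move=> y _; rewrite lee_fin prod_ge0.
have E p : \prod_(i < d.+1) pi1 (cons_rV p ord0 i) = pi1 p.1 * \prod_(i < d) pi1 (p.2 ord0 i).
  rewrite big_ord_recl cons_rV0; congr (_ * _); apply: eq_bigr => i _.
  by rewrite cons_rVS.
under eq_integral do rewrite /= E.
rewrite fubini_tonelli1/=; last 2 first.
- apply/measurable_EFinP; apply: measurable_funM.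
    by apply: measurableT_comp => //; exact: measurable_fst.
  by apply: (measurableT_comp (mprod d)); exact: measurable_snd.
- by move=> p; rewrite lee_fin; apply: mulr_ge0; [exact: pi1_ge0|exact: prod_ge0].
transitivity (\int[lebesgue_measure]_t (pi ^+ d * pi1 t)%:E)%E.
  apply: eq_integral => t _; rewrite /fubini_F/= nnintZ//; [|exact: mprod|exact: prod_ge0].
  by rewrite IH -EFinM mulrC.
rewrite nnintZ ?exprn_ge0 ?pi_ge0// int_pi1 -EFinM.
by rewrite exprSr.
Qed.

(** Every 1 + x_i^2 is at most [bracket x], so the product of their inverses dominates. Hence the
    exponent [d] in the decay asked of functions that are to be integrated. *)
Lemma integrable_bracketV d :
  (lebesgue_rV R d).-integrable setT (EFin \o (fun x => (bracket x ^+ d)^-1)).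
Proof.
have prod_ge0 (x : 'rV[R]_d) : 0 <= \prod_(i < d) pi1 (x ord0 i) by exact: prodr_ge0.
apply: (@le_integrable_real _ _ _ _ _ (fun x : 'rV[R]_d => \prod_(i < d) pi1 (x ord0 i))).
- exact: measurable_bracketXV.
- move=> x; rewrite ger0_norm; last by rewrite invr_ge0 ltW// bracketX_gt0.
  have -> : bracket x ^+ d = \prod_(i < d) bracket x by rewrite prodr_const card_ord.
  rewrite -prodfV.
  apply: ler_prod => i _; rewrite invr_ge0 ltW ?bracket_gt0//=.
  rewrite lef_pV2; [exact: sqr_coord_le_bracket|rewrite posrE; exact: bracket_gt0|].
  by rewrite posrE; apply: lt_le_trans (oneDsqr_ge1 _).
- apply: integrable_nnint => //.
  + by apply: measurable_prod => i _; apply: measurableT_comp => //; exact: measurable_coord_rV.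
  + by rewrite integral_prod_oneDsqrV ltry.
Qed.

End bracket_integrable.

(** * Schwartz functions and the Fourier transform *)

Section real_schwartz.
Context (R : realType) (d : nat).
Implicit Types (f g : 'rV[R]_d -> R) (x a xi : 'rV[R]_d) (j : 'I_d) (s : seq 'I_d).
Implicit Types (phi : 'rV[R]_d -> R[i]).

Local Notation dir j := (delta_mx ord0 j : 'rV[R]_d).

(** Calculus is done on real functions; [smooth_ReIm] and [schwartz_ReIm] pass between them and
    complex ones. *)
Definition rpderiv j f : 'rV[R]_d -> R := fun x => 'D_(dir j) f x.

Definition rpderivs s f := foldr rpderiv f s.

Definition rsmooth f := forall s, continuous (rpderivs s f) /\
  forall j x, derivable (rpderivs s f) x (dir j).

Definition rapid f := forall N, exists C : R, forall x, bracket x ^+ N * `|f x| <= C.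

Definition rschwartz f := rsmooth f /\ forall s, rapid (rpderivs s f).

Lemma Re_pderivs s phi :
  (fun x => complex.Re (pderivs s phi x)) = rpderivs s (fun x => complex.Re (phi x)).
Proof. by elim: s => //= j s IH; rewrite -IH. Qed.

Lemma Im_pderivs s phi :
  (fun x => complex.Im (pderivs s phi x)) = rpderivs s (fun x => complex.Im (phi x)).
Proof. by elim: s => //= j s IH; rewrite -IH. Qed.

Lemma smooth_ReIm phi : smooth phi <->
  rsmooth (fun x => complex.Re (phi x)) /\ rsmooth (fun x => complex.Im (phi x)).
Proof.
split=> [phis|[phi1 phi2] s].
  split => s; have [c1 c2 dphi] := phis s.
  - by rewrite -Re_pderivs; split => // j x; have [] := dphi j x.
  - by rewrite -Im_pderivs; split => // j x; have [] := dphi j x.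
have [c1 d1] := phi1 s; have [c2 d2] := phi2 s.
rewrite Re_pderivs Im_pderivs; split => // j x.
Qed.

Lemma schwartz_ReIm phi : schwartz phi <->
  rschwartz (fun x => complex.Re (phi x)) /\ rschwartz (fun x => complex.Im (phi x)).
Proof.
split=> [[/smooth_ReIm[s1 s2] dphi]|[[s1 d1] [s2 d2]]].
  split; split => // s N; have [C phiC] := dphi N s; exists C => x; apply: le_trans (phiC x).
  + rewrite -Re_pderivs; apply: ler_wpM2l; last exact: Re_le_normc.
    by rewrite ltW ?bracketX_gt0.
  + rewrite -Im_pderivs; apply: ler_wpM2l; last exact: Im_le_normc.
    by rewrite ltW ?bracketX_gt0.
split; first exact/smooth_ReIm.
move=> N s; have [C1 h1] := d1 s N; have [C2 h2] := d2 s N; exists (C1 + C2) => x.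
have := h1 x; have := h2 x; rewrite -Re_pderivs -Im_pderivs => {}h2 {}h1.
apply: le_trans (lerD h1 h2); rewrite -mulrDr.
by apply: ler_wpM2l; [rewrite ltW ?bracketX_gt0|exact: normc_le_ReIm].
Qed.

Lemma rschwartz_pderivs s f : rschwartz f -> rschwartz (rpderivs s f).
Proof.
move=> [fs fr]; have E t : rpderivs t (rpderivs s f) = rpderivs (t ++ s) f.
  by rewrite /rpderivs foldr_cat.
by split=> t; rewrite E; [exact: fs|exact: fr].
Qed.

Lemma continuous_measurable_rV f : continuous f -> measurable_fun setT f.
Proof.
move=> cf; apply: (measurability _ (RGenInftyO.measurableE R)) => _ [_ [a ->] <-].
rewrite setTI; apply: open_measurable_rV; apply: open_comp; last exact: interval_open.
by move=> x _; exact: cf.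
Qed.

Lemma rapid_integrable f : continuous f -> rapid f ->
  (lebesgue_rV R d).-integrable setT (EFin \o f).
Proof.
move=> cf /(_ d)[C fC].
apply: (@le_integrable_real _ _ _ _ _ (fun x : 'rV[R]_d => C * (bracket x ^+ d)^-1)).
- exact: continuous_measurable_rV.
- move=> x; rewrite -ler_pdivrMr ?invr_gt0 ?bracketX_gt0// invrK mulrC; exact: fC.
- exact/integrable_realZ/integrable_bracketV.
Qed.

Lemma rapidM f g (M : R) : rapid f -> (forall x, `|g x| <= M) -> rapid (fun x => f x * g x).
Proof.
move=> fr gM N; have [C fC] := fr N; exists (C * M) => x.
have M0 : 0 <= M by exact: le_trans (gM x).
rewrite normrM mulrA; apply: ler_pM => //.
by rewrite mulr_ge0// ltW// bracketX_gt0.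
Qed.

Lemma rapidD f g : rapid f -> rapid g -> rapid (fun x => f x + g x).
Proof.
move=> fr gr N; have [C fC] := fr N; have [D gD] := gr N; exists (C + D) => x.
apply: le_trans (lerD (fC x) (gD x)); rewrite -mulrDr.
by apply: ler_wpM2l; [rewrite ltW ?bracketX_gt0|exact: ler_normD].
Qed.

(** Brings directional derivatives to the real line, where the mean value theorem and the product
    and chain rules apply. *)
Lemma is_derive_line f x v (t l : R) : is_derive (t *: v + x) v f l <->
  is_derive t 1 (fun t => f (t *: v + x)) l.
Proof.
have E : (fun h : R => h^-1 *: (((fun t => f (t *: v + x)) \o shift t) (h *: 1) -
      f (t *: v + x))) = (fun h => h^-1 *: ((f \o shift (t *: v + x)) (h *: v) - f (t *: v + x))).
  by apply/funext => h; rewrite /= scalerDl addrA [h%:A]mulr1.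
by split => -[]; rewrite /derivable /derive => c e; split; rewrite /derivable /derive; 
  [rewrite E|rewrite E|rewrite -E|rewrite -E].
Qed.

(** For y = x_j one has y^2 <= 2 (t + y)^2 + 2 t^2 <= 2 (t + y)^2 + 2, and the other coordinates do
    not move. *)
Lemma bracket_shift x (t : R) j : `|t| <= 1 ->
  bracket x <= 3 * bracket (t *: dir j + x).
Proof.
move=> t1; rewrite /bracket /dotp.
have -> : \sum_i x ord0 i * x ord0 i = x ord0 j * x ord0 j +
  \sum_(i | i != j) x ord0 i * x ord0 i by rewrite (bigD1 j).
rewrite [X in _ <= 3 * (1 + X)](bigD1 j)//= !mxE !eqxx mulr1.
have -> : \sum_(i | i != j) (t *: dir j + x) ord0 i * (t *: dir j + x) ord0 i =
    \sum_(i | i != j) x ord0 i * x ord0 i.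
  apply: eq_bigr => i ij; rewrite !mxE eqxx/= (negbTE ij) mulr0 add0r//.
have : 0 <= \sum_(i | i != j) x ord0 i * x ord0 i.
  by apply: sumr_ge0 => i _; rewrite -expr2 sqr_ge0.
move: t1; rewrite ler_norml => /andP[t1 t2].
have : t * t <= 1 by nra.
set S := \sum_(i | _) _; set y := x ord0 j => tt S0.
have : 0 <= (2 * t + y) ^+ 2 by exact: sqr_ge0.
have := sqr_ge0 (3 * t + 2 * y).
nra.
Qed.

End real_schwartz.

(** * Integrals of partial derivatives *)

Section integration_by_parts.
Context (R : realType) (d : nat).
Implicit Types (f g : 'rV[R]_d -> R) (x a xi : 'rV[R]_d) (j : 'I_d).

Local Notation dir j := (delta_mx ord0 j : 'rV[R]_d).
Local Notation lambda := (lebesgue_rV R d).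

Lemma cvg_harmonic_dnbhs : (fun n => n.+1%:R^-1 : R) @ \oo --> (0 : R)^'.
Proof.
move=> A nA; have {}nA : \forall y \near (0 : R), y != 0 -> A y by [].
have hA : \forall n \near \oo, (n.+1%:R^-1 != 0 :> R) -> A n.+1%:R^-1.
  exact: (@cvg_harmonic R _ nA).
by apply: filterS hA => n; apply; rewrite invr_eq0 pnatr_eq0.
Qed.

(** Mean value theorem on the segment, then [bracket_shift] to return from the intermediate point to
    [x]. The bound does not depend on the step [h], as dominated convergence requires. *)
Lemma rapid_dominated j g : (forall x, derivable g x (dir j)) -> rapid (rpderiv j g) ->
  exists C : R, forall (x : 'rV[R]_d) (h : R), 0 < h -> h <= 1 ->
    `|h^-1 * (g (h *: dir j + x) - g x)| <= C * (bracket x ^+ d)^-1.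
Proof.
move=> dg /(_ d)[C gC]; exists (C * 3 ^+ d) => x h h0 h1.
have dline (t : R) : is_derive t 1 (fun t : R => g (t *: dir j + x)) (rpderiv j g (t *: dir j + x)).
  by apply/is_derive_line; apply: DeriveDef => //; exact: dg.
have [|c] := @MVT_segment R (fun t : R => g (t *: dir j + x)) _ 0 h (ltW h0) (fun t _ => dline t).
  apply: derivable_within_continuous => t _.
  by have [] := dline t.
rewrite in_itv/= => /andP[c0 ch]; rewrite scale0r add0r subr0 => ->.
rewrite mulrC mulfK ?gt_eqF//.
have c1 : `|c| <= 1 by rewrite ger0_norm// (le_trans ch).
have b3 := bracket_shift x j c1; set y := c *: dir j + x in b3 *.
rewrite ler_pdivlMr ?bracketX_gt0// mulrC.
apply: (@le_trans _ _ ((3 * bracket y) ^+ d * `|rpderiv j g y|)).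
  apply: ler_wpM2r => //; apply: lerXn2r => //; rewrite nnegrE ltW ?bracket_gt0//.
  by rewrite mulr_gt0// bracket_gt0.
by rewrite exprMn -mulrA mulrC ler_wpM2r.
Qed.

(** By translation invariance every difference quotient of [g] has integral 0; dominated convergence
    passes to the derivative. *)
Lemma integral_rpderiv0 j g : continuous g -> continuous (rpderiv j g) ->
  (forall x, derivable g x (dir j)) -> rapid g -> rapid (rpderiv j g) ->
  \int[lambda]_x rpderiv j g x = 0.
Proof.
move=> cg cdg dg gr dgr.
pose h n : R := n.+1%:R^-1.
have h0 n : 0 < h n by rewrite invr_gt0.
have h1 n : h n <= 1 by rewrite invf_le1// ler1n.
pose q n x := (h n)^-1 * (g (h n *: dir j + x) - g x).
have ig := rapid_integrable cg gr.
have int_q n : \int[lambda]_x q n x = 0.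
  have [ig' e] := Rintegral_translation_rV (h n *: dir j) ig.
  have ig2 : lambda.-integrable setT (EFin \o (fun x : 'rV[R]_d => g (h n *: dir j + x))).
    by apply: eq_integrable ig' => // x _; rewrite /= addrC.
  rewrite /q RintegralZl//; last exact: integrable_realB.
  rewrite RintegralB// -[X in _ - X]e [X in X - _](_ : _ =
    \int[lambda]_x g (x + h n *: dir j)); first by rewrite subrr mulr0.
  by apply: eq_Rintegral => x _; rewrite addrC.
have [C qC] := rapid_dominated dg dgr.
have mq n : measurable_fun setT (q n).
  apply: measurable_funM => //; apply: measurable_funB.
    apply: measurableT_comp; first exact: continuous_measurable_rV.
    apply: (@eq_measurable_fun _ _ _ _ _ (fun x : 'rV[R]_d => x + h n *: dir j)).
      by move=> x _; exact: addrC.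
    exact: measurable_translation_rV.
  exact: continuous_measurable_rV.
have q_dg x : q ^~ x @ \oo --> rpderiv j g x.
  apply: (@cvg_comp _ _ _ h (fun t => t^-1 *: (g (t *: dir j + x) - g x)) \oo (0 : R)^').
    exact: cvg_harmonic_dnbhs.
  exact: (dg x).
have [] := @dominated_convergence _ _ R lambda setT measurableT
  (fun n => EFin \o q n) (EFin \o rpderiv j g)
  (EFin \o (fun x : 'rV[R]_d => C * (bracket x ^+ d)^-1)).
- by move=> n; exact/measurable_EFinP.
- by apply/measurable_EFinP; exact: continuous_measurable_rV cdg.
- by apply: aeW => x _; apply: cvg_EFin; [exact: nearW|exact: q_dg].
- exact/integrable_realZ/integrable_bracketV.
- by apply: aeW => x n _; rewrite /= lee_fin; exact: qC.
move=> _ _ int_cvg.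
rewrite /Rintegral (_ : (\int[lambda]_x _)%E = 0%E)//.
apply: (cvg_unique _ int_cvg) => //.
apply: cvg_near_cst; apply: nearW => n /=.
rewrite -[LHS]fineK; last first.
  apply: integrable_fin_num => //; apply: integrable_realZ; apply: integrable_realB => //.
  have [ig' _] := Rintegral_translation_rV (h n *: dir j) ig.
  by apply: eq_integrable ig' => // x _; rewrite /= addrC.
by congr EFin; exact: int_q.
Qed.

End integration_by_parts.

(** * Cosine and sine transforms *)

Section trigonometric_transforms.
Context (R : realType) (d : nat).
Implicit Types (f g : 'rV[R]_d -> R) (x a xi eta : 'rV[R]_d) (j : 'I_d).

Local Notation dir j := (delta_mx ord0 j : 'rV[R]_d).
Local Notation lambda := (lebesgue_rV R d).

Lemma dotpDl x y xi : dotp (x + y) xi = dotp x xi + dotp y xi.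
Proof. by rewrite /dotp -big_split; apply: eq_bigr => i _; rewrite mxE mulrDl. Qed.

Lemma dotpNl x xi : dotp (- x) xi = - dotp x xi.
Proof. by rewrite /dotp -sumrN; apply: eq_bigr => i _; rewrite mxE mulNr. Qed.

Lemma dotpBr x xi eta : dotp x (xi - eta) = dotp x xi - dotp x eta.
Proof. by rewrite /dotp -sumrB; apply: eq_bigr => i _; rewrite !mxE mulrBr. Qed.

Lemma dotp_dir (t : R) j xi : dotp (t *: dir j) xi = t * xi ord0 j.
Proof.
rewrite /dotp (bigD1 j)//= !mxE !eqxx mulr1 big1 ?addr0// => i ij.
by rewrite !mxE eqxx/= (negbTE ij) mulr0 mul0r.
Qed.

Lemma continuous_funM f g : continuous f -> continuous g -> continuous (fun x => f x * g x).
Proof. by move=> cf cg x; apply: cvgM; [exact: nbhs_filter|exact: cf|exact: cg]. Qed.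

Lemma continuous_funD f g : continuous f -> continuous g -> continuous (fun x => f x + g x).
Proof. by move=> cf cg x; apply: cvgD; [exact: nbhs_filter|exact: cf|exact: cg]. Qed.

Lemma continuous_dotp xi : continuous (fun x => dotp x xi).
Proof.
apply: continuous_big; first exact: add_continuous.
move=> i _; apply: continuous_funM; first exact: coord_continuous.
exact: cst_continuous.
Qed.

Lemma continuous_cos_dotp xi : continuous (fun x => cos (dotp x xi)).
Proof. by move=> x; apply: cvg_comp; [exact: continuous_dotp|exact: continuous_cos]. Qed.

Lemma continuous_sin_dotp xi : continuous (fun x => sin (dotp x xi)).
Proof. by move=> x; apply: cvg_comp; [exact: continuous_dotp|exact: continuous_sin]. Qed.

Definition cosT f xi := \int[lambda]_x (f x * cos (dotp x xi)).
Definition sinT f xi := \int[lambda]_x (f x * sin (dotp x xi)).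

Lemma rapidZ (k : R) f : rapid f -> rapid (fun x => k * f x).
Proof.
move=> fr; rewrite (_ : (fun _ => _) = (fun x => f x * k)); last first.
  by apply/funext => x; rewrite mulrC.
by apply: (rapidM fr (M := `|k|)).
Qed.

Lemma rapid_cos f xi : rapid f -> rapid (fun x => f x * cos (dotp x xi)).
Proof. by move=> fr; apply: (rapidM fr (M := 1)) => x; exact: cos_max. Qed.

Lemma rapid_sin f xi : rapid f -> rapid (fun x => f x * sin (dotp x xi)).
Proof. by move=> fr; apply: (rapidM fr (M := 1)) => x; exact: sin_max. Qed.

Lemma continuous_cosM f xi : continuous f -> continuous (fun x => f x * cos (dotp x xi)).
Proof. by move=> cf; apply: continuous_funM => //; exact: continuous_cos_dotp. Qed.

Lemma continuous_sinM f xi : continuous f -> continuous (fun x => f x * sin (dotp x xi)).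
Proof. by move=> cf; apply: continuous_funM => //; exact: continuous_sin_dotp. Qed.

Lemma integrable_cosM f xi : continuous f -> rapid f ->
  lambda.-integrable setT (EFin \o (fun x => f x * cos (dotp x xi))).
Proof. by move=> cf fr; apply: rapid_integrable; [exact: continuous_cosM|exact: rapid_cos]. Qed.

Lemma integrable_sinM f xi : continuous f -> rapid f ->
  lambda.-integrable setT (EFin \o (fun x => f x * sin (dotp x xi))).
Proof. by move=> cf fr; apply: rapid_integrable; [exact: continuous_sinM|exact: rapid_sin]. Qed.

Lemma is_derive_cosM f xi x j : derivable f x (dir j) ->
  is_derive x (dir j) (fun x => f x * cos (dotp x xi))
    (rpderiv j f x * cos (dotp x xi) - xi ord0 j * (f x * sin (dotp x xi))).
Proof.
move=> df.
have fl : is_derive (0 : R) 1 (fun t => f (t *: dir j + x)) (rpderiv j f x).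
  by apply/is_derive_line; rewrite scale0r add0r; exact: DeriveDef.
rewrite -{1}(add0r x) -(scale0r (dir j)); apply/is_derive_line.
rewrite (_ : (fun t : R => _) = (fun t => f (t *: dir j + x)) *
   (fun t => cos (t * xi ord0 j + dotp x xi))); last first.
  by apply/funext => t /=; rewrite dotpDl dotp_dir.
apply: is_derive_eq.
rewrite /= scale0r mul0r !add0r /GRing.scale/= !mulr1. ring.
Qed.

Lemma is_derive_sinM f xi x j : derivable f x (dir j) ->
  is_derive x (dir j) (fun x => f x * sin (dotp x xi))
    (rpderiv j f x * sin (dotp x xi) + xi ord0 j * (f x * cos (dotp x xi))).
Proof.
move=> df.
have fl : is_derive (0 : R) 1 (fun t => f (t *: dir j + x)) (rpderiv j f x).
  by apply/is_derive_line; rewrite scale0r add0r; exact: DeriveDef.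
rewrite -{1}(add0r x) -(scale0r (dir j)); apply/is_derive_line.
rewrite (_ : (fun t : R => _) = (fun t => f (t *: dir j + x)) *
   (fun t => sin (t * xi ord0 j + dotp x xi))); last first.
  by apply/funext => t /=; rewrite dotpDl dotp_dir.
apply: is_derive_eq.
rewrite /= scale0r mul0r !add0r /GRing.scale/= !mulr1. ring.
Qed.

(** Integration by parts: the derivative of f(x) sin <x, xi> has integral 0. *)
Lemma sinT_rpderiv j f xi : rschwartz f ->
  sinT (rpderiv j f) xi = - (xi ord0 j * cosT f xi).
Proof.
move=> [fs fr]; have [cf df] := fs [::]; have [cf' _] := fs [:: j].
have r0 := fr [::]; have r1 := fr [:: j]; rewrite /= in cf df cf' r0 r1.
have E : rpderiv j (fun x => f x * sin (dotp x xi)) =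
    (fun x => rpderiv j f x * sin (dotp x xi) + xi ord0 j * (f x * cos (dotp x xi))).
  by apply/funext => x; have [_] := is_derive_sinM xi (df j x).
have i1 := integrable_sinM xi cf' r1; have i2 := integrable_cosM xi cf r0.
have : \int[lambda]_x rpderiv j (fun x => f x * sin (dotp x xi)) x = 0.
  apply: integral_rpderiv0.
  - exact: continuous_sinM.
  - rewrite E; apply: continuous_funD; first exact: continuous_sinM.
    by apply: continuous_funM; [exact: cst_continuous|exact: continuous_cosM].
  - by move=> x; have [] := is_derive_sinM xi (df j x).
  - exact: rapid_sin.
  - rewrite E; apply: rapidD; first exact: rapid_sin.
    by apply: rapidZ; exact: rapid_cos.
rewrite E RintegralD//; last exact: integrable_realZ.
by rewrite RintegralZl// => /eqP; rewrite addr_eq0 => /eqP.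
Qed.

Lemma cosT_rpderiv j f xi : rschwartz f ->
  cosT (rpderiv j f) xi = xi ord0 j * sinT f xi.
Proof.
move=> [fs fr]; have [cf df] := fs [::]; have [cf' _] := fs [:: j].
have r0 := fr [::]; have r1 := fr [:: j]; rewrite /= in cf df cf' r0 r1.
have E : rpderiv j (fun x => f x * cos (dotp x xi)) =
    (fun x => rpderiv j f x * cos (dotp x xi) + (- xi ord0 j) * (f x * sin (dotp x xi))).
  by apply/funext => x; rewrite mulNr; have [_] := is_derive_cosM xi (df j x).
have i1 := integrable_cosM xi cf' r1; have i2 := integrable_sinM xi cf r0.
have : \int[lambda]_x rpderiv j (fun x => f x * cos (dotp x xi)) x = 0.
  apply: integral_rpderiv0.
  - exact: continuous_cosM.
  - rewrite E; apply: continuous_funD; first exact: continuous_cosM.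
    by apply: continuous_funM; [exact: cst_continuous|exact: continuous_sinM].
  - by move=> x; have [] := is_derive_cosM xi (df j x).
  - exact: rapid_cos.
  - rewrite E; apply: rapidD; first exact: rapid_cos.
    by apply: rapidZ; exact: rapid_sin.
rewrite E RintegralD//; last exact: integrable_realZ.
by rewrite RintegralZl// mulNr => /eqP; rewrite subr_eq0 => /eqP.
Qed.

Lemma trigT_le f xi : continuous f -> rapid f ->
  `|cosT f xi| <= \int[lambda]_x `|f x| /\ `|sinT f xi| <= \int[lambda]_x `|f x|.
Proof.
move=> cf fr; have fi := integrable_norm (rapid_integrable cf fr).
split; apply: le_trans (le_normr_Rintegral _ _) _ => //.
- exact: integrable_cosM.
- apply: le_Rintegral => //; first exact/integrable_norm/integrable_cosM.
  by move=> x _; rewrite normrM -[leRHS]mulr1 ler_wpM2l// cos_max.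
- exact: integrable_sinM.
- apply: le_Rintegral => //; first exact/integrable_norm/integrable_sinM.
  by move=> x _; rewrite normrM -[leRHS]mulr1 ler_wpM2l// sin_max.
Qed.

(** Each derivative yields a factor xi_j and exchanges the two transforms up to sign, so both bounds
    are proved together. *)
Lemma trigT_decay n j f xi : rschwartz f ->
  `|xi ord0 j| ^+ n * `|cosT f xi| <= \int[lambda]_x `|rpderivs (nseq n j) f x| /\
  `|xi ord0 j| ^+ n * `|sinT f xi| <= \int[lambda]_x `|rpderivs (nseq n j) f x|.
Proof.
elim: n f => [|n IH] f fS.
  by rewrite !expr0 !mul1r; have [fs fr] := fS; apply: trigT_le (fr [::]); have [] := fs [::].
have := IH (rpderiv j f) (rschwartz_pderivs [:: j] fS).
rewrite (_ : rpderivs (nseq n j) (rpderiv j f) = rpderivs (nseq n.+1 j) f); last first.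
  have -> : nseq n.+1 j = nseq n j ++ [:: j] by rewrite -[n.+1]addn1 nseqD.
  by rewrite /rpderivs foldr_cat.
rewrite cosT_rpderiv// sinT_rpderiv// normrN !normrM !mulrA -!exprSr.
by case.
Qed.

Lemma cosT_translation a f xi : continuous f -> rapid f ->
  cosT (fun x => f (x - a)) xi =
    cos (dotp a xi) * cosT f xi - sin (dotp a xi) * sinT f xi.
Proof.
move=> cf fr; have ic := integrable_cosM xi cf fr; have isn := integrable_sinM xi cf fr.
pose g x := f x * cos (dotp x xi + dotp a xi).
have gE x : g x = cos (dotp a xi) * (f x * cos (dotp x xi)) - sin (dotp a xi) * (f x * sin (dotp x xi)).
  by rewrite /g cosD; ring.
have gi : lambda.-integrable setT (EFin \o g).
  rewrite (funext gE); apply: integrable_realB; exact: integrable_realZ.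
have [_ e] := Rintegral_translation_rV (- a) gi.
transitivity (\int[lambda]_x g (x - a)).
  by apply: eq_Rintegral => x _; rewrite /g dotpDl dotpNl subrK.
rewrite e (funext gE) RintegralB// ?RintegralZl//; exact: integrable_realZ.
Qed.

Lemma sinT_translation a f xi : continuous f -> rapid f ->
  sinT (fun x => f (x - a)) xi =
    cos (dotp a xi) * sinT f xi + sin (dotp a xi) * cosT f xi.
Proof.
move=> cf fr; have ic := integrable_cosM xi cf fr; have isn := integrable_sinM xi cf fr.
pose g x := f x * sin (dotp x xi + dotp a xi).
have gE x : g x = cos (dotp a xi) * (f x * sin (dotp x xi)) + sin (dotp a xi) * (f x * cos (dotp x xi)).
  by rewrite /g sinD; ring.
have gi : lambda.-integrable setT (EFin \o g).
  rewrite (funext gE); apply: integrable_realD; exact: integrable_realZ.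
have [_ e] := Rintegral_translation_rV (- a) gi.
transitivity (\int[lambda]_x g (x - a)).
  by apply: eq_Rintegral => x _; rewrite /g dotpDl dotpNl subrK.
rewrite e (funext gE) RintegralD// ?RintegralZl//; exact: integrable_realZ.
Qed.

End trigonometric_transforms.

(** * The complex Fourier transform: continuity, linearity, translation, decay *)

Section fourier_transform.
Context (R : realType) (d : nat).
Implicit Types (f g : 'rV[R]_d -> R) (x a xi eta : 'rV[R]_d) (j : 'I_d).
Implicit Types (phi psi : 'rV[R]_d -> R[i]).

Local Notation lambda := (lebesgue_rV R d).
Local Notation cst2pi := ((2 * pi) `^ (- (d%:R / 2)) : R).

Lemma norm_coord_le (x : 'rV[R]_d) j : `|x ord0 j| <= `|x|.
Proof.
have /mapP[k Hk ->] : `|x ord0 j| \in [seq `|x y.1 y.2| | y : 'I_1 * 'I_d].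
  by apply/mapP; exists (ord0, j) => //=; rewrite mem_enum.
by rewrite [leRHS]/Num.Def.normr /= mx_normrE; apply/bigmax_geP; right => /=; exists k.
Qed.

Lemma lipschitz_cos (u v : R) : `|cos u - cos v| <= `|u - v|.
Proof.
wlog uv : u v / u <= v.
  by move=> h; have [/h//|/ltW/h] := leP u v; rewrite distrC (distrC v).
have [|c _] := @MVT_segment _ (@cos R) (fun t => - sin t) u v uv (fun t _ => is_derive_cos t).
  exact/continuous_subspaceT/continuous_cos.
rewrite distrC (distrC u) => ->; rewrite normrM normrN -[leRHS]mul1r.
by rewrite ler_wpM2r// sin_max.
Qed.

Lemma lipschitz_sin (u v : R) : `|sin u - sin v| <= `|u - v|.
Proof.
wlog uv : u v / u <= v.
  by move=> h; have [/h//|/ltW/h] := leP u v; rewrite distrC (distrC v).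
have [|c _] := @MVT_segment _ (@sin R) (@cos R) u v uv (fun t _ => is_derive_sin t).
  exact/continuous_subspaceT/continuous_sin.
rewrite distrC (distrC u) => ->; rewrite normrM -[leRHS]mul1r.
by rewrite ler_wpM2r// cos_max.
Qed.

Lemma dotp_le x a : `|dotp x a| <= d%:R * bracket x * `|a|.
Proof.
apply: le_trans (ler_norm_sum _ _ _) _.
apply: (@le_trans _ _ (\sum_(i < d) bracket x * `|a|)).
  apply: ler_sum => i _; rewrite normrM.
  by apply: ler_pM => //; [exact: coord_le_bracket|exact: norm_coord_le].
by rewrite sumr_const card_ord -[leLHS]mulr_natl mulrA.
Qed.

Lemma lipschitz_continuous (F : 'rV[R]_d -> R) (K : R) :
  (forall xi eta, `|F xi - F eta| <= K * `|xi - eta|) -> continuous F.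
Proof.
move=> FK xi A /nbhs_ballP[e /= e0 eA].
have K1 : 0 < `|K| + 1 by rewrite ltr_wpDl.
apply/nbhs_ballP; exists (e / (`|K| + 1)); first by rewrite /= divr_gt0.
move=> eta; rewrite mx_norm_ball /ball_ /= => xieta; apply: eA.
rewrite /ball /= /ball_ /=; apply: le_lt_trans (FK _ _) _.
apply: (@le_lt_trans _ _ ((`|K| + 1) * `|xi - eta|)).
  by rewrite ler_wpM2r// (le_trans (ler_norm K))// lerDl.
by rewrite mulrC -ltr_pdivlMr.
Qed.

Let integrable_dotp f a : continuous f -> rapid f ->
  lambda.-integrable setT (EFin \o (fun x : 'rV[R]_d => `|f x| * bracket x)).
Proof.
move=> cf fr; have [C fC] := fr d.+1.
apply: (@le_integrable_real _ _ _ _ _ (fun x : 'rV[R]_d => C * (bracket x ^+ d)^-1)).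
- apply: measurable_funM; last exact: measurable_bracket.
  by apply: measurableT_comp => //; exact: continuous_measurable_rV.
- move=> x; rewrite normrM normr_id (ger0_norm (ltW (bracket_gt0 x))).
  rewrite -ler_pdivrMr ?invr_gt0 ?bracketX_gt0// invrK.
  by apply: le_trans (fC x); rewrite -mulrA -exprS mulrC.
- exact/integrable_realZ/integrable_bracketV.
Qed.

(** The transform is Lipschitz: the cosine is 1-Lipschitz and |<x, xi - eta>| grows at most like
    [bracket x], against which [f] is integrable. Continuity then gives the measurability of
    [fourier phi]. *)
Lemma continuous_cosT f : continuous f -> rapid f -> continuous (cosT f).
Proof.
move=> cf fr; have fi := integrable_dotp 0 cf fr.
apply: (@lipschitz_continuous _ (d%:R * \int[lambda]_x (`|f x| * bracket x))) => xi eta.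
have i1 := integrable_cosM xi cf fr; have i2 := integrable_cosM eta cf fr.
rewrite /cosT -RintegralB//; apply: le_trans (le_normr_Rintegral _ _) _ => //.
  exact: integrable_realB.
rewrite mulrAC -RintegralZl//; apply: le_Rintegral => //.
- exact/integrable_norm/integrable_realB.
- exact: integrable_realZ.
move=> x _; rewrite -mulrBr normrM.
apply: le_trans (ler_wpM2l (normr_ge0 _) (lipschitz_cos _ _)) _.
rewrite -dotpBr; apply: le_trans (ler_wpM2l (normr_ge0 _) (dotp_le _ _)) _.
by rewrite le_eqVlt; apply/orP; left; apply/eqP; ring.
Qed.

Lemma continuous_sinT f : continuous f -> rapid f -> continuous (sinT f).
Proof.
move=> cf fr; have fi := integrable_dotp 0 cf fr.
apply: (@lipschitz_continuous _ (d%:R * \int[lambda]_x (`|f x| * bracket x))) => xi eta.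
have i1 := integrable_sinM xi cf fr; have i2 := integrable_sinM eta cf fr.
rewrite /sinT -RintegralB//; apply: le_trans (le_normr_Rintegral _ _) _ => //.
  exact: integrable_realB.
rewrite mulrAC -RintegralZl//; apply: le_Rintegral => //.
- exact/integrable_norm/integrable_realB.
- exact: integrable_realZ.
move=> x _; rewrite -mulrBr normrM.
apply: le_trans (ler_wpM2l (normr_ge0 _) (lipschitz_sin _ _)) _.
rewrite -dotpBr; apply: le_trans (ler_wpM2l (normr_ge0 _) (dotp_le _ _)) _.
by rewrite le_eqVlt; apply/orP; left; apply/eqP; ring.
Qed.

Definition crapid phi :=
  [/\ continuous (fun x => complex.Re (phi x)), rapid (fun x => complex.Re (phi x)),
      continuous (fun x => complex.Im (phi x)) & rapid (fun x => complex.Im (phi x))].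

Lemma schwartz_crapid phi : schwartz phi -> crapid phi.
Proof.
move=> /schwartz_ReIm[[s1 d1] [s2 d2]]; split; [|exact: (d1 [::])| |exact: (d2 [::])].
- by have [] := s1 [::].
- by have [] := s2 [::].
Qed.

Lemma fourierE phi xi : crapid phi -> fourier phi xi =
  (cst2pi * (cosT (fun x => complex.Re (phi x)) xi + sinT (fun x => complex.Im (phi x)) xi)) +i*
  (cst2pi * (cosT (fun x => complex.Im (phi x)) xi - sinT (fun x => complex.Re (phi x)) xi)).
Proof.
move=> [c1 r1 c2 r2].
have i1 := integrable_cosM xi c1 r1; have i2 := integrable_sinM xi c1 r1.
have i3 := integrable_cosM xi c2 r2; have i4 := integrable_sinM xi c2 r2.
rewrite /fourier; set c := _ `^ _; apply: eq_ReIm; rewrite !ReImE /cintegral /= mul0r ?subr0 ?addr0.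
- congr (_ * _); rewrite /cosT /sinT -RintegralD//; apply: eq_Rintegral => x _.
  by rewrite !ReImE /=; ring.
- congr (_ * _); rewrite /cosT /sinT -RintegralB//; apply: eq_Rintegral => x _.
  by rewrite !ReImE /=; ring.
Qed.

Lemma fourier_cmeasurable phi : crapid phi -> cmeasurable (fourier phi).
Proof.
move=> fphi; have [c1 r1 c2 r2] := fphi; split.
- rewrite (_ : (fun _ => _) = (fun xi => cst2pi * (cosT (fun x => complex.Re (phi x)) xi +
    sinT (fun x => complex.Im (phi x)) xi))); last by apply/funext => xi; rewrite fourierE.
  apply: measurable_funM => //; apply: measurable_funD; apply: continuous_measurable_rV.
    exact: continuous_cosT.
  exact: continuous_sinT.
- rewrite (_ : (fun _ => _) = (fun xi => cst2pi * (cosT (fun x => complex.Im (phi x)) xi -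
    sinT (fun x => complex.Re (phi x)) xi))); last by apply/funext => xi; rewrite fourierE.
  apply: measurable_funM => //; apply: measurable_funB; apply: continuous_measurable_rV.
    exact: continuous_cosT.
  exact: continuous_sinT.
Qed.

Lemma fourier_linear (c : R[i]) phi psi : crapid phi -> crapid psi ->
  fourier (fun x => c * phi x + psi x) = (fun xi => c * fourier phi xi + fourier psi xi).
Proof.
move=> fphi fpsi.
have ci chi xi : crapid chi ->
    cintegrable lambda (fun x => chi x * (cos (dotp x xi) -i* sin (dotp x xi))).
  move=> [c1 r1 c2 r2].
  have i1 := integrable_cosM xi c1 r1; have i2 := integrable_sinM xi c1 r1.
  have i3 := integrable_cosM xi c2 r2; have i4 := integrable_sinM xi c2 r2.
  split.
  - have := integrable_realD i1 i4; apply: eq_integrable => // x _.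
    by rewrite /= !ReImE /=; congr EFin; ring.
  - have := integrable_realB i3 i2; apply: eq_integrable => // x _.
    by rewrite /= !ReImE /=; congr EFin; ring.
apply/funext => xi; rewrite /fourier mulrCA -mulrDr; congr (_ * _).
rewrite -(cintegralZ c (ci _ xi fphi)) -(cintegralD (cintegrableZ c (ci _ xi fphi)) (ci _ xi fpsi)).
by congr (cintegral _ _); apply/funext => x; rewrite mulrDl mulrA.
Qed.

Lemma fourier_translate a phi : crapid phi -> crapid (translate a phi) ->
  fourier (translate a phi) =
  (fun xi => (cos (dotp a xi) -i* sin (dotp a xi)) * fourier phi xi).
Proof.
move=> fphi ftphi; apply/funext => xi; rewrite !fourierE//.
have [c1 r1 c2 r2] := fphi.
rewrite /translate (cosT_translation a xi c1 r1) (cosT_translation a xi c2 r2).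
rewrite (sinT_translation a xi c2 r2) (sinT_translation a xi c1 r1).
by apply: eq_ReIm; rewrite !ReImE /=; ring.
Qed.

Definition bracket_mass : R := \int[lambda]_x (bracket x ^+ d)^-1.

Lemma bracket_mass_ge0 : 0 <= bracket_mass.
Proof. by apply: Rintegral_ge0 => x _; rewrite invr_ge0 ltW// bracketX_gt0. Qed.

Lemma Rintegral_rapid_le f (C : R) : continuous f ->
  (forall x, bracket x ^+ d * `|f x| <= C) ->
  \int[lambda]_x `|f x| <= C * bracket_mass.
Proof.
move=> cf fC; rewrite -RintegralZl//; last exact: integrable_bracketV.
have fle x : `|f x| <= C * (bracket x ^+ d)^-1.
  by rewrite -ler_pdivrMr ?invr_gt0 ?bracketX_gt0// invrK mulrC; exact: fC.
have i2 : lambda.-integrable setT (EFin \o (fun x : 'rV[R]_d => C * (bracket x ^+ d)^-1)).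
  exact/integrable_realZ/integrable_bracketV.
apply: le_Rintegral => //.
apply: le_integrable_real i2.
  by apply: measurableT_comp => //; exact: continuous_measurable_rV.
by move=> x; rewrite normr_id.
Qed.

(** If M is the maximum of 1 and the xi_j^2, then [bracket xi] <= (d + 1) M, and M^N is one of the
    summands on the right. Powers of single coordinates, obtained from repeated derivatives in one
    direction, thus control all polynomial decay. *)
Lemma bracketX_le xi N : bracket xi ^+ N <= d.+1%:R ^+ N * (1 + \sum_j `|xi ord0 j| ^+ (2 * N)).
Proof.
pose M : R := \big[Num.max/1]_j (`|xi ord0 j| ^+ 2).
have M1 : 1 <= M by apply: bigmax_ge_id.
have Mj j : `|xi ord0 j| ^+ 2 <= M by exact: le_bigmax.
have bM : bracket xi <= d.+1%:R * M.
  rewrite -addn1 natrD mulrDl mul1r addrC lerD//.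
  apply: (@le_trans _ _ (\sum_(j < d) M)); last by rewrite sumr_const card_ord mulr_natl.
  by apply: ler_sum => j _; rewrite -expr2 -(real_normK (num_real _)).
have MN : M ^+ N <= 1 + \sum_j `|xi ord0 j| ^+ (2 * N).
  have S0 : 0 <= \sum_j `|xi ord0 j| ^+ (2 * N) by apply: sumr_ge0 => j _; exact: exprn_ge0.
  rewrite /M; elim/big_ind : _ => [|x y hx hy|j _].
  - by rewrite expr1n lerDl.
  - by rewrite /Num.max; case: ifP.
  - rewrite -exprM (bigD1 j)//= addrCA lerDl addr_ge0//.
    by apply: sumr_ge0 => k _; exact: exprn_ge0.
apply: le_trans (_ : (d.+1%:R * M) ^+ N <= _).
  apply: lerXn2r => //; rewrite nnegrE; first by rewrite ltW// bracket_gt0.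
  by rewrite mulr_ge0// (le_trans _ M1).
by rewrite exprMn ler_wpM2l// exprn_ge0.
Qed.

(** The 4 counts the cosine and sine transforms of the real and imaginary parts. *)
Definition decay_cst (N : nat) : R := d.+1%:R ^+ N * (4 * cst2pi * bracket_mass).

(** The bound is linear in [A], and only derivatives of orders 0 and 2 N enter it. The same estimate
    therefore gives both the decay of one transform and continuity on the Schwartz space. *)
Lemma fourier_decay N phi (A : seq 'I_d -> R) : schwartz phi ->
  (forall s x, bracket x ^+ d * normc (pderivs s phi x) <= A s) ->
  forall xi, bracket xi ^+ N * normc (fourier phi xi) <=
    decay_cst N * (A [::] + \sum_j A (nseq (2 * N) j)).
Proof.
move=> sphi phiA xi; have [S1 S2] := proj1 (schwartz_ReIm phi) sphi.
have c0 : 0 <= cst2pi by exact: powR_ge0.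
have m0 := bracket_mass_ge0.
(* Here [t] stands for 1 or a power of |xi_j|, and [s] for the derivatives that pay for it. *)
have key (t : R) (s : seq 'I_d) : 0 <= t ->
    (forall f, rschwartz f -> t * `|cosT f xi| <= \int[lambda]_x `|rpderivs s f x| /\
      t * `|sinT f xi| <= \int[lambda]_x `|rpderivs s f x|) ->
    t * normc (fourier phi xi) <= 4 * cst2pi * bracket_mass * A s.
  move=> t0 ht.
  have B (r : R[i] -> R) f : rschwartz f ->
      (forall z, `|r z| <= normc z) ->
      rpderivs s f = (fun x => r (pderivs s phi x)) ->
      t * `|cosT f xi| <= A s * bracket_mass /\ t * `|sinT f xi| <= A s * bracket_mass.
    move=> fS rn fE; have [h1 h2] := ht f fS.
    have h3 : \int[lambda]_x `|rpderivs s f x| <= A s * bracket_mass.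
      apply: Rintegral_rapid_le; first by have [fs _] := fS; have [] := fs s.
      move=> x; apply: le_trans (phiA s x).
      by rewrite fE ler_wpM2l// ltW// bracketX_gt0.
    by split; [exact: le_trans h3|exact: le_trans h3].
  have [] := B _ _ S1 (@Re_le_normc R) (esym (Re_pderivs _ _)).
  have [] := B _ _ S2 (@Im_le_normc R) (esym (Im_pderivs _ _)).
  rewrite fourierE; last exact: schwartz_crapid.
  set a := cosT _ xi; set b := sinT _ xi; set a' := cosT _ xi; set b' := sinT _ xi.
  have -> : 4 * cst2pi * bracket_mass * A s = cst2pi * (4 * (A s * bracket_mass)) by ring.
  move: (A s * bracket_mass) => K ha hb ha' hb'.
  apply: le_trans (ler_wpM2l t0 (normc_le_ReIm _)) _ => /=.
  rewrite !normrM (ger0_norm c0) -mulrDr mulrCA; apply: ler_wpM2l => //.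
  apply: (@le_trans _ _ (t * ((`|a'| + `|b|) + (`|a| + `|b'|)))).
    by apply: ler_wpM2l => //; apply: lerD; [exact: ler_normD|exact: ler_normB].
  by rewrite !mulrDr; lra.
have k0 : 1 * normc (fourier phi xi) <= 4 * cst2pi * bracket_mass * A [::].
  by apply: key => // f [fs fr]; rewrite !mul1r; apply: trigT_le (fr [::]); have [] := fs [::].
have kj j : `|xi ord0 j| ^+ (2 * N) * normc (fourier phi xi) <=
    4 * cst2pi * bracket_mass * A (nseq (2 * N) j).
  by apply: key => [|f fS]; [exact: exprn_ge0|exact: trigT_decay].
apply: le_trans (ler_wpM2r (normc_ge0 _) (bracketX_le xi N)) _.
rewrite /decay_cst -!mulrA; apply: ler_wpM2l; first exact: exprn_ge0.
rewrite mulrDl !mulrA mulrDr; apply: lerD => //.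
by rewrite mulr_suml mulr_sumr; apply: ler_sum.
Qed.

End fourier_transform.

(** * Stability properties of Schwartz and test functions *)

Section test_function_closure.
Context (R : realType) (d : nat).
Implicit Types (f g : 'rV[R]_d -> R) (x a xi eta : 'rV[R]_d) (j : 'I_d) (s : seq 'I_d).
Implicit Types (phi psi : 'rV[R]_d -> R[i]).

Local Notation dir j := (delta_mx ord0 j : 'rV[R]_d).

Lemma rpderivs_lin (k : R) f g s : rsmooth f -> rsmooth g ->
  rpderivs s (fun x => k * f x + g x) = (fun x => k * rpderivs s f x + rpderivs s g x).
Proof.
move=> fs gs; elim: s => //= j s ->; apply/funext => x; rewrite /rpderiv.
have [_ df] := fs s; have [_ dg] := gs s.
have -> : (fun x => k * rpderivs s f x + rpderivs s g x) = k *: rpderivs s f + rpderivs s g by [].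
rewrite deriveD//; last exact: derivableZ.
by rewrite deriveZ.
Qed.

Lemma rsmooth_lin (k : R) f g : rsmooth f -> rsmooth g -> rsmooth (fun x => k * f x + g x).
Proof.
move=> fs gs s; rewrite rpderivs_lin//; have [cf df] := fs s; have [cg dg] := gs s; split.
  apply: continuous_funD => //; apply: continuous_funM => //; exact: cst_continuous.
move=> j x.
have -> : (fun x => k * rpderivs s f x + rpderivs s g x) = k *: rpderivs s f + rpderivs s g by [].
by apply: derivableD; [exact: derivableZ|].
Qed.

Lemma rschwartz_lin (k : R) f g : rschwartz f -> rschwartz g ->
  rschwartz (fun x => k * f x + g x).
Proof.
move=> [fs fr] [gs gr]; split; first exact: rsmooth_lin.
by move=> s; rewrite rpderivs_lin//; apply: rapidD => //; exact: rapidZ.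
Qed.

Let Re_lin (a : R[i]) phi psi : (fun x => complex.Re (a * phi x + psi x)) =
  (fun x => complex.Re a * complex.Re (phi x) + (- complex.Im a * complex.Im (phi x) + complex.Re (psi x))).
Proof. by apply/funext => x; rewrite !ReImE; ring. Qed.

Let Im_lin (a : R[i]) phi psi : (fun x => complex.Im (a * phi x + psi x)) =
  (fun x => complex.Re a * complex.Im (phi x) + (complex.Im a * complex.Re (phi x) + complex.Im (psi x))).
Proof. by apply/funext => x; rewrite !ReImE; ring. Qed.

Lemma smooth_lin (a : R[i]) phi psi : smooth phi -> smooth psi ->
  smooth (fun x => a * phi x + psi x).
Proof.
move=> /smooth_ReIm[p1 p2] /smooth_ReIm[q1 q2]; apply/smooth_ReIm.
rewrite Re_lin Im_lin.
split; first exact: (rsmooth_lin _ p1 (rsmooth_lin _ p2 q1)).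
exact: (rsmooth_lin _ p2 (rsmooth_lin _ p1 q2)).
Qed.

Lemma schwartz_lin (a : R[i]) phi psi : schwartz phi -> schwartz psi ->
  schwartz (fun x => a * phi x + psi x).
Proof.
move=> /schwartz_ReIm[p1 p2] /schwartz_ReIm[q1 q2]; apply/schwartz_ReIm.
rewrite Re_lin Im_lin.
split; first exact: (rschwartz_lin _ p1 (rschwartz_lin _ p2 q1)).
exact: (rschwartz_lin _ p2 (rschwartz_lin _ p1 q2)).
Qed.

Lemma test_function_lin (a : R[i]) phi psi : test_function phi -> test_function psi ->
  test_function (fun x => a * phi x + psi x).
Proof.
move=> [sphi [K cK Kphi]] [spsi [L cL Lpsi]]; split; first exact: smooth_lin.
exists (K `|` L); first exact: compactU.
move=> x /not_orP[Kx Lx]; rewrite Kphi ?Lpsi//.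
by rewrite mulr0 addr0.
Qed.

Lemma continuous_translation a : continuous (fun x : 'rV[R]_d => x + a).
Proof.
move=> x A /nbhs_ballP[e e0 eA]; apply/nbhs_ballP; exists e => // y xy; apply: eA.
move: xy; rewrite mx_norm_ball /ball_ /=.
by rewrite opprD addrACA subrr addr0.
Qed.

Let growth_translate a f x v :
  (fun h : R => h^-1 *: (((fun x => f (x - a)) \o shift x) (h *: v) - f (x - a))) =
  (fun h => h^-1 *: ((f \o shift (x - a)) (h *: v) - f (x - a))).
Proof. by apply/funext => h; rewrite /= addrA. Qed.

Lemma rpderivs_translate a f s : rpderivs s (fun x => f (x - a)) = (fun x => rpderivs s f (x - a)).
Proof.
elim: s => //= j s ->; apply/funext => x; rewrite /rpderiv /derive.
by rewrite growth_translate.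
Qed.

Lemma rsmooth_translate a f : rsmooth f -> rsmooth (fun x => f (x - a)).
Proof.
move=> fs s; rewrite rpderivs_translate; have [cf df] := fs s; split.
  move=> x; apply: (@continuous_comp _ _ _ (fun x => x - a)); last exact: cf.
  exact: continuous_translation.
by move=> j x; have := df j (x - a); rewrite /derivable growth_translate.
Qed.

Lemma test_function_translate a phi : test_function phi -> test_function (translate a phi).
Proof.
move=> [/smooth_ReIm[s1 s2] [K cK Kphi]]; split.
  by apply/smooth_ReIm; split; [exact: (rsmooth_translate a s1)|exact: (rsmooth_translate a s2)].
exists ((fun x => x + a) @` K).
  apply: continuous_compact => //; apply: continuous_subspaceT.
  exact: continuous_translation.
move=> x Kx; rewrite /translate Kphi// => Kxa; apply: Kx.
by exists (x - a) => //; rewrite subrK.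
Qed.

(** The complement of [K] is open, so near each of its points the function to be differentiated is
    identically 0. *)
Lemma rpderivs_supp f (K : set 'rV[R]_d) s : closed K -> (forall x, ~ K x -> f x = 0) ->
  forall x, ~ K x -> rpderivs s f x = 0.
Proof.
move=> cK fK; elim: s => //= j s IH x Kx; rewrite /rpderiv.
rewrite (@near_eq_derive _ _ _ _ (cst 0)); first exact: derive_cst.
have : nbhs x (~` K) by apply: open_nbhs_nbhs; split => //; exact: closed_openC.
by apply: filterS => y /IH.
Qed.

Lemma compact_support_rapid f (K : set 'rV[R]_d) : compact K -> continuous f ->
  (forall x, ~ K x -> f x = 0) -> rapid f.
Proof.
move=> cK cf fK N.
pose g x := bracket x ^+ N * f x.
have cg : continuous g.
  apply: continuous_funM => //.
  have cb : continuous (fun x : 'rV[R]_d => bracket x).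
    apply: continuous_funD; first exact: cst_continuous.
    apply: continuous_big; first exact: add_continuous.
    by move=> i _; apply: continuous_funM; exact: coord_continuous.
  elim: N {g} => [|N IH]; first exact: cst_continuous.
  rewrite (_ : (fun _ => _) = (fun x => bracket x * bracket x ^+ N)).
    exact: continuous_funM.
  by apply/funext => x; rewrite exprS.
have /compact_bounded[M [_ MB]] : compact (g @` K).
  by apply: continuous_compact => //; exact: continuous_subspaceT.
have {}MB := MB (`|M| + 1); exists (`|M| + 1) => x.
have M1 : M < `|M| + 1 by rewrite (le_lt_trans (ler_norm M))// ltrDl.
have [Kx|Kx] := pselect (K x); last by rewrite fK// normr0 mulr0 addr_ge0.
have := MB M1 (g x) (imageP _ Kx).
by move=> /=; rewrite /g normrM (ger0_norm (ltW (bracketX_gt0 x N))).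
Qed.

Lemma test_function_schwartz phi : test_function phi -> schwartz phi.
Proof.
move=> [/smooth_ReIm[s1 s2] [K cK Kphi]]; apply/schwartz_ReIm.
have clK : closed K by apply: compact_closed => //; exact: norm_hausdorff.
split; split => // s; apply: compact_support_rapid cK _ _.
- by have [] := s1 s.
- by apply: rpderivs_supp => // x Kx; rewrite Kphi.
- by have [] := s2 s.
- by apply: rpderivs_supp => // x Kx; rewrite Kphi.
Qed.

End test_function_closure.

(** * Bump functions *)

Section flat_function.
Variable R : realType.
Implicit Types (p : {poly R}) (x y t : R).

(* The class of these functions is closed under differentiation. *)
Definition flat p x : R := if 0 < x then p.[x^-1] * expR (- x^-1) else 0.

(** Horner induction: one more factor y is absorbed by half of the exponent, since e y / 2 <= exp (e
    y / 2). *)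
Lemma poly_le_expR p (e : R) : 0 < e ->
  exists2 C, 0 <= C & forall y, 0 <= y -> `|p.[y]| <= C * expR (e * y).
Proof.
elim/poly_ind: p e => [|p c IH] e e0.
  by exists 0 => // y _; rewrite horner0 normr0 mul0r.
have e2 : 0 < e / 2 by rewrite divr_gt0.
have [C C0 pC] := IH (e / 2) e2; exists (C * (e / 2)^-1 + `|c|).
  by rewrite addr_ge0// mulr_ge0// invr_ge0 ltW.
move=> y y0; rewrite hornerMXaddC; apply: le_trans (ler_normD _ _) _.
rewrite mulrDl; apply: lerD; last first.
  rewrite ler_peMr// -expR0 ler_expR mulr_ge0// ltW//.
rewrite normrM (ger0_norm y0).
have -> : e * y = e / 2 * y + e / 2 * y by field.
rewrite expRD mulrACA; apply: ler_pM => //; first exact: pC.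
rewrite mulrC ler_pdivlMr// mulrC.
by apply: le_trans (expR_ge1Dx _); rewrite lerDr.
Qed.

(** The exponential bound for p X^2 at 1/t: the two extra powers of 1/t become t^2 on the other
    side. *)
Lemma flat_le p : exists2 C, 0 <= C & forall t, `|flat p t| <= C * t ^+ 2.
Proof.
have [C C0 pC] := poly_le_expR (p * 'X^2) ltr01; exists C => // t.
rewrite /flat; case: ifPn => [t0|_]; last by rewrite normr0 mulr_ge0// sqr_ge0.
have ti : 0 <= t^-1 by rewrite invr_ge0 ltW.
have := pC _ ti; rewrite hornerM hornerXn normrM mul1r (ger0_norm (exprn_ge0 2 ti)).
rewrite exprVn ler_pdivrMr ?exprn_gt0// => h.
rewrite normrM (ger0_norm (expR_ge0 _)) expRN ler_pdivrMr ?expR_gt0//.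
by rewrite mulrAC.
Qed.

(** For x > 0 the derivative of p(1/x) exp(-1/x) is x^-2 (p - p')(1/x) exp(-1/x). At 0 the quadratic
    bound of [flat_le] forces the difference quotients to 0. *)
Lemma is_derive_flat p x : is_derive x 1 (flat p) (flat ('X^2 * (p - p^`())) x).
Proof.
have [x0|x0|->] := ltgtP x 0.
- rewrite (_ : flat (_ * _) x = 0); last by rewrite /flat ltNge (ltW x0).
  apply: (@near_eq_is_derive _ _ _ (cst 0)).
    near=> y; rewrite /flat ltNge (_ : y <= 0)//.
    by near: y; apply: filterS (lt_nbhsl x0) => y /ltW.
- rewrite (_ : flat (_ * _) x = x ^- 2 * (p.[x^-1] - p^`().[x^-1]) * expR (- x^-1)); last first.
    by rewrite /flat x0 !hornerE exprVn.
  apply: (@near_eq_is_derive _ _ _ (fun y => p.[y^-1] * expR (- y^-1))).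
    near=> y; rewrite /flat (_ : 0 < y)//.
    by near: y; exact: lt_nbhsr.
  have xn0 : x != 0 by rewrite gt_eqF.
  have dV : is_derive x 1 (fun y : R => y^-1) (- x ^- 2).
    have dV := @is_deriveV R id x 1 1 xn0 (is_derive_id x 1).
    by apply: (is_derive_eq dV); rewrite /GRing.scale/= mulr1.
  have d1 : is_derive x 1 (fun y => p.[y^-1]) (p^`().[x^-1] * - x ^- 2).
    exact: (is_derive1_comp (f := fun y => p.[y]) (is_derive_poly p x^-1) dV).
  have d2 : is_derive x 1 (fun y => expR (- y^-1)) (expR (- x^-1) * x ^- 2).
    have := @is_deriveN _ _ _ _ _ _ _ dV => dN.
    have dexp := is_derive1_comp (f := expR) (g := fun y => - y^-1) (is_derive_expR (- x^-1)) dN.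
    by apply: (is_derive_eq dexp); rewrite opprK.
  have dM := is_deriveM d1 d2; apply: (is_derive_eq dM).
  by rewrite /GRing.scale/=; ring.
- have [C C0 fC] := flat_le p.
  rewrite (_ : flat (_ * _) 0 = 0); last by rewrite /flat ltxx.
  have C1 : 0 < C + 1 by rewrite ltr_wpDl.
  have f0 : flat p 0 = 0 by rewrite /flat ltxx.
  have cvg0 : (fun h : R => h^-1 *: ((flat p \o shift 0) (h *: 1) - flat p 0)) @ (0 : R)^' --> (0 : R).
    apply/cvgr0Pnorm_le => e e0; near=> h.
    rewrite /= f0 subr0 addr0 [h *: 1]mulr1 normrM normfV.
    have hn0 : h != 0 by near: h; exact: nbhs_dnbhs_neq.
    rewrite mulrC ler_pdivrMr ?normr_gt0//.
    apply: le_trans (fC h) _; rewrite -(real_normK (num_real h)) expr2 mulrA.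
    apply: ler_wpM2r => //.
    apply: (@le_trans _ _ ((C + 1) * `|h|)); first by rewrite ler_wpM2r// lerDl.
    rewrite mulrC -ler_pdivlMr//.
    by near: h; apply: dnbhs0_le; rewrite divr_gt0.
  apply: DeriveDef; first by apply/cvg_ex; exists 0.
  exact: cvg_lim cvg0.
Unshelve. all: by end_near. Qed.

End flat_function.

Section bump.
Context (R : realType) (d : nat).
Implicit Types (f g : 'rV[R]_d -> R) (x xi : 'rV[R]_d) (j k : 'I_d).

Local Notation dir j := (delta_mx ord0 j : 'rV[R]_d).
Local Notation lambda := (lebesgue_rV R d).

(** A syntactic class closed under partial derivatives. All its members are continuous and have
    partial derivatives, so membership alone yields smoothness. *)
Inductive flat_comb : ('rV[R]_d -> R) -> Prop :=
| FlatGen p (c e : R) j : flat_comb (fun x => flat p (c + e * x ord0 j))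
| FlatCst c : flat_comb (fun=> c)
| FlatAdd f g : flat_comb f -> flat_comb g -> flat_comb (fun x => f x + g x)
| FlatMul f g : flat_comb f -> flat_comb g -> flat_comb (fun x => f x * g x).

Lemma continuous_flat (p : {poly R}) : continuous (flat p).
Proof.
move=> t; apply/differentiable_continuous/derivable1_diffP.
by have [] := is_derive_flat p t.
Qed.

Lemma is_derive_flat_coord p (c e : R) j k x :
  is_derive x (dir k) (fun x => flat p (c + e * x ord0 j))
    (e * (k == j)%:R * flat ('X^2 * (p - p^`())) (c + e * x ord0 j)).
Proof.
rewrite -{1}(add0r x) -(scale0r (dir k)); apply/is_derive_line.
set b : R := (k == j)%:R.
rewrite (_ : (fun t : R => _) = (fun t => flat p ((c + e * x ord0 j) + e * b * t))); last first.
  apply/funext => t; congr flat; rewrite !mxE eqxx /= (eq_sym j) -/b; ring.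
have da : is_derive (0 : R) 1 (fun t : R => (c + e * x ord0 j) + e * b * t) (e * b).
  have := is_derive_id (0 : R) 1 => d1.
  have d2 := @is_deriveZ _ _ _ _ (e * b) _ _ _ d1.
  have d3 := @is_deriveD _ _ _ _ _ _ _ _ _ (is_derive_cst (c + e * x ord0 j) (0 : R) 1) d2.
  by apply: (is_derive_eq d3); rewrite add0r /GRing.scale/= mulr1.
have dfl := is_derive1_comp (f := flat p) (is_derive_flat p _) da.
by apply: (is_derive_eq dfl); rewrite mulr0 addr0 mulrC.
Qed.

Lemma flat_comb_derive f : flat_comb f ->
  continuous f /\ forall k, exists2 g, flat_comb g & forall x, is_derive x (dir k) f (g x).
Proof.
elim=> {f} [p c e j|c|f g _ [cf df] _ [cg dg]|f g ff [cf df] fg [cg dg]].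
- split.
    have ca : continuous (fun x : 'rV[R]_d => c + e * x ord0 j).
      apply: continuous_funD; first exact: cst_continuous.
      by apply: continuous_funM; [exact: cst_continuous|exact: coord_continuous].
    move=> x; apply: (@continuous_comp _ _ _ (fun x : 'rV[R]_d => c + e * x ord0 j)).
      exact: ca.
    exact: continuous_flat.
  move=> k; exists (fun x => e * (k == j)%:R * flat ('X^2 * (p - p^`())) (c + e * x ord0 j)).
    by apply: FlatMul; [exact: FlatCst|exact: FlatGen].
  by move=> x; exact: is_derive_flat_coord.
- split; first exact: cst_continuous.
  move=> k; exists (fun=> 0); first exact: FlatCst.
  by move=> x; exact: is_derive_cst.
- split; first exact: continuous_funD.
  move=> k; have [f' ff' dff'] := df k; have [g' fg' dgg'] := dg k.
  exists (fun x => f' x + g' x); first exact: FlatAdd.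
  by move=> x; exact: is_deriveD.
- split; first exact: continuous_funM.
  move=> k; have [f' ff' dff'] := df k; have [g' fg' dgg'] := dg k.
  exists (fun x => f x * g' x + g x * f' x).
    by apply: FlatAdd; exact: FlatMul.
  by move=> x; exact: is_deriveM.
Qed.

Lemma flat_comb_smooth f : flat_comb f -> rsmooth f.
Proof.
move=> ff s; have {ff} : flat_comb (rpderivs s f).
  elim: s => //= k s IH; have [_ /(_ k)[g fg dg]] := flat_comb_derive IH.
  rewrite (_ : rpderiv k _ = g)//; apply/funext => x.
  by have [] := dg x.
move=> /flat_comb_derive[cf df]; split => // k x.
by have [g _ dg] := df k; have [] := dg x.
Qed.

(** Positive inside the cube |x_j| < r and zero outside. The coefficients -1 and 1 are written out
    so that each factor is an instance of [FlatGen]. *)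
Definition bump (r : R) x : R := \prod_j (flat 1 (r + (- 1) * x ord0 j) * flat 1 (r + 1 * x ord0 j)).

Lemma flat_comb_bump r : flat_comb (bump r).
Proof.
rewrite /bump; elim: (index_enum _) => [|j s IH].
  under eq_fun do rewrite big_nil.
  exact: FlatCst.
under eq_fun do rewrite big_cons.
by apply: FlatMul => //; apply: FlatMul; exact: FlatGen.
Qed.

Lemma flat1_ge0 (t : R) : 0 <= flat 1 t.
Proof. by rewrite /flat; case: ifP => // _; rewrite hornerC mul1r expR_ge0. Qed.

Lemma bump_ge0 r x : 0 <= bump r x.
Proof. by apply: prodr_ge0 => j _; rewrite mulr_ge0 ?flat1_ge0. Qed.

Lemma bump_eq0 r x : ~ (forall j, `|x ord0 j| <= r) -> bump r x = 0.
Proof.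
move=> /existsNP[j /negP]; rewrite -ltNge => rx.
rewrite /bump (bigD1 j)//= mulN1r.
have [x0|x0] := leP 0 (x ord0 j).
  rewrite {1}/flat ltNge (_ : r - x ord0 j <= 0) ?mul0r//.
  by move: rx; rewrite ger0_norm// subr_le0 => /ltW.
rewrite [flat 1 (r + 1 * _)]/flat mul1r ltNge (_ : r + x ord0 j <= 0) ?mulr0 ?mul0r//.
by move: rx; rewrite ltr0_norm// => /ltW; lra.
Qed.

Lemma bump_gt0 r x : (forall j, `|x ord0 j| < r) -> 0 < bump r x.
Proof.
move=> xr; apply: prodr_gt0 => j _; have := xr j; rewrite ltr_norml => /andP[h1 h2].
have fl t : 0 < t -> 0 < flat 1 t :> R.
  by move=> t0; rewrite /flat t0 hornerC mul1r expR_gt0.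
by rewrite mulr_gt0// fl//; lra.
Qed.

Let bump_supp r : compact [set x : 'rV[R]_d | forall j, `[(- r), r]%classic (x ord0 j)].
Proof. by apply: (@rV_compact _ _ (fun=> `[(- r), r]%classic)) => _; exact: segment_compact. Qed.

Lemma test_function_bump r : test_function (fun x => (bump r x)%:C).
Proof.
split.
  apply/smooth_ReIm; split => /=; apply: flat_comb_smooth; first exact: flat_comb_bump.
  exact: FlatCst.
exists [set x : 'rV[R]_d | forall j, `[(- r), r]%classic (x ord0 j)]; first exact: bump_supp.
move=> x xr; rewrite bump_eq0// => h; apply: xr => j /=.
by rewrite in_itv/= -ler_norml; exact: h.
Qed.

(** Otherwise the nonnegative bump would vanish a.e., although it is positive on an open cube of
    volume (2 r)^d. *)
Lemma integral_bump_gt0 (r : R) : 0 < r -> 0 < \int[lambda]_x bump r x.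
Proof.
move=> r0; have [c1 d1 _ _] := schwartz_crapid (test_function_schwartz (test_function_bump r)).
have ib := rapid_integrable c1 d1; rewrite /= in c1 d1 ib.
have mb := continuous_measurable_rV c1.
rewrite lt_neqAle Rintegral_ge0 ?andbT; last by move=> x _; exact: bump_ge0.
apply/eqP => /esym b0.
have : (\int[lambda]_x `|(bump r x)%:E| = 0)%E.
  under eq_integral do rewrite /= ger0_norm ?bump_ge0//.
  rewrite -[LHS]fineK; last exact: (integrable_fin_num measurableT ib).
  by congr EFin.
have /measurable_EFinP mbE := mb.
move=> /(ae_eq_integral_abs lambda measurableT mbE)[N [mN N0 bN]].
pose B := [set x : 'rV[R]_d | forall j, `](- r), r[%classic (x ord0 j)].
have mbox : measurable B.
  by apply: (measurable_box_rV (A := fun=> `](- r), r[%classic)) => _; exact: measurable_itv.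
have : (lambda B <= lambda N)%E.
  apply: le_measure; rewrite ?inE// => x xr; apply: bN => /= /(_ I) bx.
  have : 0 < bump r x.
    by apply: bump_gt0 => j; have := xr j; rewrite /= in_itv/= ltr_norml.
  by rewrite -lte_fin bx ltxx.
rewrite N0 (lebesgue_rV_box (A := fun=> `](- r), r[%classic)); last by move=> _; exact: measurable_itv.
rewrite leNgt => /negP; apply.
elim: (index_enum _) => [|j s IH]; first by rewrite big_nil.
rewrite big_cons mule_gt0// lebesgue_measure_itv/= lte_fin.
by rewrite (_ : - r < r) -?EFinB ?lte_fin; lra.
Qed.

(** On the support of a narrow bump the phase <x, xi> stays within 1/2 for all xi of the cube, so
    the cosine is at least 1/2 there. *)
Lemma fourier_bump_gt0 (M : R) : 0 <= M -> exists phi m, [/\ test_function phi, 0 < m &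
  forall xi, (forall j, `|xi ord0 j| <= M) -> m <= complex.Re (fourier phi xi)].
Proof.
(* Chosen so that d r M <= 1/2; the + 1 keeps r positive even for M = 0. *)
move=> M0; pose r : R := (2 * (d%:R * M + 1))^-1.
have dM : 0 < 2 * (d%:R * M + 1) by rewrite mulr_gt0// ltr_wpDl// mulr_ge0.
have r0 : 0 < r by rewrite invr_gt0.
have tb := test_function_bump r; have cb := schwartz_crapid (test_function_schwartz tb).
have [c1 d1 _ _] := cb; rewrite /= in c1 d1; have ib := rapid_integrable c1 d1.
have I0 := integral_bump_gt0 r0.
have c0 : 0 < (2 * pi) `^ (- (d%:R / 2)) :> R by rewrite powR_gt0// mulr_gt0// pi_gt0.
exists (fun x => (bump r x)%:C), ((2 * pi) `^ (- (d%:R / 2)) * (2^-1 * \int[lambda]_x bump r x)).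
split=> // [|xi xiM]; first by rewrite mulr_gt0// mulr_gt0.
rewrite fourierE//=; apply: ler_wpM2l; first exact: ltW.
rewrite /sinT; under [X in _ + X]eq_Rintegral do rewrite mul0r.
rewrite Rintegral_cst// mul0r addr0 /cosT -RintegralZl//; apply: le_Rintegral => //.
- exact: integrable_realZ.
- exact: integrable_cosM.
move=> x _; rewrite mulrC.
have [xr|xr] := pselect (forall j, `|x ord0 j| <= r); last first.
  by rewrite bump_eq0// !mul0r.
apply: ler_wpM2l; first exact: bump_ge0.
have xxi : `|dotp x xi| <= 2^-1.
  apply: le_trans (ler_norm_sum _ _ _) _.
  apply: (@le_trans _ _ (\sum_(i < d) r * M)).
    by apply: ler_sum => i _; rewrite normrM; apply: ler_pM.
  rewrite sumr_const card_ord -[leLHS]mulr_natl /r invfM -mulrA mulrCA mulrC.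
  rewrite -[leRHS]mul1r ler_wpM2r// mulrCA mulrC ler_pdivrMr; first by rewrite mul1r lerDl.
  by rewrite ltr_wpDl// mulr_ge0.
have := lipschitz_cos (dotp x xi) 0; rewrite cos0 subr0.
by move=> /le_trans/(_ xxi); rewrite ler_norml => /andP[+ _]; lra.
Qed.

End bump.

(** * Density of the transforms of test functions *)

Section tempered_integrability.
Context (R : realType) (d : nat) (mu : {measure set 'rV[R]_d -> \bar R}).
Hypothesis mu_tempered : tempered mu.
Implicit Types (phi psi : 'rV[R]_d -> R[i]).

Lemma tempered_bracketV : exists N,
  mu.-integrable setT (EFin \o (fun x : 'rV[R]_d => (bracket x ^+ N)^-1)).
Proof.
have [s s0 soo] := mu_tempered.
pose N := Num.bound (s / 2); exists N.
have sN : s / 2 <= N%:R by rewrite ltW// archi_boundP// divr_ge0.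
apply: integrable_nnint; first exact: measurable_bracketXV.
- by move=> x; rewrite invr_ge0 ltW// bracketX_gt0.
apply: le_lt_trans soo; apply: le_nnint.
- exact: measurable_bracketXV.
- apply: (measurableT_comp (f := fun t : R => t `^ (- (s / 2)))); last exact: measurable_bracket.
  exact: measurable_powR.
- by move=> x; rewrite invr_ge0 ltW// bracketX_gt0.
- move=> x; rewrite -powR_mulrn; last by rewrite ltW// bracket_gt0.
  rewrite -powRN.
  by rewrite ler_powR ?bracket_ge1// lerN2.
Qed.

Lemma schwartz_seminorms phi : schwartz phi -> exists A : seq 'I_d -> R,
  forall s x, bracket x ^+ d * normc (pderivs s phi x) <= A s.
Proof.
move=> [_ sphi]; have /choice[A phiA] : forall s, exists C : R, forall x,
    bracket x ^+ d * normc (pderivs s phi x) <= C by move=> s; exact: sphi.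
by exists A.
Qed.

Lemma fourier_rapid N phi : schwartz phi -> exists2 C : R, 0 <= C &
  forall xi, normc (fourier phi xi) <= C * (bracket xi ^+ N)^-1.
Proof.
move=> sphi; have [A phiA] := schwartz_seminorms sphi.
set C := decay_cst R d N * (A [::] + \sum_j A (nseq (2 * N) j)).
have phiC xi : normc (fourier phi xi) <= C * (bracket xi ^+ N)^-1.
  by rewrite -ler_pdivrMr ?invr_gt0 ?bracketX_gt0// invrK mulrC; exact: fourier_decay.
exists C => //; have := le_trans (normc_ge0 _) (phiC 0).
by rewrite pmulr_lge0// invr_gt0 bracketX_gt0.
Qed.

Lemma fourier_inL2 phi : schwartz phi -> inL2 mu (fourier phi).
Proof.
move=> sphi; have [N iN] := tempered_bracketV; have [C C0 phiC] := fourier_rapid N sphi.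
have mF := fourier_cmeasurable (schwartz_crapid sphi).
have mb := @measurable_bracketXV R d N.
have iC := integrable_realZ (C ^+ 2) iN.
apply: (@inL2_le _ _ _ mu _ (fun x : 'rV[R]_d => C ^+ 2 * (bracket x ^+ N)^-1)) => //.
- exact: measurable_funM.
- move=> xi; apply: le_trans (sqnorm_le_bound (phiC xi)) _.
  have b0 : 0 <= (bracket xi ^+ N)^-1 by rewrite invr_ge0 ltW// bracketX_gt0.
  rewrite exprMn; apply: ler_wpM2l; first exact: sqr_ge0.
  rewrite expr2 -[leRHS]mulr1; apply: ler_wpM2l => //.
  by rewrite invf_le1 ?bracketX_gt0// exprn_ege1// bracket_ge1.
- move/integrableP : iC => [_]; apply: le_lt_trans.
  apply: le_nnint.
  + exact: measurable_funM.
  + by apply: measurableT_comp => //; exact: measurable_funM.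
  + by move=> x; rewrite mulr_ge0 ?sqr_ge0// invr_ge0 ltW// bracketX_gt0.
  + by move=> x; exact: ler_norm.
Qed.

End tempered_integrability.

Section sign_iteration.
Variable R : realType.
Implicit Types t : R.

(** The fixed points are -1, 0 and 1, and nonzero points of [-1, 1] are driven towards their sign.
    Being polynomial, the map acts on any algebra of functions. *)
Definition sgn_step t : R := (3 * t - t ^+ 3) / 2.

Lemma sgn_step_range t : -1 <= t <= 1 -> -1 <= sgn_step t <= 1.
Proof.
move=> /andP[t1 t2]; apply/andP; split; rewrite -subr_ge0.
  have -> : sgn_step t - -1 = (1 + t) ^+ 2 * (2 - t) / 2 by rewrite /sgn_step; field.
  by rewrite divr_ge0// mulr_ge0 ?sqr_ge0//; lra.
have -> : 1 - sgn_step t = (1 - t) ^+ 2 * (2 + t) / 2 by rewrite /sgn_step; field.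
by rewrite divr_ge0// mulr_ge0 ?sqr_ge0//; lra.
Qed.

Lemma iter_sgn_step_range n t : -1 <= t <= 1 -> -1 <= iter n sgn_step t <= 1.
Proof. by move=> t1; elim: n => //= n IH; exact: sgn_step_range. Qed.

Lemma iter_sgn_stepN n t : iter n sgn_step (- t) = - iter n sgn_step t.
Proof. by elim: n => //= n ->; rewrite /sgn_step; field. Qed.

(** The iterates s increase from t, and one step multiplies the distance to 1 by (1 - s) (2 + s) / 2
    = 1 - s/2 - s^2/2 <= 1 - t/2. *)
Lemma iter_sgn_step_gt0 n t : 0 < t -> t <= 1 ->
  t <= iter n sgn_step t <= 1 /\ 1 - iter n sgn_step t <= (1 - t / 2) ^+ n.
Proof.
move=> t0 t1; elim: n => [|n [/andP[h1 h2] h3]]; first by rewrite /= lexx t1 expr0; split => //; lra.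
rewrite /=; move: (iter n _ t) h1 h2 h3 => s h1 h2 h3.
have s0 : 0 < s by lra.
have e : 1 - sgn_step s = (1 - s) * ((1 - s) * (2 + s) / 2) by rewrite /sgn_step; field.
have e0 : 0 <= (1 - s) * (2 + s) / 2 by rewrite divr_ge0// mulr_ge0//; lra.
have e1 : (1 - s) * (2 + s) / 2 <= 1 - t / 2.
  have -> : (1 - s) * (2 + s) / 2 = 1 - s / 2 - s ^+ 2 / 2 by field.
  by have := sqr_ge0 s; lra.
have ss : s <= sgn_step s.
  rewrite -subr_ge0.
  have -> : sgn_step s - s = s * ((1 - s) * (1 + s)) / 2 by rewrite /sgn_step; field.
  by rewrite divr_ge0// !mulr_ge0//; lra.
have se : 0 <= 1 - sgn_step s by rewrite e mulr_ge0//; lra.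
split; first by apply/andP; split; lra.
by rewrite e exprSr; apply: ler_pM => //; lra.
Qed.

Lemma iter_sgn_step_cvg t : -1 <= t <= 1 -> (fun n => iter n sgn_step t) @ \oo --> Num.sg t.
Proof.
wlog t0 : t / 0 <= t.
  move=> h; have [/h//|t0 t1] := leP 0 t.
  rewrite -(opprK t) sgrN; under eq_fun do rewrite iter_sgn_stepN.
  by apply: cvgN; apply: h; [rewrite oppr_ge0 ltW|rewrite lerN2 andbC lerNl].
move=> /andP[_ t1]; move: t0; rewrite le_eqVlt => /predU1P[<-|t0].
  rewrite sgr0 (_ : (fun n => _) = cst 0); first exact: cvg_cst.
  apply/funext => n; elim: n => //= n ->.
  by rewrite /sgn_step mulr0 expr0n subr0 mul0r.
rewrite gtr0_sg//.
have q : (fun n => (1 - t / 2) ^+ n) @ \oo --> (0 : R).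
  by apply: cvg_expr; rewrite ger0_norm; lra.
apply: (@squeeze_cvgr _ _ _ _ (fun n => 1 - (1 - t / 2) ^+ n) (cst 1)).
- apply: nearW => n; have [/andP[_ ->] h] := iter_sgn_step_gt0 n t0 t1.
  by rewrite andbT; lra.
- by rewrite -[X in _ --> X]subr0; apply: cvgB => //; exact: cvg_cst.
- exact: cvg_cst.
Qed.

End sign_iteration.

(** * The closed subspace W and its real multipliers *)

Section density.
Context (R : realType) (d : nat) (mu : {measure set 'rV[R]_d -> \bar R}).
Hypothesis mu_tempered : tempered mu.
Implicit Types (phi psi f g h : 'rV[R]_d -> R[i]) (m : 'rV[R]_d -> R) (x a xi : 'rV[R]_d).

Definition fourier_closure g := inL2 mu g /\ forall e : R, 0 < e ->
  exists2 phi, test_function phi & (L2sqdist mu (fourier phi) g < e%:E)%E.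

Let F_inL2 phi : test_function phi -> inL2 mu (fourier phi).
Proof. by move=> tphi; apply: fourier_inL2 => //; exact: test_function_schwartz. Qed.

Let F_mes phi : test_function phi -> cmeasurable (fourier phi).
Proof. by move=> /F_inL2[]. Qed.

Lemma closure_fourier phi : test_function phi -> fourier_closure (fourier phi).
Proof.
move=> tphi; split; first exact: F_inL2.
by move=> e e0; exists phi => //; rewrite L2sqdistxx lte_fin.
Qed.

Lemma closure_limit g : inL2 mu g ->
  (forall e : R, 0 < e -> exists2 h, fourier_closure h & (L2sqdist mu h g < e%:E)%E) ->
  fourier_closure g.
Proof.
move=> gi gW; split=> // e e0; have e4 : 0 < e / 4 by rewrite divr_gt0.
have [h [hi hW] hg] := gW _ e4; have [phi tphi phih] := hW _ e4; exists phi => //.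
have [mg _] := gi; have [mh _] := hi.
apply: le_lt_trans (L2sqdist_triangle mu (F_mes tphi) mh mg) _.
have [r1 E1] := L2sqdist_fin (lt_trans hg (ltry _)).
have [r2 E2] := L2sqdist_fin (lt_trans phih (ltry _)).
by move: hg phih; rewrite E1 E2 -!EFinM -EFinD !lte_fin; lra.
Qed.

Lemma closure_lin (c : R[i]) f g : fourier_closure f -> fourier_closure g ->
  fourier_closure (fun x => c * f x + g x).
Proof.
move=> [fi fW] [gi gW]; split; first by apply: inL2D => //; exact: inL2Z.
move=> e e0; have c0 := sqnorm_ge0 c.
have e1 : 0 < e / (4 * (sqnorm c + 1)) by rewrite divr_gt0// mulr_gt0// ltr_wpDl.
have e2 : 0 < e / 4 by rewrite divr_gt0.
have [phi tphi phif] := fW _ e1; have [psi tpsi psig] := gW _ e2.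
exists (fun x => c * phi x + psi x); first exact: test_function_lin.
rewrite fourier_linear; [|exact/schwartz_crapid/test_function_schwartz..].
have [mf _] := fi; have [mg _] := gi.
apply: le_lt_trans (L2sqdist_lin mu _ (F_mes tphi) (F_mes tpsi) mf mg) _.
have p1 := L2sqdist_ge0 mu (fourier phi) f.
have [r1 E1] := L2sqdist_fin (lt_trans phif (ltry _)).
have [r2 E2] := L2sqdist_fin (lt_trans psig (ltry _)).
move: phif psig p1; rewrite E1 E2 -!EFinM -EFinD !lte_fin lee_fin ltr_pdivlMr; last by rewrite mulr_gt0// ltr_wpDl.
by move=> h1 h2 h3; nra.
Qed.

Lemma closureZ (c : R[i]) f : fourier_closure f -> fourier_closure (fun x => c * f x).
Proof.
move=> fW; have := closure_lin (c - 1) fW fW.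
by congr fourier_closure; apply/funext => x; rewrite mulrBl mul1r subrK.
Qed.

(* The real multipliers of the closed subspace form an algebra, stable under
   bounded pointwise limits. *)
Definition multiplier m := [/\ measurable_fun setT m, exists M : R, forall x, `|m x| <= M &
  forall g, fourier_closure g -> fourier_closure (fun x => (m x)%:C * g x)].

Lemma L2sqdist_bddM m (M : R) f g : measurable_fun setT m -> (forall x, `|m x| <= M) ->
  cmeasurable f -> cmeasurable g ->
  (L2sqdist mu (fun x => (m x)%:C * f x)%R (fun x => (m x)%:C * g x)%R <=
    (M ^+ 2)%:E * L2sqdist mu f g)%E.
Proof.
move=> mm mM mf mg; have s1 := measurable_sqnorm (cmeasurableB mf mg).
rewrite -nnintZ ?sqr_ge0//; last by move=> x; exact: sqnorm_ge0.
apply: le_nnint.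
- by apply: measurable_sqnorm; apply: cmeasurableB; apply: cmeasurableM => //; exact: cmeasurableC.
- exact: measurable_funM.
- by move=> x; exact: sqnorm_ge0.
- move=> x; rewrite -mulrBr sqnormM; apply: ler_wpM2r; first exact: sqnorm_ge0.
  by apply: sqnorm_le_bound; rewrite normcC.
Qed.

Lemma inL2_realM m (M : R) g : measurable_fun setT m -> (forall x, `|m x| <= M) ->
  inL2 mu g -> inL2 mu (fun x => (m x)%:C * g x).
Proof.
move=> mm mM gi; apply: inL2_bddM gi; first exact: cmeasurableC.
by move=> x; rewrite normcC; exact: mM.
Qed.

(** Multiplication by a bounded function is continuous in L^2, so stability can be checked on the
    transforms, which are dense in their closure. *)
Lemma multiplier_test m (M : R) : measurable_fun setT m -> (forall x, `|m x| <= M) ->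
  (forall phi, test_function phi -> fourier_closure (fun x => (m x)%:C * fourier phi x)) ->
  multiplier m.
Proof.
move=> mm mM hm; split=> //; first by exists M.
move=> g [gi gW]; have [mg _] := gi; apply: closure_limit; first exact: inL2_realM mM gi.
move=> e e0; have e1 : 0 < e / (M ^+ 2 + 1) by rewrite divr_gt0// ltr_wpDl// sqr_ge0.
have [phi tphi phig] := gW _ e1; exists (fun x => (m x)%:C * fourier phi x); first exact: hm.
apply: le_lt_trans (L2sqdist_bddM mm mM (F_mes tphi) mg) _.
have p1 := L2sqdist_ge0 mu (fourier phi) g.
have [r1 E1] := L2sqdist_fin (lt_trans phig (ltry _)).
move: phig p1; rewrite E1 -!EFinM !lte_fin lee_fin ltr_pdivlMr ?ltr_wpDl ?sqr_ge0//.
by move=> h1 h2; nra.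
Qed.

Lemma multiplier_cst (c : R) : multiplier (fun=> c).
Proof. split=> //; last by move=> g; exact: closureZ.
by exists `| c |. Qed.

Lemma multiplierM m1 m2 : multiplier m1 -> multiplier m2 -> multiplier (fun x => m1 x * m2 x).
Proof.
move=> [mm1 [M1 h1] W1] [mm2 [M2 h2] W2]; split; first exact: measurable_funM.
  by exists (M1 * M2) => x; rewrite normrM ler_pM.
move=> g gW; have := W1 _ (W2 _ gW); congr fourier_closure; apply/funext => x.
by rewrite rmorphM mulrA.
Qed.

Lemma multiplierD m1 m2 : multiplier m1 -> multiplier m2 -> multiplier (fun x => m1 x + m2 x).
Proof.
move=> [mm1 [M1 h1] W1] [mm2 [M2 h2] W2]; split; first exact: measurable_funD.
  by exists (M1 + M2) => x; apply: le_trans (ler_normD _ _) _; exact: lerD.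
move=> g gW; have := closure_lin 1 (W1 _ gW) (W2 _ gW); congr fourier_closure; apply/funext => x.
by rewrite mul1r rmorphD mulrDl.
Qed.

Lemma multiplierZ (c : R) m : multiplier m -> multiplier (fun x => c * m x).
Proof. by apply: multiplierM; exact: multiplier_cst. Qed.

Lemma multiplierB m1 m2 : multiplier m1 -> multiplier m2 -> multiplier (fun x => m1 x - m2 x).
Proof.
move=> h1 /(multiplierZ (-1)); under eq_fun do rewrite mulN1r.
exact: multiplierD.
Qed.

Lemma L2sqdist_dominated (g_ : nat -> 'rV[R]_d -> R[i]) g (r : 'rV[R]_d -> R) :
  (forall n, cmeasurable (g_ n)) -> cmeasurable g ->
  mu.-integrable setT (EFin \o r) -> (forall n x, sqnorm (g_ n x - g x) <= r x) ->
  (forall x, (fun n => sqnorm (g_ n x - g x)) @ \oo --> (0 : R)) ->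
  forall e : R, 0 < e -> exists n, (L2sqdist mu (g_ n) g < e%:E)%E.
Proof.
move=> mg_ mg ri gr g0 e e0.
have [] := @dominated_convergence _ _ R mu setT measurableT
  (fun n => EFin \o (fun x => sqnorm (g_ n x - g x))) (cst 0%E) (EFin \o r).
- by move=> n; apply/measurable_EFinP/measurable_sqnorm/cmeasurableB.
- exact: measurable_cst.
- by apply: aeW => x _; apply: cvg_EFin; [exact: nearW|exact: g0].
- exact: ri.
- by apply: aeW => x n _; rewrite /= lee_fin ger0_norm ?sqnorm_ge0.
move=> _ _; rewrite integral0 => /fine_cvgP[fin /cvgr_lt/(_ _ e0) lt].
have : \forall n \near \oo, (L2sqdist mu (g_ n) g < e%:E)%E.
  apply: filterS2 fin lt => n /= fn ln.
  by rewrite -[ltLHS](fineK fn) lte_fin.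
by move=> [n _ /(_ n (leqnn n))]; exists n.
Qed.

(** For fixed [g], dominated convergence with majorant (2 M)^2 |g|^2. *)
Lemma multiplier_limit (m_ : nat -> 'rV[R]_d -> R) m (M : R) :
  (forall n, multiplier (m_ n)) -> (forall n x, `|m_ n x| <= M) ->
  (forall x, m_ ^~ x @ \oo --> m x) -> multiplier m.
Proof.
move=> hm_ mM mcvg.
have mm_ n : measurable_fun setT (m_ n) by have [] := hm_ n.
have mm : measurable_fun setT m.
  apply/measurable_EFinP; apply: (emeasurable_fun_cvg (fun n => EFin \o m_ n)).
    by move=> n; exact/measurable_EFinP.
  by move=> x _; apply: cvg_EFin; [exact: nearW|exact: mcvg].
have mbd x : `|m x| <= M.
  have cn : (fun n => `|m_ n x|) @ \oo --> `|m x| by apply: cvg_norm; exact: mcvg.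
  rewrite -(cvg_lim _ cn)//; apply: limr_le; first by apply/cvg_ex; exists `|m x|.
  by apply: nearW => n; exact: mM.
split=> //; first by exists M.
move=> g gW; have [gi _] := gW; have [mg goo] := gi.
have sg := measurable_sqnorm mg.
apply: closure_limit; first exact: inL2_realM mbd gi.
move=> e e0.
have [|||||n ng] := @L2sqdist_dominated (fun n x => (m_ n x)%:C * g x) (fun x => (m x)%:C * g x)
    (fun x => (2 * M) ^+ 2 * sqnorm (g x)) _ _ _ _ _ e e0.
- by move=> n; apply: cmeasurableM => //; exact: cmeasurableC.
- by apply: cmeasurableM => //; exact: cmeasurableC.
- by apply: integrable_realZ; apply: integrable_nnint => // x; exact: sqnorm_ge0.
- move=> n x; rewrite -mulrBl -rmorphB sqnormM; apply: ler_wpM2r; first exact: sqnorm_ge0.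
  apply: sqnorm_le_bound; rewrite normcC mulr_natl mulr2n.
  by apply: le_trans (ler_normB _ _) _; exact: lerD.
- move=> x; rewrite (_ : (fun n => _) = (fun n => (m_ n x - m x) * (m_ n x - m x) * sqnorm (g x))); last first.
    by apply/funext => n; rewrite -mulrBl -rmorphB sqnormM sqnormC expr2.
  rewrite -[X in _ --> X](_ : 0 * 0 * sqnorm (g x) = 0); last by rewrite !mul0r.
  have h : (fun n => m_ n x - m x) @ \oo --> (0 : R).
    by rewrite -(subrr (m x)); apply: cvgB; [exact: mcvg|exact: cvg_cst].
  by apply: cvgM; [exact: cvgM|exact: cvg_cst].
exists (fun x => (m_ n x)%:C * g x) => //.
by have [_ _] := hm_ n; exact.
Qed.

(** Translation by [a] multiplies the transform by exp(-i <a, xi>); the cosine is half the sum of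
    the factors for [a] and [-a]. *)
Lemma multiplier_cos a : multiplier (fun xi => cos (dotp a xi)).
Proof.
have mdotp : measurable_fun setT (fun xi : 'rV[R]_d => dotp a xi).
  rewrite (_ : (fun _ => _) = (fun xi => dotp xi a)); first exact: measurable_dotp.
  by apply/funext => xi; apply: eq_bigr => i _; rewrite mulrC.
apply: (@multiplier_test _ 1).
- by apply: (measurableT_comp (f := @cos R)) => //; apply: continuous_measurable_fun; exact: continuous_cos.
- by move=> x; exact: cos_max.
move=> phi tphi; have ta := test_function_translate a tphi.
have tb := test_function_translate (- a) tphi.
have sp := schwartz_crapid (test_function_schwartz tphi).
have sa := schwartz_crapid (test_function_schwartz ta).
have sb := schwartz_crapid (test_function_schwartz tb).
have := closureZ (2^-1)%:C (closure_lin 1 (closure_fourier ta) (closure_fourier tb)).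
congr fourier_closure; apply/funext => xi; rewrite !fourier_translate//.
rewrite dotpNl cosN sinN; move: (cos _) (sin _) (fourier phi xi) => u v z.
by apply: eq_ReIm; rewrite !ReImE /=; field.
Qed.

(** The factor for [a] minus the factor for [-a] is -2i sin <a, xi>; multiply by i/2. *)
Lemma multiplier_sin a : multiplier (fun xi => sin (dotp a xi)).
Proof.
have mdotp : measurable_fun setT (fun xi : 'rV[R]_d => dotp a xi).
  rewrite (_ : (fun _ => _) = (fun xi => dotp xi a)); first exact: measurable_dotp.
  by apply/funext => xi; apply: eq_bigr => i _; rewrite mulrC.
apply: (@multiplier_test _ 1).
- by apply: (measurableT_comp (f := @sin R)) => //; apply: continuous_measurable_fun; exact: continuous_sin.
- by move=> x; exact: sin_max.
move=> phi tphi; have ta := test_function_translate a tphi.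
have tb := test_function_translate (- a) tphi.
have sp := schwartz_crapid (test_function_schwartz tphi).
have sa := schwartz_crapid (test_function_schwartz ta).
have sb := schwartz_crapid (test_function_schwartz tb).
have := closureZ (0 +i* 2^-1) (closure_lin (-1) (closure_fourier tb) (closure_fourier ta)).
congr fourier_closure; apply/funext => xi; rewrite !fourier_translate//.
rewrite dotpNl cosN sinN; move: (cos _) (sin _) (fourier phi xi) => u v z.
by apply: eq_ReIm; rewrite !ReImE /=; field.
Qed.

End density.

(** * From trigonometric to bounded measurable multipliers *)

Section multiplier_sets.
Import HBNNSimple.
Context (R : realType) (d : nat) (mu : {measure set 'rV[R]_d -> \bar R}).
Hypothesis mu_tempered : tempered mu.
Implicit Types (phi psi f g h : 'rV[R]_d -> R[i]) (m : 'rV[R]_d -> R) (x a xi : 'rV[R]_d).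

Local Notation dir j := (delta_mx ord0 j : 'rV[R]_d).
Local Notation multiplier := (multiplier mu).
Local Notation fourier_closure := (fourier_closure mu).

Lemma multiplier_sgn m : multiplier m -> (forall x, -1 <= m x <= 1) ->
  multiplier (fun x => Num.sg (m x)).
Proof.
move=> hm m1.
have hn n : multiplier (fun x => iter n (@sgn_step R) (m x)).
  elim: n => [|n IH]; [exact: hm|rewrite /= /sgn_step].
  have h3 : multiplier (fun x => iter n (@sgn_step R) (m x) ^+ 3).
    rewrite (_ : (fun x => _) = (fun x => iter n (@sgn_step R) (m x) *
      (iter n (@sgn_step R) (m x) * iter n (@sgn_step R) (m x)))).
      exact: multiplierM IH (multiplierM IH IH).
    by apply/funext => x; rewrite !exprS expr0 mulr1.
  have := multiplierZ mu_tempered 2^-1 (multiplierB mu_tempered (multiplierZ mu_tempered 3 IH) h3).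
  by congr multiplier; apply/funext => x; rewrite mulrC.
apply: (@multiplier_limit _ _ _ mu_tempered _ _ 1 hn).
- by move=> n x; rewrite ler_norml; exact: iter_sgn_step_range.
- by move=> x; exact: iter_sgn_step_cvg.
Qed.

(** For large n the argument lies in (-pi, pi), where the sine has the sign of its argument, so the
    sequence is eventually constant. The scaling removes the effect of periodicity. *)
Lemma sgr_scaled_cvg (t : R) : (fun n => Num.sg (sin (t / n.+1%:R))) @ \oo --> Num.sg t.
Proof.
wlog t0 : t / 0 < t.
  move=> h; have [t0|t0|->] := ltgtP t 0; last 2 first.
  - exact: h.
  - by rewrite sgr0; under eq_fun do rewrite mul0r sin0 sgr0; exact: cvg_cst.
  rewrite -(opprK t) sgrN.
  under eq_fun do rewrite mulNr sinN sgrN.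
  by apply: cvgN; apply: h; rewrite oppr_gt0.
rewrite gtr0_sg//; apply: cvg_near_cst.
have [N tN] : exists N : nat, t < pi * N%:R.
  exists (Num.bound (t / pi)); rewrite mulrC -ltr_pdivrMr ?pi_gt0//.
  by rewrite archi_boundP// divr_ge0 ?pi_ge0// ltW.
exists N => // n /= Nn; rewrite gtr0_sg//; apply: sin_gt0_pi; apply/andP; split.
  by rewrite divr_gt0.
rewrite ltr_pdivrMr// (lt_le_trans tN)// ler_wpM2l ?pi_ge0//.
by rewrite ler_nat (leq_trans Nn).
Qed.

Lemma multiplier_sgn_coord (c : R) j : multiplier (fun x => Num.sg (x ord0 j - c)).
Proof.
apply: (@multiplier_limit _ _ _ mu_tempered
  (fun n x => Num.sg (sin ((x ord0 j - c) / n.+1%:R))) _ 1).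
- move=> n; apply: multiplier_sgn; last first.
    by move=> x; rewrite -ler_norml; exact: sin_max.
  rewrite (_ : (fun x => _) = (fun x =>
      cos (c / n.+1%:R) * sin (dotp (n.+1%:R^-1 *: dir j) x) -
      sin (c / n.+1%:R) * cos (dotp (n.+1%:R^-1 *: dir j) x))); last first.
    apply/funext => x; rewrite dotp_dir mulrBl sinD sinN cosN.
    by rewrite (mulrC _^-1); ring.
  apply: (multiplierB mu_tempered); apply: (multiplierZ mu_tempered).
    exact: multiplier_sin.
  exact: multiplier_cos.
- by move=> n x; rewrite normr_sg; case: (_ != 0).
- by move=> x; exact: sgr_scaled_cvg.
Qed.

Definition multiplier_set : set (set 'rV[R]_d) := [set A | multiplier (\1_A : 'rV[R]_d -> R)].

Lemma multiplier_set_setC A : multiplier_set A -> multiplier_set (~` A).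
Proof.
move=> hA; rewrite /multiplier_set /=.
have := multiplierB mu_tempered (multiplier_cst mu_tempered 1) hA.
congr multiplier; apply/funext => x; rewrite !indicE in_setC.
by case: (x \in A); rewrite /= ?subrr ?subr0.
Qed.

Lemma multiplier_set_setI A B : multiplier_set A -> multiplier_set B -> multiplier_set (A `&` B).
Proof.
move=> hA hB; rewrite /multiplier_set /=; have := multiplierM hA hB.
by congr multiplier; apply/funext => x; rewrite indicI.
Qed.

(** Finite unions come from complements and intersections; the countable union is a bounded
    pointwise limit of them. *)
Lemma multiplier_set_bigcup (A : nat -> set 'rV[R]_d) :
  (forall n, multiplier_set (A n)) -> multiplier_set (\bigcup_n A n).
Proof.
move=> hA.
have hU n : multiplier_set (\big[setU/set0]_(i < n) A i).
  elim: n => [|n IH].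
    rewrite big_ord0 /multiplier_set /=.
    have := multiplier_cst mu_tempered 0.
    by congr multiplier; apply/funext => x; rewrite indic0.
  rewrite big_ord_recr /= -[X in multiplier_set X]setCK setCU.
  by apply/multiplier_set_setC/multiplier_set_setI; exact: multiplier_set_setC.
apply: (@multiplier_limit _ _ _ mu_tempered _ _ 1 hU).
  by move=> n x; rewrite indicE; case: (_ \in _) => /=; rewrite ?normr1 ?normr0.
move=> x; rewrite indicE; have [|xA] := boolP (x \in _).
  rewrite inE => -[k _ Akx]; apply: cvg_near_cst; exists k.+1 => // n /= kn.
  by rewrite indicE mem_set//; rewrite -bigcup_mkord; exists k.
apply: cvg_near_cst; apply: nearW => n; rewrite indicE memNset//.
rewrite -bigcup_mkord => -[k _ Akx]; move/negP : xA; apply.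
by rewrite inE; exists k.
Qed.

(** With s = sgn (x_j - c), the two indicators are (s^2 + s) / 2 and (s^2 - s) / 2. *)
Lemma multiplier_set_gt (c : R) j :
  multiplier_set [set x : 'rV[R]_d | c < x ord0 j] /\
  multiplier_set [set x : 'rV[R]_d | x ord0 j < c].
Proof.
have hs := multiplier_sgn_coord c j.
have hss := multiplierM hs hs.
split; rewrite /multiplier_set /=.
- have := multiplierZ mu_tempered 2^-1 (multiplierD mu_tempered hss hs).
  congr multiplier; apply/funext => x; rewrite indicE.
  have [xc|xc|xc] := ltgtP (x ord0 j) c.
  + rewrite memNset/=; first by rewrite ltr0_sg ?subr_lt0//; field.
    by apply/negP; rewrite -leNgt ltW.
  + by rewrite mem_set/= ?gtr0_sg ?subr_gt0//; field.
  + by rewrite xc subrr sgr0 memNset/= ?xc ?ltxx//; field.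
- have := multiplierZ mu_tempered 2^-1 (multiplierB mu_tempered hss hs).
  congr multiplier; apply/funext => x; rewrite indicE.
  have [xc|xc|xc] := ltgtP (x ord0 j) c.
  + by rewrite mem_set/= ?ltr0_sg ?subr_lt0//; field.
  + rewrite memNset/=; first by rewrite gtr0_sg ?subr_gt0//; field.
    by apply/negP; rewrite -leNgt ltW.
  + by rewrite xc subrr sgr0 memNset/= ?xc ?ltxx//; field.
Qed.

Lemma multiplier_set0 : multiplier_set set0.
Proof.
rewrite /multiplier_set /=; have := multiplier_cst mu_tempered 0.
by congr multiplier; apply/funext => x; rewrite indic0.
Qed.

Lemma multiplier_set_countable (I : countType) (P : set I) (B : I -> set 'rV[R]_d) :
  (forall i, multiplier_set (B i)) -> multiplier_set (\bigcup_(i in P) B i).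
Proof.
move=> hB; rewrite bigcup_mkcond.
pose C n := if unpickle n is Some i then if i \in P then B i else set0 else set0.
rewrite (_ : \bigcup_i _ = \bigcup_n C n).
  apply: multiplier_set_bigcup => n; rewrite /C; case: (unpickle n) => [i|].
    by case: ifP => // _; exact: multiplier_set0.
  exact: multiplier_set0.
apply/seteqP; split => x; rewrite /C.
  by move=> [i _ Bx]; exists (pickle i) => //; rewrite pickleK.
by move=> [n _]; case: (unpickle n) => // i Bx; exists i.
Qed.

(** An open set is a countable union of rational boxes, and a box is a finite intersection of
    half-spaces. *)
Lemma multiplier_set_open (U : set 'rV[R]_d) : open U -> multiplier_set U.
Proof.
move=> /open_rV_boxes ->.
have hbox (q : 'rV[rat]_d) (k : nat) : multiplier_set
    [set x : 'rV[R]_d | forall j, `|x ord0 j - ratr (q ord0 j)| < k.+1%:R^-1].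
  have h1 (s : seq 'I_d) : multiplier_set
    [set x : 'rV[R]_d | forall j, j \in s -> `|x ord0 j - ratr (q ord0 j)| < k.+1%:R^-1].
    elim: s => [|i s IH].
      rewrite /multiplier_set /=; have := multiplier_cst mu_tempered 1.
      by congr multiplier; apply/funext => x; rewrite indicE mem_set.
    have [hg _] := multiplier_set_gt (ratr (q ord0 i) - k.+1%:R^-1) i.
    have [_ hl] := multiplier_set_gt (ratr (q ord0 i) + k.+1%:R^-1) i.
    have := multiplier_set_setI IH (multiplier_set_setI hg hl).
    congr multiplier_set; apply/seteqP; split => x /=.
      move=> [xs [h2 h3]] j; rewrite inE => /predU1P[->|]; last exact: xs.
      by rewrite ltr_norml ltrBlDl ltrBrDl h3 h2.
    move=> xs; split; first by move=> j js; apply: xs; rewrite inE js orbT.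
    have := xs i (mem_head _ _).
    by rewrite ltr_norml ltrBlDl ltrBrDl => /andP[].
  have := h1 (index_enum 'I_d); congr multiplier_set; apply/seteqP; split => x /= h j.
    by apply: h; rewrite mem_index_enum.
  by move=> _; exact: h.
by apply: multiplier_set_countable => -[q k]; exact: hbox.
Qed.

Lemma multiplier_set_measurable (A : set 'rV[R]_d) : measurable A -> multiplier_set A.
Proof.
apply: smallest_sub; last exact: multiplier_set_open.
split; first exact: multiplier_set0.
- by move=> B hB; rewrite setTD; exact: multiplier_set_setC.
- exact: multiplier_set_bigcup.
Qed.

(** A bounded limit of simple functions, themselves linear combinations of indicators. *)
Lemma multiplier_ge0 m (M : R) : measurable_fun setT m -> (forall x, 0 <= m x <= M) ->
  multiplier m.
Proof.
move=> mm mM; have /measurable_EFinP mmE := mm.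
pose s := nnsfun_approx measurableT mmE.
have s_m x : (s ^~ x : nat -> R) @ \oo --> m x.
  have : EFin \o s ^~ x @ \oo --> (EFin \o m) x.
    apply: cvg_nnsfun_approx => // y _.
    by rewrite /= lee_fin; case/andP: (mM y).
  by move=> /fine_cvgP[].
have s_ge0 n x : 0 <= s n x by exact: fun_ge0.
have s_le n x : s n x <= m x.
  rewrite -(cvg_lim _ (s_m x))//; apply: nondecreasing_cvgn_le; last by apply/cvg_ex; exists (m x).
  by move=> k l kl; exact/lefP/nd_nnsfun_approx.
apply: (@multiplier_limit _ _ _ mu_tempered s m M) => //; last first.
  by move=> n x; rewrite ger0_norm// (le_trans (s_le n x))//; case/andP: (mM x).
move=> n; rewrite (_ : (s n : _ -> R) = fun x => \sum_(y <- finmap.enum_fset (fset_set (range (s n))))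
    (y * \1_(s n @^-1` [set y]) x)); last first.
  by apply/funext => x; rewrite fimfunE fsbig_finite.
elim: (finmap.enum_fset _) => [|y l IH].
  by under eq_fun do rewrite big_nil; exact: multiplier_cst.
under eq_fun do rewrite big_cons.
apply: (multiplierD mu_tempered _ IH); apply: (multiplierZ mu_tempered); apply: multiplier_set_measurable.
exact: measurable_funPTI.
Qed.

Lemma multiplier_bounded m (M : R) : measurable_fun setT m -> (forall x, `|m x| <= M) ->
  multiplier m.
Proof.
move=> mm mM; have h : multiplier (fun x => m x + M).
  apply: (@multiplier_ge0 _ (M + M)); first exact: measurable_funD.
  by move=> x; have := mM x; rewrite ler_norml => /andP[h1 h2]; apply/andP; split; lra.
have := multiplierB mu_tempered h (multiplier_cst mu_tempered M).
by congr multiplier; apply/funext => x; rewrite addrK.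
Qed.

(** Restrict [g] to sets E_n on which both the point and the value are bounded. There some bump
    transform F is bounded away from 0, so the restriction is z F with z bounded; the real and
    imaginary parts of z are multipliers and F lies in the closure. *)
Lemma fourier_dense g : inL2 mu g -> forall e : R, 0 < e ->
  exists2 phi, test_function phi & (L2sqdist mu (fourier phi) g < e%:E)%E.
Proof.
move=> gi; suff [_] : fourier_closure g by [].
have [mg goo] := gi; have sg := measurable_sqnorm mg.
pose E (n : nat) := [set x : 'rV[R]_d | (forall j, `[- n%:R, n%:R]%classic (x ord0 j)) ] `&`
  [set x | sqnorm (g x) <= n%:R].
have mE n : measurable (E n).
  apply: measurableI.
    apply: (measurable_box_rV (A := fun=> `[- n%:R, n%:R]%classic)) => j.
    exact: measurable_itv.
  rewrite (_ : mkset _ = (fun x => sqnorm (g x)) @^-1` `]-oo, n%:R]); last first.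
    by apply/seteqP; split => x /=; rewrite in_itv.
  by rewrite -[X in measurable X]setTI; apply: sg => //; exact: measurable_itv.
have m1E n : measurable_fun setT (\1_(E n) : 'rV[R]_d -> R) by exact: measurable_indic.
have EgW n : fourier_closure (fun x => (\1_(E n) x)%:C * g x).
  have [phi [m0 [tphi m0_gt0 phim]]] := @fourier_bump_gt0 R d n%:R (ler0n _ _).
  have [mF _] := fourier_inL2 mu_tempered (test_function_schwartz tphi).
  (* Truncated [g] divided by the transform, the complex inverse being the conjugate over the
     squared modulus. *)
  pose z x := (\1_(E n) x * (sqnorm (fourier phi x))^-1)%:C * (g x * (fourier phi x)^*).
  have zF x : z x * fourier phi x = (\1_(E n) x)%:C * g x.
    rewrite /z indicE; have [|] := boolP (x \in E n); last by rewrite !mul0r.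
    rewrite inE => -[xn gn]; rewrite mul1r.
    have Re0 : 0 < complex.Re (fourier phi x).
      apply: lt_le_trans m0_gt0 (phim x _) => j.
      by have := xn j; rewrite /= in_itv/= ler_norml.
    have s0 : sqnorm (fourier phi x) != 0.
      by rewrite gt_eqF// sqnormE ltr_pwDl ?sqr_ge0// exprn_gt0.
    move: (fourier phi x) (g x) s0 => F w; rewrite sqnormE => s0.
    by apply: eq_ReIm; rewrite !ReImE /=; field.
  have sF := measurable_sqnorm mF.
  have mz : cmeasurable z.
    apply: cmeasurableM; last by apply: cmeasurableM => //; exact: cmeasurableJ.
    apply: cmeasurableC; apply: measurable_funM => //.
    rewrite (_ : (fun x => _) = (fun x => sqnorm (fourier phi x) `^ (-1))).
      exact: (measurableT_comp (measurable_powR (-1)) sF).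
    by apply/funext => x; rewrite powR_inv1// sqnorm_ge0.
  (* On E_n one has |z|^2 |F|^2 = |g|^2 <= n, whereas |F|^2 >= m0^2. *)
  have zB x : sqnorm (z x) <= n%:R / m0 ^+ 2.
    have [xE|xE] := boolP (x \in E n); last first.
      rewrite /z indicE (negbTE xE) mul0r sqnormM sqnormC expr0n mul0r.
      by rewrite divr_ge0// exprn_ge0// ltW.
    have h : sqnorm (z x) * sqnorm (fourier phi x) = sqnorm (g x).
      by rewrite -sqnormM zF sqnormM indicE xE sqnormC expr1n mul1r.
    move: xE; rewrite inE => -[xn gn].
    have Re0 : m0 <= complex.Re (fourier phi x).
      by apply: phim => j; have := xn j; rewrite /= in_itv/= ler_norml.
    have F0 : m0 ^+ 2 <= sqnorm (fourier phi x).
      by apply: le_trans (sqr_Re_le _); rewrite lerXn2r// nnegrE ltW// (lt_le_trans m0_gt0).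
    rewrite ler_pdivlMr ?exprn_gt0//; apply: le_trans gn; rewrite -h.
    by apply: ler_wpM2l => //; exact: sqnorm_ge0.
  have bd (t : R) (B : R) : t ^+ 2 <= B -> `|t| <= 1 + B.
    rewrite -(real_normK (num_real t)); set b := `|t| => tB.
    by have := sqr_ge0 (b - 1); nra.
  have Fc := closure_fourier mu_tempered tphi.
  have [_ _ Wre] : multiplier (fun x => complex.Re (z x)).
    apply: (@multiplier_bounded _ (1 + n%:R / m0 ^+ 2)); first by case: mz.
    by move=> x; apply: bd; apply: le_trans (sqr_Re_le _) (zB x).
  have [_ _ Wim] : multiplier (fun x => complex.Im (z x)).
    apply: (@multiplier_bounded _ (1 + n%:R / m0 ^+ 2)); first by case: mz.
    by move=> x; apply: bd; apply: le_trans (sqr_Im_le _) (zB x).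
  have := closure_lin mu_tempered (0 +i* 1) (Wim _ Fc) (Wre _ Fc).
  congr fourier_closure; apply/funext => x; rewrite -zF.
  move: (z x) (fourier phi x) => z1 z2.
  by apply: eq_ReIm; rewrite !ReImE /=; ring.
(* The truncations tend to [g] with majorant |g|^2. *)
apply: (closure_limit mu_tempered gi) => e e0.
have [|||||n ng] := @L2sqdist_dominated R d mu (fun n x => (\1_(E n) x)%:C * g x) g
    (fun x => sqnorm (g x)) _ _ _ _ _ e e0.
- by move=> n; apply: cmeasurableM => //; exact: cmeasurableC.
- exact: mg.
- by apply: integrable_nnint => // x; exact: sqnorm_ge0.
- move=> n x; rewrite indicE; case: (x \in E n) => /=.
    by rewrite mul1r subrr sqnorm0 sqnorm_ge0.
  by rewrite mul0r sub0r sqnormN.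
- move=> x; apply: cvg_near_cst.
  (* From this index on [x] belongs to E_n, since [bracket x] bounds all coordinates. *)
  exists (Num.bound (bracket x + sqnorm (g x))) => // n /= Nn.
  have b0 := bracket_gt0 x; have s0 := sqnorm_ge0 (g x).
  have nx : bracket x + sqnorm (g x) <= n%:R.
    apply: (@le_trans _ _ (Num.bound (bracket x + sqnorm (g x)))%:R); last by rewrite ler_nat.
    by rewrite ltW// archi_boundP// addr_ge0// ltW.
  rewrite indicE mem_set ?mul1r ?subrr ?sqnorm0//; split => /=; last by lra.
  move=> j; rewrite in_itv/= -ler_norml; apply: le_trans (coord_le_bracket x j) _.
  by lra.
by exists (fun x => (\1_(E n) x)%:C * g x).
Qed.

End multiplier_sets.

(** * Weighted measures and Radon-Nikodym derivatives *)

Section weighted_measure.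
Context (R : realType) (disp : measure_display) (T : measurableType disp).
Variables (mu : {measure set T -> \bar R}) (w : T -> R).
Hypotheses (mw : measurable_fun setT w) (w_ge0 : forall x, 0 <= w x).

Definition weighted (A : set T) : \bar R := (\int[mu]_(x in A) (w x)%:E)%E.

Let weighted0 : weighted set0 = 0%E. Proof. exact: integral_set0. Qed.

Let weighted_ge0 A : (0 <= weighted A)%E.
Proof. by apply: integral_ge0 => x _; rewrite lee_fin. Qed.

Let weighted_sigma_additive : semi_sigma_additive weighted.
Proof.
move=> F mF tF mUF; rewrite /weighted ge0_integral_bigcup//.
- apply: is_cvg_ereal_nneg_natsum_cond => n _ _.
  by apply: integral_ge0 => x _; rewrite lee_fin.
- by apply: measurable_funTS; exact/measurable_EFinP.
- by move=> x _; rewrite lee_fin.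
Qed.

Definition weighted_measure : {measure set T -> \bar R} :=
  HB.pack weighted (isMeasure.Build _ _ _ weighted weighted0 weighted_ge0 weighted_sigma_additive).

End weighted_measure.

Section density_integral.
Context (R : realType) (disp : measure_display) (T : measurableType disp).
Variables (mu nu : {measure set T -> \bar R}) (w : T -> R).
Hypotheses (mw : measurable_fun setT w) (w_ge0 : forall x, 0 <= w x).
Hypothesis nuE : forall A, measurable A -> nu A = (\int[mu]_(x in A) (w x)%:E)%E.

Import HBNNSimple.

(** Indicators by hypothesis, simple functions by linearity, the general case by monotone
    convergence on both sides. *)
Lemma ge0_integral_density (g : T -> R) : measurable_fun setT g -> (forall x, 0 <= g x) ->
  (\int[nu]_x (g x)%:E = \int[mu]_x (g x * w x)%:E)%E.
Proof.
pose P (g : T -> R) := [/\ measurable_fun setT g, forall x, 0 <= g x &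
  (\int[nu]_x (g x)%:E = \int[mu]_x (g x * w x)%:E)%E].
have Pindic (A : set T) : measurable A -> P \1_A.
  move=> mA; split; first exact: measurable_indic.
    by move=> x; rewrite indicE.
  rewrite integral_indic// setIT nuE// integral_mkcond; apply: eq_integral => x _.
  by rewrite /patch indicE; case: (x \in A); rewrite ?mul1r ?mul0r.
have PZ (k : R) f : 0 <= k -> P f -> P (fun x => k * f x).
  move=> k0 [mf f0 fE]; split; first exact: measurable_funM.
    by move=> x; rewrite mulr_ge0.
  rewrite nnintZ// fE -nnintZ//; last 2 first.
  - exact: measurable_funM.
  - by move=> x; rewrite mulr_ge0.
  by apply: eq_integral => x _; rewrite mulrA.
have PD f1 f2 : P f1 -> P f2 -> P (fun x => f1 x + f2 x).
  move=> [mf f0 fE] [mg g0 gE]; split; first exact: measurable_funD.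
    by move=> x; rewrite addr_ge0.
  rewrite nnintD// fE gE -nnintD//; [|exact: measurable_funM|exact: measurable_funM|
    by move=> x; rewrite mulr_ge0|by move=> x; rewrite mulr_ge0].
  by apply: eq_integral => x _; rewrite mulrDl.
move=> mg g0; have /measurable_EFinP mgE := mg.
pose s := nnsfun_approx measurableT mgE.
have s_g x : EFin \o s ^~ x @ \oo --> (EFin \o g) x.
  by apply: cvg_nnsfun_approx => // y _; rewrite /= lee_fin.
have Ps n : P (s n).
  rewrite (_ : (s n : _ -> R) = fun x => \sum_(y <- finmap.enum_fset (fset_set (range (s n))))
    (y * \1_(s n @^-1` [set y]) x)); last by apply/funext => x; rewrite fimfunE fsbig_finite.
  have : forall y, y \in finmap.enum_fset (fset_set (range (s n))) -> 0 <= y.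
    by move=> y; rewrite in_fset_set// inE => -[x _ <-].
  elim: (finmap.enum_fset _) => [|y l IH] l0.
    rewrite (_ : (fun _ => _) = (fun x => 0 * \1_(@set0 T) x)); last first.
      by apply/funext => x; rewrite big_nil mul0r.
    exact/PZ/Pindic.
  under eq_fun do rewrite big_cons.
  apply: PD; last by apply: IH => z zl; apply: l0; rewrite inE zl orbT.
  apply: PZ; first by apply: l0; rewrite mem_head.
  by apply: Pindic; exact: measurable_funPTI.
have -> : (\int[nu]_x (g x)%:E = limn (fun n => \int[nu]_x (s n x)%:E))%E.
  rewrite -monotone_convergence//.
  - by apply: eq_integral => x _; apply/esym/cvg_lim => //; exact: s_g.
  - by move=> n; exact/measurable_EFinP.
  - by move=> n x _; rewrite lee_fin.
  - by move=> x _ a b ab; rewrite lee_fin; exact/lefP/nd_nnsfun_approx.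
have -> : (\int[mu]_x (g x * w x)%:E = limn (fun n => \int[mu]_x (s n x * w x)%:E))%E.
  rewrite -monotone_convergence//.
  - apply: eq_integral => x _; apply/esym/cvg_lim => //.
    rewrite EFinM; under eq_fun do rewrite EFinM.
    by apply: cvgeZr => //; exact: s_g.
  - by move=> n; apply/measurable_EFinP; exact: measurable_funM.
  - by move=> n x _; rewrite lee_fin mulr_ge0.
  - move=> x _ a b ab; rewrite lee_fin ler_wpM2r//; exact/lefP/nd_nnsfun_approx.
by congr (limn _); apply/funext => n; have [] := Ps n.
Qed.

End density_integral.

Section sigma_finite_pack.
Context (R : realType) (disp : measure_display) (T : measurableType disp).
Variable mu : {measure set T -> \bar R}.
Hypothesis sf : sigma_finite setT mu.

Let mu_copy : set T -> \bar R := mu.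

HB.instance Definition _ := Measure.copy mu_copy mu.
HB.instance Definition _ := Measure_isSigmaFinite.Build _ _ _ mu_copy sf.

(** Turns a proof of sigma-finiteness into the structure in which the Radon-Nikodym theorem takes
    its reference measure. *)
Lemma sigma_finite_pack :
  exists mu' : {sigma_finite_measure set T -> \bar R}, forall A, mu' A = mu A.
Proof. by exists (mu_copy : {sigma_finite_measure set T -> \bar R}). Qed.

End sigma_finite_pack.

Section finite_pack.
Context (R : realType) (disp : measure_display) (T : measurableType disp).
Variable mu : {measure set T -> \bar R}.
Hypothesis fin : (mu setT < +oo)%E.

Let mu_copy : set T -> \bar R := mu.

Let mu_fin : fin_num_fun mu_copy.
Proof.
move=> A mA; rewrite /mu_copy ge0_fin_numE//; apply: le_lt_trans fin.
by apply: le_measure => //; rewrite inE.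
Qed.

HB.instance Definition _ := Measure.copy mu_copy mu.
HB.instance Definition _ := Measure_isFinite.Build _ _ _ mu_copy mu_fin.

Lemma finite_pack :
  exists mu' : {finite_measure set T -> \bar R}, forall A, mu' A = mu A.
Proof. by exists (mu_copy : {finite_measure set T -> \bar R}). Qed.

End finite_pack.

Section radon_nikodym.
Context (R : realType) (disp : measure_display) (T : measurableType disp).

(* The library requires [nu] to be finite: apply it to a finite weighted
   version of [nu] and divide by the weight. *)
Lemma radon_nikodym_weighted (mu nu : {measure set T -> \bar R}) (w : T -> R) :
  sigma_finite setT mu -> measurable_fun setT w -> measurable_fun setT (fun x => (w x)^-1) ->
  (forall x, 0 < w x) -> (\int[nu]_x (w x)%:E < +oo)%E ->
  (forall A, measurable A -> mu A = 0%E -> nu A = 0%E) ->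
  exists h : T -> R, [/\ measurable_fun setT h, forall x, 0 <= h x &
    forall A, measurable A -> nu A = (\int[mu]_(x in A) (h x)%:E)%E].
Proof.
move=> sf mw mwV w0 nufin numu; have w0' x : 0 <= w x by exact: ltW.
have [mu' mu'E] := sigma_finite_pack sf.
have [nu' nu'E] := @finite_pack _ _ _ (weighted_measure nu mw w0') nufin.
have /radon_nikodym_sigma_finite[k [k0 kfin ki kE]] : nu' `<< mu'.
  apply/null_content_dominatesP => A mA mu'A; apply: etrans (nu'E A) _.
  have nuA : nu A = 0%E by apply: numu => //; rewrite -mu'E; exact: mu'A.
  apply: null_set_integral => //.
  by apply: measurable_funTS; exact/measurable_EFinP.
have mk : measurable_fun setT k by exact: measurable_int ki.
have mfk : measurable_fun setT (fine \o k) by exact: measurableT_comp.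
have fk0 x : 0 <= fine (k x) by exact: fine_ge0.
exists (fun x => fine (k x) * (w x)^-1); split.
- exact: measurable_funM.
- by move=> x; rewrite mulr_ge0// invr_ge0.
move=> A mA.
have nu'A B : measurable B -> weighted_measure nu mw w0' B = (\int[mu]_(x in B) (fine (k x))%:E)%E.
  move=> mB; rewrite -nu'E kE//; apply: etrans (_ : \int[mu]_(x in B) k x = _)%E.
    by apply: eq_measure_integral => C mC _; rewrite mu'E.
  by apply: eq_integral => x _; rewrite fineK.
(* So nu(A) is the integral of 1_A / w against w nu, which has density [k] with respect to [mu]. *)
transitivity (\int[nu]_x ((\1_A x * (w x)^-1) * w x)%:E)%E.
  rewrite -[A in LHS]setIT -integral_indic//.
  by apply: eq_integral => x _; rewrite mulfVK// gt_eqF.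
have mAw : measurable_fun setT (fun x => \1_A x * (w x)^-1).
  by apply: measurable_funM => //; exact: measurable_indic.
have Aw0 x : 0 <= \1_A x * (w x)^-1 by rewrite mulr_ge0 ?invr_ge0// indicE.
rewrite -(@ge0_integral_density _ _ _ nu (weighted_measure nu mw w0') w)//.
rewrite (@ge0_integral_density _ _ _ mu (weighted_measure nu mw w0') (fine \o k))//.
rewrite [RHS]integral_mkcond; apply: eq_integral => x _.
rewrite /patch indicE; case: (x \in A); rewrite ?mul0r//=.
by rewrite mul1r mulrC.
Qed.

End radon_nikodym.

(** * Radon and tempered measures, uniqueness of densities *)

Section measures_on_rV.
Context (R : realType) (d : nat).
Implicit Types (mu nu : {measure set 'rV[R]_d -> \bar R}).

Let cube (n : nat) : set 'rV[R]_d := [set x | forall j, `[- n%:R, n%:R]%classic (x ord0 j)].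

Let cube_compact n : compact (cube n).
Proof.
apply: (@rV_compact R d (fun=> `[- n%:R, n%:R]%classic)) => _.
exact: segment_compact.
Qed.

Let cube_measurable n : measurable (cube n).
Proof. by apply: (measurable_box_rV (A := fun=> `[- n%:R, n%:R]%classic)) => j; exact: measurable_itv. Qed.

Let cube_cover : \bigcup_n cube n = setT.
Proof.
apply/seteqP; split => x // _; exists (Num.bound (bracket x)) => // j /=.
rewrite in_itv/= -ler_norml; apply: le_trans (coord_le_bracket x j) _.
by rewrite ltW// archi_boundP// ltW// bracket_gt0.
Qed.

Lemma radon_sigma_finite mu : radon mu -> sigma_finite setT mu.
Proof. by move=> rmu; exists cube => // n; split => //; exact/rmu/cube_compact. Qed.

(** Integrable densities are unique, hence equality holds a.e. on each cube, and countably many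
    cubes cover the space. *)
Lemma density_ae_unique mu (h k : 'rV[R]_d -> R) : measurable_fun setT h -> measurable_fun setT k ->
  (forall n, (\int[mu]_(x in cube n) (`|k x|)%:E < +oo)%E) ->
  (forall A, measurable A -> (\int[mu]_(x in A) (h x)%:E = \int[mu]_(x in A) (k x)%:E)%E) ->
  {ae mu, forall x, h x = k x}.
Proof.
move=> mh mk kfin hk.
have hn n : {ae mu, forall x, cube n x -> (k x)%:E = (h x)%:E}.
  apply: (@integral_ae_eq _ _ _ mu (cube n) (cube_measurable n) (EFin \o h) (EFin \o k)).
  - by apply/integrableP; split; [apply: measurable_funTS; exact/measurable_EFinP|exact: kfin].
  - by apply: measurable_funTS; exact/measurable_EFinP.
  - by move=> A _ mA; rewrite /= hk.
have := ae_foralln hn; apply: filterS => x hx.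
have [n _ xn] : (\bigcup_n cube n) x by rewrite cube_cover.
by have [->] := hx n xn.
Qed.

Lemma density_ae_unique_radon mu nu (h k : 'rV[R]_d -> R) : radon nu ->
  measurable_fun setT h -> measurable_fun setT k -> (forall x, 0 <= k x) ->
  (forall A, measurable A -> (nu A = \int[mu]_(x in A) (h x)%:E)%E) ->
  (forall A, measurable A -> (nu A = \int[mu]_(x in A) (k x)%:E)%E) ->
  {ae mu, forall x, h x = k x}.
Proof.
move=> rnu mh mk k0 hnu knu; apply: density_ae_unique => //.
- move=> n; under eq_integral do rewrite ger0_norm//.
  by rewrite -knu//; exact/rnu/cube_compact.
- by move=> A mA; rewrite -hnu// knu.
Qed.

Lemma radon_add mu nu : radon mu -> radon nu -> radon (measure_add mu nu).
Proof.
move=> rmu rnu K cK; apply: (@le_lt_trans _ _ (mu K + nu K)%E).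
  by rewrite -measure_addE.
by apply: lte_add_pinfty; [exact: rmu|exact: rnu].
Qed.

Lemma tempered_le mu (s t : R) : s <= t ->
  (\int[mu]_x (bracket x `^ (- (s / 2)))%:E < +oo ->
   \int[mu]_x (bracket x `^ (- (t / 2)))%:E < +oo)%E.
Proof.
move=> st; apply: le_lt_trans.
have mb (r : R) : measurable_fun setT (fun x : 'rV[R]_d => bracket x `^ r).
  exact: (measurableT_comp (measurable_powR r) (@measurable_bracket R d)).
apply: le_nnint => //.
- by move=> x; exact: powR_ge0.
- move=> x; rewrite ler_powR ?bracket_ge1// lerN2; lra.
Qed.

(** As [bracket] >= 1, raising the exponent only lowers the integrand, so the larger exponent serves
    for both measures. *)
Lemma tempered_add mu nu : tempered mu -> tempered nu -> tempered (measure_add mu nu).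
Proof.
move=> [s s0 hs] [t t0 ht]; exists (Num.max s t); first by rewrite le_max s0.
have mb (r : R) : measurable_fun setT (fun x : 'rV[R]_d => bracket x `^ r).
  exact: (measurableT_comp (measurable_powR r) (@measurable_bracket R d)).
rewrite ge0_integral_measure_add//.
- by rewrite lte_add_pinfty//; [apply: tempered_le hs|apply: tempered_le ht]; rewrite le_max lexx ?orbT.
- by move=> x _; rewrite lee_fin powR_ge0.
- exact/measurable_EFinP.
Qed.

(** With s = 6 N the integrand is bracket^(-3N); times the weight bracket^(2N) it becomes
    bracket^(-N), which is integrable. *)
Lemma tempered_weighted mu N (mw : measurable_fun setT (fun x : 'rV[R]_d => bracket x ^+ (2 * N)))
    (w0 : forall x : 'rV[R]_d, 0 <= bracket x ^+ (2 * N)) :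
  mu.-integrable setT (EFin \o (fun x : 'rV[R]_d => (bracket x ^+ N)^-1)) ->
  tempered (weighted_measure mu mw w0).
Proof.
move=> /integrableP[_ iN]; exists (2 * (3 * N)%:R); first by rewrite mulr_ge0.
have e (x : 'rV[R]_d) : bracket x `^ (- (2 * (3 * N)%:R / 2)) = (bracket x ^+ (3 * N))^-1.
  have -> : 2 * (3 * N)%:R / 2 = (3 * N)%:R :> R by field.
  by rewrite powRN powR_mulrn// ltW// bracket_gt0.
under eq_integral do rewrite e.
rewrite (@ge0_integral_density _ _ _ mu (weighted_measure mu mw w0) _ mw w0)//.
- apply: le_lt_trans iN; rewrite le_eqVlt; apply/orP; left; apply/eqP.
  apply: eq_integral => x _ /=; rewrite ger0_norm; last by rewrite invr_ge0 ltW// bracketX_gt0.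
  congr EFin; have b0 : bracket x != 0 by rewrite gt_eqF// bracket_gt0.
  rewrite (_ : (3 * N)%N = (N + 2 * N)%N); last by rewrite -mulSn.
  by rewrite exprD invfM mulfVK// expf_neq0.
- exact: measurable_bracketXV.
- by move=> x; rewrite invr_ge0 ltW// bracketX_gt0.
Qed.

End measures_on_rV.

Lemma normcB_le (R : realType) (x y : R[i]) :
  normc (x + (-1) * y) <= normc x + normc y.
Proof.
rewrite mulN1r; apply: le_trans (le_normcD (x : Rcomplex R) (- y)) _.
by rewrite lerD2l (@normcN R y).
Qed.

(** * Filters *)

Section Linf_transform.
Context (R : realType) (d : nat) (mu : {measure set 'rV[R]_d -> \bar R}).
Hypothesis mu_tempered : tempered mu.
Implicit Types (h k g : 'rV[R]_d -> R[i]) (phi psi : 'rV[R]_d -> R[i]).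

Let cbr N : 'rV[R]_d -> R[i] := fun x => (bracket x ^+ N)%:C.
Let cbrV N : 'rV[R]_d -> R[i] := fun x => ((bracket x ^+ N)^-1)%:C.

Let m_cbr N : cmeasurable (cbr N).
Proof. by apply: cmeasurableC; apply: measurable_funX; exact: measurable_bracket. Qed.

Let m_cbrV N : cmeasurable (cbrV N).
Proof. by apply: cmeasurableC; exact: measurable_bracketXV. Qed.

Lemma bracketV_inL2 N : mu.-integrable setT (EFin \o (fun x : 'rV[R]_d => (bracket x ^+ N)^-1)) ->
  inL2 mu (cbrV N).
Proof.
move=> /integrableP[_ iN]; split; first exact: m_cbrV.
apply: le_lt_trans iN; apply: le_nnint.
- exact: measurable_sqnorm.
- by apply: measurableT_comp => //; exact: measurable_bracketXV.
- by move=> x; exact: sqnorm_ge0.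
- move=> x; have b0 : 0 <= (bracket x ^+ N)^-1 by rewrite invr_ge0 ltW// bracketX_gt0.
  rewrite ger0_norm// sqnormC expr2 -[leRHS]mulr1; apply: ler_wpM2l => //.
  by rewrite invf_le1 ?bracketX_gt0// exprn_ege1// bracket_ge1.
Qed.

Lemma Linf_mul_inL2 h g : inLinf mu h -> inL2 mu g -> inL2 mu (fun x => h x * g x).
Proof.
move=> [mh [M hM]] [mg goo]; have sg := measurable_sqnorm mg.
have mhg := cmeasurableM mh mg; split => //.
apply: (@le_lt_trans _ _ (\int[mu]_x (M ^+ 2 * sqnorm (g x))%:E)%E).
  apply: ae_ge0_le_integral => //.
  - by move=> x _; rewrite lee_fin sqnorm_ge0.
  - by apply/measurable_EFinP/measurable_sqnorm.
  - by move=> x _; rewrite lee_fin mulr_ge0 ?sqr_ge0 ?sqnorm_ge0.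
  - by apply/measurable_EFinP; exact: measurable_funM.
  apply: filterS hM => x hxM _; rewrite lee_fin sqnormM.
  by apply: ler_wpM2r; [exact: sqnorm_ge0|exact: sqnorm_le_bound].
rewrite nnintZ//; [|by move=> x; exact: sqnorm_ge0|exact: sqr_ge0].
by apply: lte_mul_pinfty => //; rewrite lee_fin sqr_ge0.
Qed.

Lemma fourier_bracket_inL2 N phi : schwartz phi -> inL2 mu (fun x => cbr N x * fourier phi x).
Proof.
move=> sphi; have [M iM] := tempered_bracketV mu_tempered.
have [C C0 phiC] := fourier_rapid (N + M) sphi.
have [mF _] := fourier_inL2 mu_tempered sphi.
have := inL2Z C%:C (bracketV_inL2 iM) => -[mC Coo].
split; first exact: cmeasurableM.
apply: le_lt_trans Coo; apply: le_nnint; [exact/measurable_sqnorm/cmeasurableM|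
  exact: measurable_sqnorm|by move=> x; exact: sqnorm_ge0|move=> x].
rewrite -[leRHS]/(sqnorm (C%:C * ((bracket x ^+ M)^-1)%:C)) -rmorphM sqnormC.
apply: sqnorm_le_bound; rewrite Normc.normcM normcC ger0_norm; last by rewrite ltW// bracketX_gt0.
apply: le_trans (ler_wpM2l _ (phiC x)) _; first by rewrite ltW// bracketX_gt0.
rewrite exprD invfM mulrCA (mulrA (bracket x ^+ N)) mulfV ?gt_eqF ?bracketX_gt0//.
by rewrite mul1r.
Qed.

Let cbrK N x : cbrV N x * cbr N x = 1.
Proof. by rewrite -rmorphM mulVf// gt_eqF// bracketX_gt0. Qed.

(** An L^oo function need not be square integrable. Moving a power of [bracket] between the two
    factors, at the expense of the rapid decay of the transform, puts both in L^2(mu). *)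
Let pairE N h phi : (fun x => h x * (fourier phi x)^*) =
  (fun x => (h x * cbrV N x) * (cbr N x * fourier phi x)^*).
Proof.
apply/funext => x.
have e : cbr N x * (fourier phi x)^* = (cbr N x * fourier phi x)^*.
  by rewrite /cbr; move: (fourier phi x) => u; apply: eq_ReIm; rewrite !ReImE /=; ring.
transitivity (h x * cbrV N x * (cbr N x * (fourier phi x)^*)).
  by rewrite mulrA -(mulrA (h x)) cbrK mulr1.
exact: (congr1 (fun z => h x * cbrV N x * z) e).
Qed.

Lemma cintegrable_Linf h phi : inLinf mu h -> schwartz phi ->
  cintegrable mu (fun x => h x * (fourier phi x)^*).
Proof.
move=> hi sphi; have [N iN] := tempered_bracketV mu_tempered.
rewrite (pairE N); apply: cintegrable_inL2M; last exact: fourier_bracket_inL2.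
exact/Linf_mul_inL2/bracketV_inL2.
Qed.

(* [k] annihilates the Fourier transforms in L^2(mu), hence k/bracket^(2N) does
   in L^2(bracket^(2N) mu), where the transforms are dense. *)
Lemma Linf_orthogonal_eq0 k : inLinf mu k ->
  (forall phi, schwartz phi -> cintegral mu (fun x => k x * (fourier phi x)^*) = 0) ->
  {ae mu, forall x, k x = 0}.
Proof.
move=> ki k0; have [N iN] := tempered_bracketV mu_tempered.
have mw : measurable_fun setT (fun x : 'rV[R]_d => bracket x ^+ (2 * N)).
  by apply: measurable_funX; exact: measurable_bracket.
have w0 (x : 'rV[R]_d) : 0 <= bracket x ^+ (2 * N) by rewrite ltW// bracketX_gt0.
pose nu := weighted_measure mu mw w0.
have tnu : tempered nu by exact: tempered_weighted.
have nuE := @ge0_integral_density _ _ _ mu nu _ mw w0 (fun A mA => erefl).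
(* Multiplication by bracket^N is an isometry from L^2(nu) to L^2(mu), and it sends [G] to [f1]. *)
pose G x := k x * cbrV (2 * N) x; pose f1 x := k x * cbrV N x.
have [mk _] := ki; have mG : cmeasurable G by exact: cmeasurableM.
have f1i : inL2 mu f1 by exact/Linf_mul_inL2/bracketV_inL2.
have e g x : sqnorm (g x - G x) * bracket x ^+ (2 * N) = sqnorm (cbr N x * g x - f1 x).
  have -> : cbr N x * g x - f1 x = cbr N x * (g x - G x).
    rewrite mulrBr; congr (_ - _); rewrite /f1 /G mulrCA; congr (_ * _).
    rewrite /cbrV /cbr -rmorphM; congr (_%:C).
    by rewrite mul2n -addnn exprD invfM mulrA mulfV ?mul1r// gt_eqF// bracketX_gt0.
  by rewrite sqnormM sqnormC -exprM mulnC mulrC.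
have dnu g : cmeasurable g -> L2sqdist nu g G = L2sqdist mu (fun x => cbr N x * g x) f1.
  move=> mg; rewrite /L2sqdist nuE; last by move=> x; exact: sqnorm_ge0.
    by apply: eq_integral => x _; rewrite e.
  by apply: measurable_sqnorm; exact: cmeasurableB.
have Gi : inL2 nu G.
  split=> //; have [_] := f1i; apply: le_lt_trans.
  have h : L2sqdist nu (fun=> 0) G = L2sqdist mu (fun x => cbr N x * 0) f1.
    by apply: (dnu (fun=> 0)); exact: cmeasurable_cst.
  rewrite /L2sqdist in h.
  under eq_integral do rewrite -sqnormN -sub0r.
  rewrite h le_eqVlt; apply/orP; left; apply/eqP; apply: eq_integral => x _.
  by rewrite mulr0 sub0r sqnormN.
suff f10 : (\int[mu]_x (sqnorm (f1 x))%:E = 0)%E.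
  have : {ae mu, forall x, f1 x = 0}.
    apply: L2sqdist0_ae; [exact: (proj1 f1i)|exact: cmeasurable_cst|].
    by rewrite /L2sqdist; under eq_integral do rewrite subr0.
   apply: filterS => x /(congr1 (fun z => z * cbr N x)).
  by rewrite mul0r /f1 -mulrA cbrK mulr1.
apply/eqP; rewrite eq_le nnint_ge0 ?andbT; last by move=> x; exact: sqnorm_ge0.
apply/lee_addgt0Pr => eps eps0; rewrite add0e.
(* Carried to L^2(mu), this approximant of [f1] is orthogonal to it; by Pythagoras the squared norm
   of [f1] is at most their squared distance. *)
have [phi tphi phiG] := fourier_dense tnu Gi eps0.
have sphi := test_function_schwartz tphi.
have [mF _] := fourier_inL2 mu_tempered sphi.
have gi := fourier_bracket_inL2 N sphi.
rewrite dnu// L2sqdistC L2_pythagoras// in phiG; last by rewrite -pairE k0.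
by apply: ltW; apply: le_lt_trans phiG; rewrite leeDl// nnint_ge0// => x; exact: sqnorm_ge0.
Qed.

(** The difference of the two representatives annihilates the transforms of all Schwartz
    functions. *)
Lemma fourier_Linf_unique f h k : has_fourier_Linf mu f h -> has_fourier_Linf mu f k ->
  {ae mu, forall x, h x = k x}.
Proof.
move=> [_ hi hE] [_ ki kE]; have [mh [M hM]] := hi; have [mk [L kL]] := ki.
have di : inLinf mu (fun x => h x + (-1) * k x).
  split; first by apply: cmeasurableD => //; apply: cmeasurableM => //; exact: cmeasurable_cst.
  exists (M + L); apply: filterS2 hM kL => x hx kx.
  by apply: le_trans (normcB_le _ _) _; exact: lerD.
have : {ae mu, forall x, h x + (-1) * k x = 0}.
  apply: Linf_orthogonal_eq0 => // phi sphi.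
  have i1 := cintegrable_Linf hi sphi; have i2 := cintegrable_Linf ki sphi.
  have -> : (fun x => (h x + (-1) * k x) * (fourier phi x)^*) =
      (fun x => h x * (fourier phi x)^* + (-1) * (k x * (fourier phi x)^*)).
    by apply/funext => x; rewrite mulrDl mulrA.
  rewrite (cintegralD i1 (cintegrableZ _ i2)) (cintegralZ _ i2) (hE _ sphi) (kE _ sphi).
  by rewrite mulN1r subrr.
by apply: filterS => x; rewrite mulN1r => /eqP; rewrite subr_eq0 => /eqP.
Qed.

(** Continuity rests on [fourier_decay]: functions in a small Schwartz ball have transforms that are
    small multiples of the integrable weight bracket^(-N). *)
Lemma Linf_tempered_distribution h (M : R) : cmeasurable h -> (forall x, normc (h x) <= M) ->
  tempered_distribution (fun phi => cintegral mu (fun x => h x * (fourier phi x)^*)).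
Proof.
move=> mh hM; have hi : inLinf mu h by split => //; exists M; exact: aeW.
have M0 : 0 <= M by apply: le_trans (normc_ge0 _) (hM 0).
have lin (a : R[i]) phi psi : schwartz phi -> schwartz psi ->
    cintegral mu (fun x => h x * (fourier (fun y => a * phi y + psi y) x)^*) =
    a^* * cintegral mu (fun x => h x * (fourier phi x)^*) +
    cintegral mu (fun x => h x * (fourier psi x)^*).
  move=> sphi spsi; have i1 := cintegrable_Linf hi sphi; have i2 := cintegrable_Linf hi spsi.
  rewrite -cintegralZ// -cintegralD//; last exact: cintegrableZ.
  congr (cintegral _ _); apply/funext => x.
  rewrite fourier_linear; [|exact: schwartz_crapid..].
  move: (fourier phi x) (fourier psi x) (h x) => u v w.
  by apply: eq_ReIm; rewrite !ReImE /=; ring.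
split=> // phi sphi eps eps0.
have [N iN] := tempered_bracketV mu_tempered.
pose K := \int[mu]_x (bracket x ^+ N)^-1.
have K0 : 0 <= K by apply: Rintegral_ge0 => x _; rewrite invr_ge0 ltW// bracketX_gt0.
(* If all seminorms involved are at most delta, [fourier_decay] yields [decay_cst] times delta + d
   delta. *)
pose B := M * (decay_cst R d N * d.+1%:R).
(* The factor 2 comes from [normc_cintegral_le], and the + 1 makes the denominator positive. *)
have D0 : 0 < 2 * (`|B| * K) + 1 by rewrite ltr_wpDl// mulr_ge0// mulr_ge0.
exists d, (2 * N)%N, (eps / (2 * (`|B| * K) + 1)); split; first exact: divr_gt0.
set delta := (eps / _) => psi spsi ball.
have delta0 : 0 <= delta by rewrite divr_ge0// ltW.
have schi : schwartz (fun x => (-1) * phi x + psi x) by exact: schwartz_lin.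
have chiE : (fun x => psi x - phi x) = (fun x => (-1) * phi x + psi x).
  by apply/funext => x; rewrite mulN1r addrC.
rewrite chiE in ball; set chi := (fun x => _) in schi ball.
have -> : cintegral mu (fun x => h x * (fourier psi x)^*) - cintegral mu (fun x => h x * (fourier phi x)^*)
    = cintegral mu (fun x => h x * (fourier chi x)^*).
  rewrite (lin (-1) phi psi sphi spsi).
  rewrite [X in _ = X * _ + _](_ : _ = -1); first by rewrite mulN1r addrC.
  by apply: eq_ReIm; rewrite /= ?oppr0.
have [A chiA] := schwartz_seminorms schi.
(* The ball controls derivatives up to order 2 N; longer lists keep some finite bound, which does
   not enter the estimate. *)
pose A' s := if (size s <= 2 * N)%N then delta else A s.
have chiA' s x : bracket x ^+ d * normc (pderivs s chi x) <= A' s.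
  by rewrite /A'; case: ifPn => [/ball|_]; [exact|exact: chiA].
have Fchi x : normc (h x * (fourier chi x)^*) <= `|B| * delta * (bracket x ^+ N)^-1.
  rewrite Normc.normcM (_ : normc (fourier chi x)^* = normc (fourier chi x)); last first.
    by rewrite /normc; case: (fourier chi x) => a b /=; rewrite sqrrN.
  rewrite -ler_pdivrMr ?invr_gt0 ?bracketX_gt0// invrK.
  have := @fourier_decay R d N chi A' schi chiA' x.
  rewrite /A' /= (eq_bigr (fun=> delta)); last by move=> j _; rewrite size_nseq leqnn.
  rewrite sumr_const card_ord => dec.
  have -> : normc (h x) * normc (fourier chi x) * bracket x ^+ N =
    normc (h x) * (bracket x ^+ N * normc (fourier chi x)) by ring.
  apply: (@le_trans _ _ (M * (decay_cst R d N * (delta + delta *+ d)))).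
    apply: ler_pM => //; first exact: normc_ge0.
    by rewrite mulr_ge0 ?normc_ge0// ltW// bracketX_gt0.
  rewrite (_ : M * _ = B * delta); last by rewrite /B -mulrS -mulr_natl; ring.
  by apply: ler_wpM2r => //; exact: ler_norm.
apply: le_trans (normc_cintegral_le (cintegrable_Linf hi schi) Fchi _) _.
  exact: integrable_realZ.
rewrite RintegralZl// -/K.
rewrite (_ : 2 * _ = delta * (2 * (`|B| * K))); last by ring.
rewrite /delta mulrAC ler_pdivrMr//; apply: ler_wpM2l; first exact: ltW.
by rewrite lerDl ler01.
Qed.

End Linf_transform.

(** The difference f - c g, arranged to match the shape of linearity in [gsp] and
    [fourier_linear]. *)
Definition residual (R : realType) (X : Type) (c : R) (f g : X -> R[i]) : X -> R[i] :=
  fun x => (- c)%:C * g x + f x.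

Lemma residualE (R : realType) (X : Type) (c : R) (f g : X -> R[i]) x :
  residual c f g x = f x - c%:C * g x.
Proof. by rewrite /residual rmorphN mulNr addrC. Qed.

(** * The optimal filter *)

Section approximation.
Context (R : realType) (d : measure_display) (X : measurableType d).
Context (mu : {measure set X -> \bar R}).
Implicit Types f g : X -> R[i].

Lemma ae_eq_sqnorm_integral f g : cmeasurable f -> cmeasurable g ->
  {ae mu, forall x, f x = g x} ->
  (\int[mu]_x (sqnorm (f x))%:E = \int[mu]_x (sqnorm (g x))%:E)%E.
Proof.
move=> mf mg fg; apply: ge0_ae_eq_integral => //.
- by apply/measurable_EFinP; exact: measurable_sqnorm.
- by apply/measurable_EFinP; exact: measurable_sqnorm.
- by move=> x _; rewrite lee_fin sqnorm_ge0.
- by move=> x _; rewrite lee_fin sqnorm_ge0.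
- by apply: filterS fg => x -> _.
Qed.

Lemma L2sqdist_residual (c : R) f g :
  L2sqdist mu f (fun x => c%:C * g x) = (\int[mu]_x (sqnorm (residual c f g x))%:E)%E.
Proof. by apply: eq_integral => x _; rewrite residualE. Qed.

Lemma cmeasurable_residual (c : R) f g : cmeasurable f -> cmeasurable g -> cmeasurable (residual c f g).
Proof. by move=> mf mg; apply: cmeasurableD => //; apply: cmeasurableM => //; exact: cmeasurable_cst. Qed.

Lemma residual_dist (c t : R) f g f' g' : 0 <= t -> cmeasurable f -> cmeasurable g ->
  cmeasurable f' -> cmeasurable g' ->
  (L2sqdist mu f f' <= t%:E -> L2sqdist mu g g' <= t%:E ->
   L2sqdist mu (residual c f g) (residual c f' g') <= ((2 * c ^+ 2 + 2) * t)%:E)%E.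
Proof.
move=> t0 mf mg mf' mg' ff' gg'.
apply: le_trans (L2sqdist_lin mu (- c)%:C mg mf mg' mf') _.
rewrite sqnormC sqrrN (_ : ((_ + 2) * t)%:E = (2 * c ^+ 2)%:E * t%:E + 2%:E * t%:E)%E; last first.
  by rewrite -!EFinM -EFinD mulrDl.
apply: leeD; apply: lee_wpmul2l => //.
by rewrite lee_fin mulr_ge0// sqr_ge0.
Qed.

(** For a squared distance e^2 the second term of the Young inequality contributes (1 + 1/e) e^2 =
    e^2 + e <= 2 e. *)
Lemma close_sqnorm_integral (e : R) f g : 0 < e -> e <= 1 -> cmeasurable f -> cmeasurable g ->
  (L2sqdist mu f g <= (e ^+ 2)%:E)%E ->
  (\int[mu]_x (sqnorm (f x))%:E <= (1 + e)%:E * \int[mu]_x (sqnorm (g x))%:E + (2 * e)%:E)%E.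
Proof.
move=> e0 e1 mf mg fg; apply: le_trans (sqnorm_integral_eps mu e0 mf mg) _.
rewrite leeD2l//; apply: (@le_trans _ _ ((1 + e^-1)%:E * (e ^+ 2)%:E)%E).
  by apply: lee_wpmul2l => //; rewrite lee_fin addr_ge0// invr_ge0 ltW.
rewrite -EFinM lee_fin mulrDl mul1r expr2 mulrA mulVf ?gt_eqF// mul1r.
by rewrite [leRHS]mulr_natl mulr2n lerD2r ler_piMr// ltW.
Qed.

End approximation.

(** Composing the two estimates through [C] costs at most e (3 b + 12) when e <= 1 and b is
    finite. *)
Lemma le_approx (R : realType) (a b : \bar R) : (0 <= b)%E ->
  (forall e : R, 0 < e -> e <= 1 -> exists C : \bar R,
    (a <= (1 + e)%:E * C + (4 * e)%:E /\ C <= (1 + e)%:E * b + (4 * e)%:E)%E) ->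
  (a <= b)%E.
Proof.
case: b => [r|_ _|] //; last by rewrite leey.
rewrite lee_fin => r0 h; apply/lee_addgt0Pr => eps eps0.
have D0 : 0 < 3 * r + 12 by rewrite ltr_wpDl// mulr_ge0.
pose e := Num.min 1 (eps / (3 * r + 12)).
have e0 : 0 < e by rewrite lt_min ltr01 divr_gt0.
have e1 : e <= 1 by rewrite ge_min lexx.
have eeps : e * (3 * r + 12) <= eps by rewrite -ler_pdivlMr// ge_min lexx orbT.
have [C [aC Cb]] := h e e0 e1.
apply: le_trans aC _; apply: (@le_trans _ _ ((1 + e)%:E * ((1 + e)%:E * r%:E + (4 * e)%:E) + (4 * e)%:E)%E).
  by apply: leeD => //; apply: lee_wpmul2l => //; rewrite lee_fin addr_ge0// ltW.
rewrite -!(EFinM, EFinD) lee_fin.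
have ee : e * e <= e by rewrite ler_piMr// ltW.
have eer : e * e * r <= e * r by apply: ler_wpM2r.
nra.
Qed.

Lemma leeD_approx (R : realType) (e : R) (a b a' b' : \bar R) : (0 <= a)%E -> (0 <= b)%E ->
  (a' <= (1 + e)%:E * a + (2 * e)%:E -> b' <= (1 + e)%:E * b + (2 * e)%:E ->
   a' + b' <= (1 + e)%:E * (a + b) + (4 * e)%:E)%E.
Proof.
move=> a0 b0 ha hb; rewrite ge0_muleDr//.
rewrite (_ : (4 * e)%:E = (2 * e)%:E + (2 * e)%:E)%E; last by rewrite -EFinD; congr EFin; ring.
by rewrite addeACA; exact: leeD.
Qed.

(** * Error formula for the extended processes *)

Section processes.
Context (R : realType) (d : nat) (d' : measure_display) (T : measurableType d').
Context (P : probability T R) (u w : ('rV[R]_d -> R[i]) -> T -> R[i]).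
Context (mu_u mu_w : {measure set 'rV[R]_d -> \bar R}).
Hypotheses (gsp_u : gsp P u) (gsp_w : gsp P w) (uncorr_uw : uncorrelated_gsp P u w).
Hypotheses (spec_u : spectral_measure P u mu_u) (spec_w : spectral_measure P w mu_w).

Let mu : {measure set 'rV[R]_d -> \bar R} := measure_add mu_u mu_w.
Let v := gsp_add u w.
Implicit Types (chi phi psi g k : 'rV[R]_d -> R[i]).

(** Real part of the covariance identity with equal arguments; both sides are finite, so equality
    holds in the extended reals. *)
Lemma spectral_isometry (u0 : ('rV[R]_d -> R[i]) -> T -> R[i])
    (mu0 : {measure set 'rV[R]_d -> \bar R}) chi : gsp P u0 -> spectral_measure P u0 mu0 -> test_function chi ->
  (\int[P]_t (sqnorm (u0 chi t))%:E = \int[mu0]_x (sqnorm (fourier chi x))%:E)%E.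
Proof.
move=> [u0L _ _] [_ tmu cov] tchi; have [[_ uoo] _] := u0L _ tchi.
have [_ Foo] := fourier_inL2 tmu (test_function_schwartz tchi).
have := congr1 (@complex.Re R) (cov chi chi tchi tchi).
rewrite /covariance_gsp !cintegral_sqnorm => e.
rewrite -[LHS]fineK ?e ?fineK// ge0_fin_numE// nnint_ge0// => x; exact: sqnorm_ge0.
Qed.

Lemma test_residual (c : R) phi psi : test_function phi -> test_function psi ->
  test_function (residual c phi psi).
Proof. by move=> tphi tpsi; exact: test_function_lin. Qed.

Lemma fourier_residual (c : R) phi psi : test_function phi -> test_function psi ->
  fourier (residual c phi psi) = residual c (fourier phi) (fourier psi).
Proof.
move=> /test_function_schwartz/schwartz_crapid cphi /test_function_schwartz/schwartz_crapid cpsi.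
exact: fourier_linear.
Qed.

Lemma gsp_residual u0 (c : R) phi psi : gsp P u0 -> test_function phi -> test_function psi ->
  {ae P, forall t, u0 (residual c phi psi) t = residual c (u0 phi) (u0 psi) t}.
Proof.
move=> [_ lin _] tphi tpsi; have := lin (- c)%:C psi phi tpsi tphi.
apply: filterS => t ->; rewrite /residual; congr (_ * _ + _).
by apply: eq_ReIm; rewrite /= ?oppr0.
Qed.

(** Uncorrelated variables are orthogonal in L^2(P), and each process is isometric for its own
    spectral measure. *)
Lemma uncorrelated_dist (c : R) chi1 chi2 : test_function chi1 -> test_function chi2 ->
  (L2sqdist P (u chi1) (fun t => c%:C * w chi2 t)%R =
   \int[mu_u]_x (sqnorm (fourier chi1 x))%:E +
   \int[mu_w]_x (sqnorm (c%:C * fourier chi2 x))%:E)%E.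
Proof.
move=> t1 t2; have [uL _ _] := gsp_u; have [wL _ _] := gsp_w.
have [ui _] := uL _ t1; have [wi _] := wL _ t2.
rewrite L2_pythagoras//; [|exact: inL2Z|].
  rewrite (spectral_isometry gsp_u spec_u)//; congr (_ + _)%E.
  have [_ tw _] := spec_w; have [mF _] := fourier_inL2 tw (test_function_schwartz t2).
  have [mw _] := wi.
  under eq_integral do rewrite sqnormM sqnormC.
  under [RHS]eq_integral do rewrite sqnormM sqnormC.
  rewrite !nnintZ ?sqr_ge0 ?(spectral_isometry gsp_w spec_w)//.
  - exact: measurable_sqnorm.
  - by move=> x; exact: sqnorm_ge0.
  - exact: measurable_sqnorm.
  - by move=> x; exact: sqnorm_ge0.
have -> : (fun t => u chi1 t * (c%:C * w chi2 t)^*) = (fun t => c%:C * (u chi1 t * (w chi2 t)^*)).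
  apply/funext => t; move: (u chi1 t) (w chi2 t) => x y.
  by apply: eq_ReIm; rewrite !ReImE /=; ring.
rewrite cintegralZ; last exact: cintegrable_inL2M.
by have := uncorr_uw t1 t2; rewrite /covariance_gsp => ->; rewrite mulr0.
Qed.

Let mu_tempered : tempered mu.
Proof. by have [_ ? _] := spec_u; have [_ ? _] := spec_w; exact: tempered_add. Qed.

Let mu_integral (r : 'rV[R]_d -> R) : measurable_fun setT r -> (forall x, 0 <= r x) ->
  (\int[mu]_x (r x)%:E = \int[mu_u]_x (r x)%:E + \int[mu_w]_x (r x)%:E)%E.
Proof.
move=> mr r0; apply: ge0_integral_measure_add => //; first by move=> x _; rewrite lee_fin.
exact/measurable_EFinP.
Qed.

Lemma le_mu_u (r : 'rV[R]_d -> R) : measurable_fun setT r -> (forall x, 0 <= r x) ->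
  (\int[mu_u]_x (r x)%:E <= \int[mu]_x (r x)%:E)%E.
Proof. by move=> mr r0; rewrite mu_integral// leeDl// nnint_ge0. Qed.

Lemma le_mu_w (r : 'rV[R]_d -> R) : measurable_fun setT r -> (forall x, 0 <= r x) ->
  (\int[mu_w]_x (r x)%:E <= \int[mu]_x (r x)%:E)%E.
Proof. by move=> mr r0; rewrite mu_integral// leeDr// nnint_ge0. Qed.

Let fourierL chi : test_function chi -> inL2 mu (fourier chi).
Proof. by move=> tchi; exact/fourier_inL2/test_function_schwartz. Qed.

Let res1 X (f g : X -> R[i]) : residual 1 f g = fun x => f x - g x.
Proof. by apply/funext => x; rewrite residualE mul1r. Qed.

Let L2sqdist_res1 phi psi (nu : {measure set 'rV[R]_d -> \bar R}) :
  test_function phi -> test_function psi ->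
  L2sqdist nu (fourier phi) (fourier psi) = (\int[nu]_x (sqnorm (fourier (residual 1 phi psi) x))%:E)%E.
Proof. by move=> tphi tpsi; rewrite fourier_residual// res1. Qed.

(** On test functions [u] is isometric for [mu_u], hence a contraction for the larger [mu]. *)
Lemma extension_u : continuous_extension P mu u (gsp_ext P mu u).
Proof.
rewrite /gsp_ext; apply: (@xgetPex _ (fun=> fun=> 0) [set U | continuous_extension P mu u U]).
have [uL _ _] := gsp_u.
apply: (continuous_extension_exists uL) => [phi psi tphi tpsi|phi|]; [|exact: fourierL|exact: fourier_dense].
have [[mp _] _] := uL _ tphi; have [[mq _] _] := uL _ tpsi.
have t1 := test_residual 1 tphi tpsi; have [[m1 _] _] := uL _ t1.
have [mF _] := fourierL t1.
rewrite L2sqdist_res1//; apply: le_trans (le_mu_u (measurable_sqnorm mF) _); last first.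
  by move=> x; exact: sqnorm_ge0.
rewrite -(spectral_isometry gsp_u spec_u t1) le_eqVlt; apply/orP; left; apply/eqP.
rewrite /L2sqdist; apply: ae_eq_sqnorm_integral => //; first exact: cmeasurableB.
by apply: filterS (gsp_residual 1 gsp_u tphi tpsi) => t ->; rewrite res1.
Qed.

Lemma extension_v : continuous_extension P mu v (gsp_ext P mu v).
Proof.
rewrite /gsp_ext; apply: (@xgetPex _ (fun=> fun=> 0) [set U | continuous_extension P mu v U]).
have [uL _ _] := gsp_u; have [wL _ _] := gsp_w.
have vL phi : test_function phi -> inL20 P (v phi).
  move=> tphi; have [ui u0] := uL _ tphi; have [wi w0] := wL _ tphi; split; first exact: inL2D.
  by rewrite cintegralD ?u0 ?w0 ?addr0//; exact: integrable_inL2.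
apply: (continuous_extension_exists vL) => [phi psi tphi tpsi|phi|]; [|exact: fourierL|exact: fourier_dense].
have [[mp _] _] := vL _ tphi; have [[mq _] _] := vL _ tpsi.
have t1 := test_residual 1 tphi tpsi; have [[m1 _] _] := uL _ t1; have [[m2 _] _] := wL _ t1.
have [mF _] := fourierL t1.
rewrite L2sqdist_res1// mu_integral; [|exact: measurable_sqnorm|by move=> x; exact: sqnorm_ge0].
(* With c = -1 the difference u - c w is the sum, so [v] is isometric for [mu]. *)
have := uncorrelated_dist (-1) t1 t1; rewrite rmorphN rmorph1.
under [X in (_ + X)%E]eq_integral do rewrite mulN1r sqnormN.
move=> <-; rewrite le_eqVlt; apply/orP; left; apply/eqP.
apply: ae_eq_sqnorm_integral; [exact: cmeasurableB| |].
  by apply: cmeasurableB => //; apply: cmeasurableM => //; exact: cmeasurable_cst.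
apply: filterS2 (gsp_residual 1 gsp_u tphi tpsi) (gsp_residual 1 gsp_w tphi tpsi) => t -> ->.
by rewrite !res1 /v /gsp_add mulN1r opprK; ring.
Qed.

(** A.e., u(phi) - c v(psi) = u(phi - c psi) - c w(psi), a difference of orthogonal variables. *)
Let uncorrelated_dist_test (c : R) phi psi : test_function phi -> test_function psi ->
  (\int[P]_t (sqnorm (residual c (u phi) (v psi) t))%:E =
   \int[mu_u]_x (sqnorm (residual c (fourier phi) (fourier psi) x))%:E +
   \int[mu_w]_x (sqnorm (residual c (fun=> 0) (fourier psi) x))%:E)%E.
Proof.
move=> tphi tpsi; have [uL _ _] := gsp_u; have [wL _ _] := gsp_w.
have t1 := test_residual c tphi tpsi.
have [[mp _] _] := uL _ tphi; have [[mq _] _] := uL _ tpsi; have [[mr _] _] := wL _ tpsi.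
have [[m1 _] _] := uL _ t1.
rewrite -fourier_residual//.
have -> : (\int[mu_w]_x (sqnorm (residual c (fun=> 0) (fourier psi) x))%:E =
    \int[mu_w]_x (sqnorm (c%:C * fourier psi x)%R)%:E)%E.
  by apply: eq_integral => x _; rewrite residualE sub0r sqnormN.
rewrite -uncorrelated_dist//; apply: ae_eq_sqnorm_integral.
- by apply: cmeasurable_residual => //; exact: cmeasurableD.
- by apply: cmeasurableB => //; apply: cmeasurableM => //; exact: cmeasurable_cst.
apply: filterS (gsp_residual c gsp_u tphi tpsi) => t ->.
by rewrite !residualE /v /gsp_add mulrDr opprD addrA.
Qed.

Let le_dist f g (m : {measure set 'rV[R]_d -> \bar R}) t : inL2 mu f -> inL2 mu g ->
  (forall r : 'rV[R]_d -> R, measurable_fun setT r -> (forall x, 0 <= r x) ->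
     (\int[m]_x (r x)%:E <= \int[mu]_x (r x)%:E)%E) ->
  (L2sqdist mu f g <= t -> L2sqdist m f g <= t)%E.
Proof.
move=> [mf _] [mg _] h; apply: le_trans; apply: h; last by move=> x; exact: sqnorm_ge0.
exact/measurable_sqnorm/cmeasurableB.
Qed.

(** Both sides depend continuously on (g, k) and agree on transforms of test functions; [le_approx]
    takes each inequality to the limit. *)
Lemma extension_dist (c : R) g k : inL2 mu g -> inL2 mu k ->
  (L2sqdist P (gsp_ext P mu u g) (fun t => c%:C * gsp_ext P mu v k t)%R =
   \int[mu_u]_x (sqnorm (g x - c%:C * k x))%:E + \int[mu_w]_x (sqnorm (c%:C * k x))%:E)%E.
Proof.
move=> gi ki; rewrite L2sqdist_residual.
set U := gsp_ext P mu u; set V := gsp_ext P mu v.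
have [UL Ucont Uu] := extension_u; have [VL Vcont Vv] := extension_v.
have [uL _ _] := gsp_u; have [wL _ _] := gsp_w.
have [[mU _] _] := UL _ gi; have [[mV _] _] := VL _ ki.
have [mg _] := gi; have [mk _] := ki.
have -> : (\int[mu_u]_x (sqnorm (g x - c%:C * k x)%R)%:E =
    \int[mu_u]_x (sqnorm (residual c g k x))%:E)%E.
  by apply: eq_integral => x _; rewrite residualE.
have -> : (\int[mu_w]_x (sqnorm (c%:C * k x)%R)%:E =
    \int[mu_w]_x (sqnorm (residual c (fun=> 0) k x))%:E)%E.
  by apply: eq_integral => x _; rewrite residualE sub0r sqnormN.
have approx (e : R) : 0 < e -> exists phi psi, [/\ test_function phi, test_function psi,
   (L2sqdist P (residual c (U g) (V k)) (residual c (u phi) (v psi)) <= (e ^+ 2)%:E)%E,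
   (L2sqdist mu_u (residual c g k) (residual c (fourier phi) (fourier psi)) <= (e ^+ 2)%:E)%E &
   (L2sqdist mu_w (residual c (fun=> 0%R) k) (residual c (fun=> 0%R) (fourier psi)) <= (e ^+ 2)%:E)%E].
  move=> e0; have D0 : 0 < 2 * c ^+ 2 + 2 by rewrite ltr_wpDl// mulr_ge0// sqr_ge0.
  pose t := e ^+ 2 / (2 * c ^+ 2 + 2); have t0 : 0 < t by rewrite divr_gt0// exprn_gt0.
  have tE : (2 * c ^+ 2 + 2) * t = e ^+ 2 by rewrite /t mulrC divfK// gt_eqF.
  have [d1 d10 Ud1] := Ucont g gi t t0; have [d2 d20 Vd2] := Vcont k ki t t0.
  (* The radius [d1] serves the continuity of the extension, [t] the distances on the spectral
     side. *)
  have m10 : 0 < Num.min d1 t by rewrite lt_min d10.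
  have m20 : 0 < Num.min d2 t by rewrite lt_min d20.
  have [phi tphi phig] := fourier_dense mu_tempered gi m10.
  have [psi tpsi psik] := fourier_dense mu_tempered ki m20.
  have Fphi := fourierL tphi; have Fpsi := fourierL tpsi.
  have [mFphi _] := Fphi; have [mFpsi _] := Fpsi.
  have dg : (L2sqdist mu g (fourier phi) <= t%:E)%E.
    by rewrite L2sqdistC; apply/ltW/(lt_le_trans phig); rewrite lee_fin ge_min lexx orbT.
  have dk : (L2sqdist mu k (fourier psi) <= t%:E)%E.
    by rewrite L2sqdistC; apply/ltW/(lt_le_trans psik); rewrite lee_fin ge_min lexx orbT.
  have [[mup _] _] := uL _ tphi; have [[mup' _] _] := uL _ tpsi; have [[mwp _] _] := wL _ tpsi.
  have mvp : cmeasurable (v psi) by exact: cmeasurableD.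
  have [[mUp _] _] := UL _ Fphi; have [[mVp _] _] := VL _ Fpsi.
  exists phi, psi; split => //; rewrite -tE; apply: residual_dist => //; try exact: ltW; try exact: cmeasurable_cst.
  - rewrite L2sqdistC -(@L2sqdist_ae _ _ _ P (U (fourier phi)) (U g) (u phi) (U g))//.
    + apply/ltW/Ud1 => //; apply: lt_le_trans phig _; by rewrite lee_fin ge_min lexx.
    + exact: Uu.
    + exact: aeW.
  - rewrite L2sqdistC -(@L2sqdist_ae _ _ _ P (V (fourier psi)) (V k) (v psi) (V k))//.
    + apply/ltW/Vd2 => //; apply: lt_le_trans psik _; by rewrite lee_fin ge_min lexx.
    + exact: Vv.
    + exact: aeW.
  - exact: le_dist le_mu_u dg.
  - exact: le_dist le_mu_u dk.
  - by rewrite L2sqdistxx lee_fin ltW.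
  - exact: le_dist le_mu_w dk.
have mres := cmeasurable_residual.
have m0 : cmeasurable (fun _ : 'rV[R]_d => 0 : R[i]) by exact: cmeasurable_cst.
apply/eqP; rewrite eq_le; apply/andP; split; apply: le_approx.
- by apply: adde_ge0; apply: nnint_ge0 => x; exact: sqnorm_ge0.
- move=> e e0 e1; have [phi [psi [tphi tpsi hP hu hw]]] := approx e e0.
  have [mFphi _] := fourierL tphi; have [mFpsi _] := fourierL tpsi.
  have [[mup _] _] := uL _ tphi; have [[mup' _] _] := uL _ tpsi; have [[mwp _] _] := wL _ tpsi.
  have mvp : cmeasurable (v psi) by exact: cmeasurableD.
  exists (\int[P]_t (sqnorm (residual c (u phi) (v psi) t))%:E)%E; split.
    apply: le_trans (close_sqnorm_integral e0 e1 _ _ hP) _; [exact: mres|exact: mres|].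
    by rewrite leeD2l// lee_fin; apply: ler_wpM2r; [exact: ltW|rewrite ler_nat].
  rewrite uncorrelated_dist_test//; apply: leeD_approx; try by apply: nnint_ge0 => x; exact: sqnorm_ge0.
  + by rewrite L2sqdistC in hu; apply: (close_sqnorm_integral e0 e1 _ _ hu); exact: mres.
  + by rewrite L2sqdistC in hw; apply: (close_sqnorm_integral e0 e1 _ _ hw); exact: mres.
- by apply: nnint_ge0 => x; exact: sqnorm_ge0.
- move=> e e0 e1; have [phi [psi [tphi tpsi hP hu hw]]] := approx e e0.
  have [mFphi _] := fourierL tphi; have [mFpsi _] := fourierL tpsi.
  have [[mup _] _] := uL _ tphi; have [[mup' _] _] := uL _ tpsi; have [[mwp _] _] := wL _ tpsi.
  have mvp : cmeasurable (v psi) by exact: cmeasurableD.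
  exists (\int[P]_t (sqnorm (residual c (u phi) (v psi) t))%:E)%E; split.
    rewrite uncorrelated_dist_test//; apply: leeD_approx; try by apply: nnint_ge0 => x; exact: sqnorm_ge0.
    + by apply: (close_sqnorm_integral e0 e1 _ _ hu); exact: mres.
    + by apply: (close_sqnorm_integral e0 e1 _ _ hw); exact: mres.
  rewrite L2sqdistC in hP.
  apply: le_trans (close_sqnorm_integral e0 e1 _ _ hP) _; [exact: mres|exact: mres|].
  by rewrite leeD2l// lee_fin; apply: ler_wpM2r; [exact: ltW|rewrite ler_nat].
Qed.

End processes.

(** * The Wiener filter: optimality, uniqueness, support, minimal error *)

Section wiener_filter.
Context (R : realType) (d : nat) (d' : measure_display) (T : measurableType d').
Context (P : probability T R) (u w : ('rV[R]_d -> R[i]) -> T -> R[i]).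
Context (mu_u mu_w : {measure set 'rV[R]_d -> \bar R}).
Hypotheses (gsp_u : gsp P u) (gsp_w : gsp P w) (uncorr_uw : uncorrelated_gsp P u w).
Hypotheses (spec_u : spectral_measure P u mu_u) (spec_w : spectral_measure P w mu_w).
Implicit Types (h g : 'rV[R]_d -> R[i]) (f : ('rV[R]_d -> R[i]) -> R[i]).

Let mu : {measure set 'rV[R]_d -> \bar R} := measure_add mu_u mu_w.
Let v := gsp_add u w.

Let mu_radon : radon mu.
Proof. by have [? _ _] := spec_u; have [? _ _] := spec_w; exact: radon_add. Qed.

Let mu_tempered : tempered mu.
Proof. by have [_ ? _] := spec_u; have [_ ? _] := spec_w; exact: tempered_add. Qed.

Let muE A : mu A = (mu_u A + mu_w A)%E. Proof. exact: measure_addE. Qed.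

Lemma radon_nikodym_tempered (nu : {measure set 'rV[R]_d -> \bar R}) : tempered nu ->
  (forall A, measurable A -> mu A = 0%E -> nu A = 0%E) ->
  exists h : 'rV[R]_d -> R, [/\ measurable_fun setT h, forall x, 0 <= h x &
    forall A, measurable A -> nu A = (\int[mu]_(x in A) (h x)%:E)%E].
Proof.
move=> tnu numu; have [N /integrableP[_ iN]] := tempered_bracketV tnu.
apply: (@radon_nikodym_weighted _ _ _ mu nu (fun x => (bracket x ^+ N)^-1)) => //.
- exact: radon_sigma_finite.
- exact: measurable_bracketXV.
- under eq_fun do rewrite invrK.
  by apply: measurable_funX; exact: measurable_bracket.
- by move=> x; rewrite invr_gt0 bracketX_gt0.
- apply: le_lt_trans iN; rewrite le_eqVlt; apply/orP; left; apply/eqP.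
  by apply: eq_integral => x _ /=; rewrite ger0_norm// invr_ge0 ltW// bracketX_gt0.
Qed.

(** Both measures are absolutely continuous with respect to their sum, and their densities add up to
    1 a.e. Truncating the first at 1 changes it on a null set only and makes the bounds hold at
    every point. *)
Lemma spectral_densities : exists fhat : 'rV[R]_d -> R, [/\ measurable_fun setT fhat,
  forall x, 0 <= fhat x <= 1,
  forall A, measurable A -> mu_u A = (\int[mu]_(x in A) (fhat x)%:E)%E &
  forall A, measurable A -> mu_w A = (\int[mu]_(x in A) (1 - fhat x)%:E)%E].
Proof.
have [_ tu _] := spec_u; have [_ tw _] := spec_w.
have [h0 [m0 h0p h0E]] : exists h : 'rV[R]_d -> R, [/\ measurable_fun setT h, forall x, 0 <= h x &
    forall A, measurable A -> mu_u A = (\int[mu]_(x in A) (h x)%:E)%E].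
  apply: radon_nikodym_tempered => // A mA; rewrite muE => A0.
  by apply/eqP; rewrite eq_le measure_ge0 andbT -A0 leeDl.
have [h1 [m1 h1p h1E]] : exists h : 'rV[R]_d -> R, [/\ measurable_fun setT h, forall x, 0 <= h x &
    forall A, measurable A -> mu_w A = (\int[mu]_(x in A) (h x)%:E)%E].
  apply: radon_nikodym_tempered => // A mA; rewrite muE => A0.
  by apply/eqP; rewrite eq_le measure_ge0 andbT -A0 leeDr.
have h01 : {ae mu, forall x, h0 x + h1 x = 1}.
  apply: (@density_ae_unique_radon _ _ mu mu _ (fun=> 1)) => //.
  - exact: measurable_funD.
  - move=> A mA; rewrite muE h0E// h1E//.
    under [RHS]eq_integral do rewrite EFinD.
    rewrite ge0_integralD//; try by move=> x _; rewrite lee_fin.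
    + by apply/measurable_EFinP; exact: measurable_funTS.
    + by apply/measurable_EFinP; exact: measurable_funTS.
  - by move=> A mA; rewrite integral_cst// mul1e.
have mf : measurable_fun setT (fun x => Num.min (h0 x) 1) by exact: measurable_minr.
have ae0 A : measurable A ->
    (\int[mu]_(x in A) (h0 x)%:E = \int[mu]_(x in A) (Num.min (h0 x) 1)%:E)%E.
  move=> mA; apply: ae_eq_integral => //.
  - by apply/measurable_EFinP; exact: measurable_funTS.
  - by apply/measurable_EFinP; exact: measurable_funTS.
  apply: filterS h01 => x h _; congr EFin; apply/esym/min_idPl.
  by rewrite -h lerDl.
have ae1 A : measurable A ->
    (\int[mu]_(x in A) (h1 x)%:E = \int[mu]_(x in A) (1 - Num.min (h0 x) 1)%:E)%E.
  move=> mA; apply: ae_eq_integral => //.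
  - by apply/measurable_EFinP; exact: measurable_funTS.
  - by apply/measurable_EFinP; apply: measurable_funTS; exact: measurable_funB.
  apply: filterS h01 => x h _; congr EFin.
  have /min_idPl -> : h0 x <= 1 by rewrite -h lerDl.
  by rewrite -h addrC addKr.
exists (fun x => Num.min (h0 x) 1); split => //.
- by move=> x; rewrite le_min h0p ler01/= ge_min lexx orbT.
- by move=> A mA; rewrite h0E// ae0.
- by move=> A mA; rewrite h1E// ae1.
Qed.

Lemma fourier_LinfP f : FLinf mu f -> has_fourier_Linf mu f (fourier_Linf mu f).
Proof. exact: (@xgetPex _ (fun=> 0) [set h | has_fourier_Linf mu f h]). Qed.

Lemma mseE f g : FLinf mu f -> inL2 mu g ->
  (mse P mu u v f g =
   \int[mu_u]_x (sqnorm (g x - (fourier_Linf mu f x)^* * g x))%:E +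
   \int[mu_w]_x (sqnorm ((fourier_Linf mu f x)^* * g x))%:E)%E.
Proof.
move=> /fourier_LinfP[_ hi _] gi; set h := fourier_Linf mu f in hi *.
have hji : inLinf mu (fun x => (h x)^*).
  have [mh [M hM]] := hi; split; first exact: cmeasurableJ.
  exists M; apply: filterS hM => x; apply: le_trans.
  by rewrite /normc; case: (h x) => a b /=; rewrite sqrrN.
have ki : inL2 mu (star_conv mu f g) by apply: inL2Z; exact: Linf_mul_inL2.
have e x : ((2 * pi) `^ (- (d%:R / 2)))%:C * star_conv mu f g x = (h x)^* * g x.
  rewrite /star_conv mulrA -rmorphM powRN mulVf ?mul1r//.
  by rewrite gt_eqF// powR_gt0// mulr_gt0// pi_gt0.
rewrite /mse /filter_output (extension_dist gsp_u gsp_w uncorr_uw spec_u spec_w _ gi ki).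
by congr (_ + _)%E; apply: eq_integral => x _; rewrite e.
Qed.

Variable fhat : 'rV[R]_d -> R.
Hypothesis m_fhat : measurable_fun setT fhat.
Hypothesis fhat01 : forall x, 0 <= fhat x <= 1.
Hypothesis fhat_u : forall A, measurable A -> mu_u A = (\int[mu]_(x in A) (fhat x)%:E)%E.
Hypothesis fhat_w : forall A, measurable A -> mu_w A = (\int[mu]_(x in A) (1 - fhat x)%:E)%E.

Let fhat_ge0 x : 0 <= fhat x. Proof. by have /andP[] := fhat01 x. Qed.
Let fhatC_ge0 x : 0 <= 1 - fhat x. Proof. by rewrite subr_ge0; have /andP[] := fhat01 x. Qed.
Let m_fhatC : measurable_fun setT (fun x => 1 - fhat x). Proof. exact: measurable_funB. Qed.

Let integral_u (r : 'rV[R]_d -> R) : measurable_fun setT r -> (forall x, 0 <= r x) ->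
  (\int[mu_u]_x (r x)%:E = \int[mu]_x (r x * fhat x)%:E)%E.
Proof. exact: (@ge0_integral_density _ _ _ mu mu_u _ m_fhat fhat_ge0 fhat_u). Qed.

Let integral_w (r : 'rV[R]_d -> R) : measurable_fun setT r -> (forall x, 0 <= r x) ->
  (\int[mu_w]_x (r x)%:E = \int[mu]_x (r x * (1 - fhat x))%:E)%E.
Proof. exact: (@ge0_integral_density _ _ _ mu mu_w _ m_fhatC fhatC_ge0 fhat_w). Qed.

(** Loss of a filter with transform [h] against the optimum; [optimal_error] is the part of the
    error that no filter removes. *)
Let excess h g x : R := sqnorm (g x * (h x - (fhat x)%:C)).
Let optimal_error g x : R := fhat x * (1 - fhat x) * sqnorm (g x).

Let m_fhatc : cmeasurable (fun x => (fhat x)%:C). Proof. exact: cmeasurableC. Qed.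

Let m_excess h g : cmeasurable h -> cmeasurable g -> measurable_fun setT (excess h g).
Proof.
move=> mh mg; apply: measurable_sqnorm; apply: cmeasurableM => //.
exact: cmeasurableB.
Qed.

Let m_error g : cmeasurable g -> measurable_fun setT (optimal_error g).
Proof.
move=> mg; apply: measurable_funM; last exact: measurable_sqnorm.
exact: measurable_funM.
Qed.

Let error_ge0 g x : 0 <= optimal_error g x.
Proof. by rewrite mulr_ge0 ?sqnorm_ge0// mulr_ge0. Qed.

(* Complete the square in [fourier_Linf mu f x], using that [mu_u] and [mu_w]
   have the densities [fhat] and [1 - fhat] with respect to [mu]. *)
Lemma mse_excess f g : FLinf mu f -> inL2 mu g ->
  (mse P mu u v f g = \int[mu]_x (excess (fourier_Linf mu f) g x)%:E +
    \int[mu]_x (optimal_error g x)%:E)%E.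
Proof.
move=> ff gi; rewrite mseE//; have [_ [mh _] _] := fourier_LinfP ff; have [mg _] := gi.
set h := fourier_Linf mu f in mh *.
have mhg : cmeasurable (fun x => (h x)^* * g x).
  by apply: cmeasurableM => //; exact: cmeasurableJ.
have m1 := measurable_sqnorm (cmeasurableB mg mhg); have m2 := measurable_sqnorm mhg.
rewrite integral_u//; last by move=> x; exact: sqnorm_ge0.
rewrite integral_w//; last by move=> x; exact: sqnorm_ge0.
rewrite -nnintD; [|exact: measurable_funM|exact: measurable_funM|
  by move=> x; rewrite mulr_ge0 ?sqnorm_ge0|by move=> x; rewrite mulr_ge0 ?sqnorm_ge0].
rewrite -nnintD; [|exact: m_excess|exact: m_error|by move=> x; exact: sqnorm_ge0|exact: error_ge0].
apply: eq_integral => x _; congr EFin; rewrite /excess /optimal_error.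
move: (h x) (g x) (fhat x) => a b r.
by rewrite !sqnormE !ReImE /=; ring.
Qed.

Definition wiener_filter : ('rV[R]_d -> R[i]) -> R[i] :=
  fun phi => cintegral mu (fun x => (fhat x)%:C * (fourier phi x)^*).

Lemma wiener_filterP : has_fourier_Linf mu wiener_filter (fun x => (fhat x)%:C).
Proof.
have fM x : normc (fhat x)%:C <= 1.
  by rewrite normcC ger0_norm//; have /andP[] := fhat01 x.
split=> //; first exact: (Linf_tempered_distribution mu_tempered m_fhatc fM).
by split => //; exists 1; exact: aeW.
Qed.

Lemma FLinf_wiener : FLinf mu wiener_filter.
Proof. by exists (fun x => (fhat x)%:C); exact: wiener_filterP. Qed.

(** The representative selected by [fourier_Linf] equals [fhat] a.e., so the excess integrates to
    0. *)
Lemma mse_wiener g : inL2 mu g -> mse P mu u v wiener_filter g = (\int[mu]_x (optimal_error g x)%:E)%E.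
Proof.
move=> gi; rewrite mse_excess//; last exact: FLinf_wiener.
have hP := fourier_LinfP FLinf_wiener; have [_ [mh _] _] := hP; have [mg _] := gi.
rewrite [X in (X + _)%E](_ : _ = 0)%E ?add0e//.
rewrite (_ : 0 = \int[mu]_x (0%R)%:E)%E; last by rewrite integral0.
apply: ge0_ae_eq_integral => //.
- by apply/measurable_EFinP; exact: m_excess.
- by move=> x _; rewrite lee_fin; exact: sqnorm_ge0.
apply: filterS (fourier_Linf_unique mu_tempered hP wiener_filterP) => x /= hx _.
by rewrite /excess hx subrr mulr0 sqnorm0.
Qed.

Lemma wiener_filter_optimal : mse_optimal P mu u v wiener_filter.
Proof.
split; first exact: FLinf_wiener.
move=> f' ff' g gi; rewrite mse_wiener// mse_excess// leeDr// nnint_ge0// => x.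
exact: sqnorm_ge0.
Qed.

Lemma mse_wiener_lty g : inL2 mu g -> (mse P mu u v wiener_filter g < +oo)%E.
Proof.
move=> gi; have [mg goo] := gi; rewrite mse_wiener//; apply: le_lt_trans goo.
apply: le_nnint; [exact: m_error|exact: measurable_sqnorm|exact: error_ge0|move=> x].
apply: ler_piMl; first exact: sqnorm_ge0.
by have /andP[f0 f1] := fhat01 x; apply: mulr_ile1 => //; rewrite gerBl.
Qed.

(** Comparing errors at a single nowhere vanishing [g] already forces the excess to vanish, so the
    transform of f' is [fhat] a.e.; its pairings with transforms determine the filter on Schwartz
    functions. *)
Lemma wiener_filter_unique f' : mse_optimal P mu u v f' ->
  forall phi, schwartz phi -> f' phi = wiener_filter phi.
Proof.
move=> [ff' opt] phi sphi; have [_ hi hE] := fourier_LinfP ff'.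
set h := fourier_Linf mu f' in hi hE *; have [mh _] := hi.
(* The comparison function is a negative power of [bracket]: square integrable and nowhere zero. *)
have [N iN] := tempered_bracketV mu_tempered; have gi := bracketV_inL2 iN.
set g := (fun x => _) in gi; have [mg _] := gi.
have : (mse P mu u v f' g <= mse P mu u v wiener_filter g)%E.
  by apply: opt => //; exact: FLinf_wiener.
have := mse_wiener_lty gi; rewrite (mse_wiener gi) (mse_excess ff' gi) => foo le.
(* The optimal error is finite, so it can be cancelled on both sides. *)
have ex0 : (\int[mu]_x (excess h g x)%:E = 0)%E.
  apply/eqP; rewrite eq_le nnint_ge0 ?andbT; last by move=> x; exact: sqnorm_ge0.
  move: foo le; case: (\int[mu]_x (optimal_error g x)%:E)%E (@nnint_ge0 _ _ _ mu _ (error_ge0 g)) => // r _ _.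
  by rewrite -leeBrDr// subee.
have hf : {ae mu, forall x, h x = (fhat x)%:C}.
  have : {ae mu, forall x, g x * h x = g x * (fhat x)%:C}.
    apply: L2sqdist0_ae; [exact: cmeasurableM|exact: cmeasurableM|].
    by rewrite -ex0; apply: eq_integral => x _; rewrite /excess mulrBr.
  apply: filterS => x; apply: mulfI; rewrite /g.
  by rewrite -(rmorph0 (@real_complex R)) (inj_eq (@complexI R)) invr_eq0 gt_eqF// bracketX_gt0.
rewrite -hE// /wiener_filter.
have [c1 c2] := cintegrable_Linf mu_tempered hi sphi.
have [_ fi _] := wiener_filterP.
have [c3 c4] := cintegrable_Linf mu_tempered fi sphi.
apply: eq_ReIm; rewrite /cintegral /=; congr fine; apply: ae_eq_integral => //.
- exact: measurable_int c1.
- exact: measurable_int c3.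
- by apply: filterS hf => x -> _.
- exact: measurable_int c2.
- exact: measurable_int c4.
- by apply: filterS hf => x -> _.
Qed.

(** For open [U], mu_u(U) is the integral of the nonnegative [fhat] over [U], which is zero exactly
    when [fhat] vanishes a.e. on [U]. The same open sets are thus removed on both sides. *)
Lemma ess_supp_wiener : ess_supp mu fhat = supp mu_u.
Proof.
rewrite /ess_supp /supp; congr (~` _); congr (\bigcup_(U in _) U).
apply/seteqP; split => U /= [oU hU]; have mU := open_measurable_rV oU; split => //.
- rewrite fhat_u//; rewrite (_ : 0 = \int[mu]_(x in U) (0%R)%:E)%E; last by rewrite integral0.
  apply: ae_eq_integral => //; first by apply/measurable_EFinP; exact: measurable_funTS.
  by apply: filterS hU => x hx /hx ->.
- move: hU; rewrite fhat_u// => h.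
  have mfU : measurable_fun U (EFin \o fhat).
    by apply/measurable_EFinP; exact: measurable_funTS.
  have /(ae_eq_integral_abs mu mU mfU) : (\int[mu]_(x in U) `|(EFin \o fhat) x| = 0)%E.
    by rewrite -h; apply: eq_integral => x _; rewrite /= ger0_norm.
  by apply: filterS => x /= hx Ux; apply: EFin_inj; exact: hx.
Qed.

Lemma mse_wiener_w g : inL2 mu g ->
  mse P mu u v wiener_filter g = (\int[mu_w]_x (fhat x * sqnorm (g x))%:E)%E.
Proof.
move=> gi; have [/measurable_sqnorm mg _] := gi; rewrite mse_wiener// integral_w//.
- by apply: eq_integral => x _; rewrite /optimal_error mulrAC.
- exact: measurable_funM.
- by move=> x; rewrite mulr_ge0 ?sqnorm_ge0.
Qed.

Lemma mse_wiener_u g : inL2 mu g ->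
  mse P mu u v wiener_filter g = (\int[mu_u]_x ((1 - fhat x) * sqnorm (g x))%:E)%E.
Proof.
move=> gi; have [/measurable_sqnorm mg _] := gi; rewrite mse_wiener// integral_u//.
- by apply: eq_integral => x _; rewrite /optimal_error -mulrA mulrC.
- exact: measurable_funM.
- by move=> x; rewrite mulr_ge0 ?sqnorm_ge0.
Qed.

End wiener_filter.

Theorem theorem4p12 (R : realType) (d : nat) (d_gt0 : (0 < d)%N)
    (d' : measure_display) (T : measurableType d') (P : probability T R)
    (u w : ('rV[R]_d -> R[i]) -> T -> R[i])
    (mu_u mu_w : {measure set 'rV[R]_d -> \bar R})
    (gsp_u : gsp P u) (gsp_w : gsp P w)
    (wss_u : wss P u) (wss_w : wss P w)
    (uncorr_uw : uncorrelated_gsp P u w)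
    (spec_u : spectral_measure P u mu_u) (spec_w : spectral_measure P w mu_w) :
  let v := gsp_add u w in
  let mu : {measure set 'rV[R]_d -> \bar R} := measure_add mu_u mu_w in
  exists f : ('rV[R]_d -> R[i]) -> R[i],
    [/\ mse_optimal P mu u v f,
        forall f', mse_optimal P mu u v f' ->
          forall phi, schwartz phi -> f' phi = f phi &
        exists fhat : 'rV[R]_d -> R,
          [/\ has_fourier_Linf mu f (fun xi => (fhat xi)%:C),
              density mu mu_u fhat /\
              (forall h, density mu mu_u h ->
                 {ae mu, forall xi, h xi = fhat xi}),
              {ae mu, forall xi, 0 <= fhat xi <= 1},
              ess_supp mu fhat = supp mu_u &
              forall g, inL2 mu g ->
                mse P mu u v f g
                  = (\int[mu_w]_xi (fhat xi * sqnorm (g xi))%:E)%E /\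
                mse P mu u v f g
                  = (\int[mu_u]_xi ((1 - fhat xi) * sqnorm (g xi))%:E)%E]].
Proof.
move=> v mu; have [ru _ _] := spec_u.
have [fhat [mf f01 fu fw]] := spectral_densities spec_u spec_w.
exists (wiener_filter mu_u mu_w fhat); split.
- exact: (wiener_filter_optimal gsp_u gsp_w uncorr_uw spec_u spec_w mf f01 fu fw).
- by move=> f' of' phi sphi; exact: (wiener_filter_unique gsp_u gsp_w uncorr_uw spec_u spec_w mf f01 fu fw).
exists fhat; split => //.
- exact: (wiener_filterP spec_u spec_w mf f01).
- split; first by split.
  (* Uniqueness comes from the finiteness of [mu_u] on compact sets. *)
  move=> h [mh hE]; apply: (density_ae_unique_radon ru) => // x.
  by have /andP[] := f01 x.
- exact: aeW.
- exact: (ess_supp_wiener mf f01 fu).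
- move=> g gi; split.
    exact: (mse_wiener_w gsp_u gsp_w uncorr_uw spec_u spec_w mf f01 fu fw).
  exact: (mse_wiener_u gsp_u gsp_w uncorr_uw spec_u spec_w mf f01 fu fw).
Qed.
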